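(* Let $M\subset\mathbb C^{2p}$ be a quadratic submanifold defined by $z_{p+j}=h_j(z',\bar z')+q_j(\bar z')$, $1\le j\le p$, where $h_j$ is a homogeneous quadratic polynomial in $z',\bar z'$ without holomorphic or anti-holomorphic terms and $q_j$ is a homogeneous quadratic polynomial in $\bar z'$. Suppose that $M$ satisfies condition E, i.e. $M$ admits the maximum number $2^p$ of deck transformations (with $q^{-1}(0)=\{0\}$) and $M$ has $2p$ distinct eigenvalues. Then there are integers $e_*,h_*,s_*\ge 0$ with $e_*+h_*+2s_*=p$, numbers $\gamma_j$ with $$0<\gamma_e<\tfrac12\ (1\le e\le e_* ),\quad \tfrac12<\gamma_h<\infty\ (e_*<h\le e_*+h_* ),\quad \operatorname{Re}\gamma_s>\tfrac12,\ \operatorname{Im}\gamma_s>0\ (e_*+h_*<s\le p-s_* ),$$ and a matrix $\mathbf B\in GL_p(\mathbb C)$ such that $M$ is holomorphically equivalent to $$Q_{\mathbf B,\boldsymbol\gamma}\colon\quad z_{p+j}=L_j^2(z',\bar z'),\quad 1\le j\le p,\qquad (L_1,\dots,L_p)^t=\mathbf B(z'-2\boldsymbol\gamma\bar z'),$$ where $$\boldsymbol\gamma=\begin{pmatrix}\boldsymbol\gamma_{e_*}&0&0&0\\0&\boldsymbol\gamma_{h_*}&0&0\\0&0&0&\boldsymbol\gamma_{s_*}\\0&0&\mathbf I_{s_*}-\overline{\boldsymbol\gamma}_{s_*}&0\end{pmatrix},$$ $\boldsymbol\gamma_{e_*}=\operatorname{diag}(\gamma_1,\dots,\gamma_{e_*})$,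 $\boldsymbol\gamma_{h_*}=\operatorname{diag}(\gamma_{e_*+1},\dots,\gamma_{e_*+h_*})$, $\boldsymbol\gamma_{s_*}=\operatorname{diag}(\gamma_{e_*+h_*+1},\dots,\gamma_{p-s_*})$, and $\mathbf I_{s_*}$ is the identity matrix of size $s_*$. Moreover, $\mathbf B$ is uniquely determined up to the equivalence relation $$\mathbf B\sim(\operatorname{diag}_\nu\mathbf d)^{-1}\,\mathbf B\,\operatorname{diag}\mathbf a ,$$ where $\nu$ is any permutation of $\{1,\dots,p\}$, $\mathbf d\in(\mathbb C^* )^p$, $\operatorname{diag}_\nu\mathbf d$ is the $p\times p$ matrix whose $(j,\nu(j))$ entry is $d_j$ for each $j$ and whose other entries vanish, and $\mathbf a=(a_1,\dots,a_p)$ satisfies $a_e,a_h\in\mathbb R\setminus\{0\}$ and $a_{s+s_*}=\overline{a_s}\in\mathbb C\setminus\{0\}$ for all $e,h,s$ in the ranges above. (That is, for $\boldsymbol\gamma$ fixed, two such quadrics $Q_{\mathbf B,\boldsymbol\gamma}$ and $Q_{\tilde{\mathbf B},\boldsymbol\gamma}$ are holomorphically equivalent if and only if $\mathbf B\sim\tilde{\mathbf B}$.)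
   Context: Write $z=(z',z'')\in\mathbb C^p\times\mathbb C^p$. For $M\colon z_{p+j}=E_j(z',\bar z')$, $1\le j\le p$ (a germ at $0$, real dimension $2p$), the complexification is $\mathcal M=\{(z,w)\in\mathbb C^{2p}\times\mathbb C^{2p}\colon z_{p+j}=E_j(z',w'),\ w_{p+j}=\bar E_j(w',z'),\ 1\le j\le p\}$ ($\bar E_j$ has the complex conjugate coefficients), with coordinates $(z',w')$; $\pi_1(z,w)=z$ on $\mathcal M$; $\rho_0(z',w')=(\bar w',\bar z')$. A deck transformation is a germ of biholomorphism $F$ of $(\mathcal M,0)$ with $\pi_1\circ F=\pi_1$. If $q^{-1}(0)=\{0\}$ for $q=(q_1,\dots,q_p)$, then $\pi_1$ is a $2^p$-to-$1$ branched covering near $0$. If in addition there are exactly $2^p$ deck transformations, they form an abelian group of involutions having a unique set of $p$ generators $\tau_{11},\dots,\tau_{1p}$ each of which fixes a hypersurface pointwise; put $\tau_1=\tau_{11}\cdots\tau_{1p}$, $\tau_2=\rho_0\tau_1\rho_0$, $\sigma=\tau_1\tau_2$. ''$M$ has $2p$ distinct eigenvalues'' means that the linear part of $\sigma$ at $0$ has $2p$ distinct eigenvalues. Holomorphic equivalence means equivalence by a germ of biholomorphism of $(\mathbb C^{2p},0)$. *)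

(* Defs.v *)
From HB Require Import structures.
From mathcomp Require Import all_boot all_order all_fingroup all_algebra.
From mathcomp Require Import complex.
From mathcomp Require Import boolp classical_sets functions reals.
From mathcomp Require Import topology normedtype derive.

Set Implicit Arguments.
Unset Strict Implicit.
Unset Printing Implicit Defensive.

Import Order.TTheory GRing.Theory Num.Theory.
Import numFieldNormedType.Exports.

Local Open Scope classical_set_scope.
Local Open Scope ring_scope.
Local Open Scope complex_scope.

(* Points of C^n are row vectors 'rV[R[i]]_n.  A point of C^(2p) is a
   'rV[R[i]]_(p + p), whose halves (z', z'') are lsubmx z and rsubmx z. *)

Section Germs.
Variable k : numFieldType.

(* k is R[i] in all uses below; `differentiable' then means complex
   differentiable, as 'rV[k]_n and W are normed modules over k. *)
Definition holomorphic_at0 (m : nat) (W : normedModType k)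
    (f : 'rV[k]_m -> W) : Prop :=
  \forall x \near (0 : 'rV[k]_m), differentiable f x.

Definition germ_eq (m n : nat) (f g : 'rV[k]_m -> 'rV[k]_n) : Prop :=
  \forall x \near (0 : 'rV[k]_m), f x = g x.

Definition germ_biholo (n : nat) (f : 'rV[k]_n -> 'rV[k]_n) : Prop :=
  [/\ f 0 = 0, holomorphic_at0 f &
      exists g : 'rV[k]_n -> 'rV[k]_n,
        [/\ g 0 = 0, holomorphic_at0 g, germ_eq (f \o g) id &
            germ_eq (g \o f) id]].

(* Equivalence of the germs at 0 of the sets M and N. *)
Definition holo_equiv (n : nat) (M N : set 'rV[k]_n) : Prop :=
  exists2 f : 'rV[k]_n -> 'rV[k]_n, germ_biholo f &
    \forall x \near (0 : 'rV[k]_n), M x <-> N (f x).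

(* F fixes pointwise the germ at 0 of some hypersurface {u = 0}. *)
Definition fixes_hypersurface (n : nat) (F : 'rV[k]_n -> 'rV[k]_n) :
    Prop :=
  exists u : 'rV[k]_n -> k^o,
    [/\ holomorphic_at0 u, u 0 = 0,
        ~ (\forall x \near (0 : 'rV[k]_n), u x = 0) &
        \forall x \near (0 : 'rV[k]_n), u x = 0 -> F x = x].

(* The subgroup, of the group of germs of biholomorphisms of (C^n, 0),
   generated by the germs t_i. *)
Inductive germ_generated (n : nat) (I : Type)
    (t : I -> 'rV[k]_n -> 'rV[k]_n) :
    ('rV[k]_n -> 'rV[k]_n) -> Prop :=
| Gen_base i : germ_generated t (t i)
| Gen_id : germ_generated t id
| Gen_comp F G :
    germ_generated t F -> germ_generated t G -> germ_generated t (F \o G)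
| Gen_inv F G :
    germ_generated t F -> germ_eq (F \o G) id -> germ_eq (G \o F) id ->
    germ_generated t G
| Gen_eq F G : germ_generated t F -> germ_eq F G -> germ_generated t G.

End Germs.

Section Quadric.
Variables (R : realType) (p : nat).

Local Notation C := (R[i]).
Local Notation Cp := ('rV[C]_p).
Local Notation C2p := ('rV[C]_(p + p)).

Definition conjv (m n : nat) (A : 'M[C]_(m, n)) : 'M[C]_(m, n) :=
  map_mx (fun z => z^*%C) A.

(* The form h_j(z', w') = sum_(k, l) (H j)_kl z_k w_l has no pure terms, and
   q_j(w') = sum_(k, l) (K j)_kl w_k w_l is an arbitrary quadratic form. *)
Definition hmap (H : 'I_p -> 'M[C]_p) (z w : Cp) : Cp :=
  \row_j \sum_k \sum_l H j k l * z 0 k * w 0 l.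

Definition qmap (K : 'I_p -> 'M[C]_p) (w : Cp) : Cp :=
  \row_j \sum_k \sum_l K j k l * w 0 k * w 0 l.

Definition Emap (H K : 'I_p -> 'M[C]_p) (z w : Cp) : Cp :=
  hmap H z w + qmap K w.

Definition Ebar (H K : 'I_p -> 'M[C]_p) : Cp -> Cp -> Cp :=
  Emap (fun j => conjv (H j)) (fun j => conjv (K j)).

Definition quadM (H K : 'I_p -> 'M[C]_p) : set C2p :=
  [set z | rsubmx z = Emap H K (lsubmx z) (conjv (lsubmx z))].

Definition complexification (H K : 'I_p -> 'M[C]_p) : set (C2p * C2p) :=
  [set zw | rsubmx zw.1 = Emap H K (lsubmx zw.1) (lsubmx zw.2) /\
            rsubmx zw.2 = Ebar H K (lsubmx zw.2) (lsubmx zw.1)].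

(* The point of the complexification with coordinates x = (z', w'). *)
Definition cplx_point (H K : 'I_p -> 'M[C]_p) (x : C2p) : C2p * C2p :=
  (row_mx (lsubmx x) (Emap H K (lsubmx x) (rsubmx x)),
   row_mx (rsubmx x) (Ebar H K (rsubmx x) (lsubmx x))).

Lemma range_cplx_point (H K : 'I_p -> 'M[C]_p) :
  range (cplx_point H K) = complexification H K.
Proof.
apply/seteqP; split=> [_ [x _ <-]|[z w] /= [Ez Ew]].
  by split; rewrite /= !row_mxKl row_mxKr.
exists (row_mx (lsubmx z) (lsubmx w)) => //.
by rewrite /cplx_point !row_mxKl !row_mxKr -Ez -Ew !hsubmxK.
Qed.

Definition pi1 (H K : 'I_p -> 'M[C]_p) (x : C2p) : C2p := (cplx_point H K x).1.

Definition deck (H K : 'I_p -> 'M[C]_p) (F : C2p -> C2p) : Prop :=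
  germ_biholo F /\ germ_eq (pi1 H K \o F) (pi1 H K).

Definition max_deck (H K : 'I_p -> 'M[C]_p) : Prop :=
  exists D : 'I_(2 ^ p) -> C2p -> C2p,
    [/\ forall i, deck H K (D i),
        forall i j, germ_eq (D i) (D j) -> i = j &
        forall F, deck H K F -> exists i, germ_eq F (D i)].

Definition deck_generators (H K : 'I_p -> 'M[C]_p) (t : 'I_p -> C2p -> C2p) :
    Prop :=
  [/\ forall j, deck H K (t j), forall j, fixes_hypersurface (t j) &
      forall F, deck H K F -> germ_generated t F].

Definition rho0 (x : C2p) : C2p :=
  row_mx (conjv (rsubmx x)) (conjv (lsubmx x)).

Definition tau1 (t : 'I_p -> C2p -> C2p) : C2p -> C2p :=
  \big[(fun F G : C2p -> C2p => F \o G)/id]_(j < p) t j.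

Definition tau2 (t : 'I_p -> C2p -> C2p) : C2p -> C2p :=
  rho0 \o tau1 t \o rho0.

Definition sigma (t : 'I_p -> C2p -> C2p) : C2p -> C2p := tau1 t \o tau2 t.

Definition distinct_eigenvalues (n : nat) (A : 'M[C]_n) : Prop :=
  exists mu : n.-tuple C, uniq mu /\ all (eigenvalue A) mu.

(* The family t of generators below is unique up to reordering, and sigma t
   does not depend on the order since the deck transformations commute. *)
Definition conditionE (H K : 'I_p -> 'M[C]_p) : Prop :=
  [/\ [set w | qmap K w = 0] = [set 0],
      max_deck H K &
      exists2 t : 'I_p -> C2p -> C2p, deck_generators H K t &
        distinct_eigenvalues ('J (sigma t) 0)].

Definition Lmap (B g : 'M[C]_p) (z w : Cp) : Cp :=
  (B *m (z^T - 2 *: (g *m w^T)))^T.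

Definition quadQ (B g : 'M[C]_p) : set C2p :=
  [set z | forall j : 'I_p,
     rsubmx z 0 j = (Lmap B g (lsubmx z) (conjv (lsubmx z)) 0 j) ^+ 2].

(* The matrix diag_nu d. *)
Definition perm_diag (nu : 'S_p) (d : 'rV[C]_p) : 'M[C]_p :=
  \matrix_(j, k) (if k == nu j then d 0 j else 0).

End Quadric.

Section NormalForm.
Variables (R : realType) (p e h s : nat).
Hypothesis Ep : (e + h + (s + s))%N = p.

Local Notation C := (R[i]).

Definition gamma_range (ge : 'rV[R]_e) (gh : 'rV[R]_h) (gs : 'rV[C]_s) : Prop :=
  [/\ forall i, 0 < ge 0 i < 2^-1,
      forall i, 2^-1 < gh 0 i &
      forall i, 2^-1 < complex.Re (gs 0 i) /\ 0 < complex.Im (gs 0 i)].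

Definition gamma_mx (ge : 'rV[R]_e) (gh : 'rV[R]_h) (gs : 'rV[C]_s) : 'M[C]_p :=
  castmx (Ep, Ep)
    (block_mx
       (block_mx (diag_mx (map_mx (real_complex R) ge)) 0
                 0 (diag_mx (map_mx (real_complex R) gh))) 0
       0 (block_mx 0 (diag_mx gs)
                   (1%:M - conjv (diag_mx gs)) 0)).

Definition a_vector (ae : 'rV[R]_e) (ah : 'rV[R]_h) (as_ : 'rV[C]_s) :
    'rV[C]_p :=
  castmx (erefl 1%N, Ep)
    (row_mx (row_mx (map_mx (real_complex R) ae) (map_mx (real_complex R) ah))
            (row_mx as_ (conjv as_))).

Definition B_equiv (B B' : 'M[C]_p) : Prop :=
  exists (nu : 'S_p) (d : 'rV[C]_p)
         (ae : 'rV[R]_e) (ah : 'rV[R]_h) (as_ : 'rV[C]_s),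
    [/\ forall j, d 0 j != 0, forall i, ae 0 i != 0, forall i, ah 0 i != 0,
        forall i, as_ 0 i != 0 &
        B' = invmx (perm_diag nu d) *m B *m diag_mx (a_vector ae ah as_)].

End NormalForm.

(* Main.v *)
(* c^-1 F(c x) is a deck transformation whenever F is; as there are finitely many
   of them, F coincides with one of its rescalings and hence is linear.  The linear
   deck transformations are commuting involutions, and in a suitable basis they are
   the sign changes of the coordinates of w - zN/2.  So E(z, w) is a sum of squares
   of these coordinates plus a holomorphic term, i.e. M is equivalent to Q_(A, G)
   with G = (N^T)^-1.  An eigenvalue mu of sigma yields the eigenvalue
   (1 + mu)^2 / mu of N conj(N), so condition E gives p distinct ones, none of them
   0 or 4, and the antilinear map v |-> conj(v N) on the corresponding eigenvectors
   brings G to the form gamma.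

   For uniqueness, the second order terms of an equivalence from Q_(B, g) to
   Q_(B', g') along the curves t |-> t z show that some P with g' conj(P) = P g
   satisfies B' P = diag_nu(d) B; when g conj(g) has distinct eigenvalues and
   g' = g, P is diagonal.

   The facts needed on functions that are merely assumed differentiable (strict
   differentiability at 0, no t conj(t) term in expansions, no isolated zeros in
   two variables) follow from: Re f takes the value Re f(0) on every small circle
   |z| = r, by Rolle's theorem applied to Im of a primitive of (f - f(0)) / z. *)
Require Import Defs.
From HB Require Import structures.
From mathcomp Require Import all_boot all_order all_fingroup all_algebra complex.
From mathcomp Require Import all_classical all_reals all_analysis ring lra.

Set Implicit Arguments.
Unset Strict Implicit.
Unset Printing Implicit Defensive.

Import Order.TTheory GRing.Theory Num.Theory ComplexField.Normc.
Import numFieldNormedType.Exports.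

Local Open Scope classical_set_scope.
Local Open Scope ring_scope.

(** * Goursat's theorem *)

Section ComplexNorm.
Variable R : rcfType.
Implicit Types z : R[i].

(** Only differentiability near 0 is assumed, so a comparison of values on small circles takes the
    place of power series, Cauchy estimates and the maximum principle.

    The values 0 and 4 are excluded because the fibre of mu |-> (1 + mu)^2 / mu is {mu, 1 / mu} and
    shrinks to one point exactly at mu = -1 and mu = 1; the 2p eigenvalues of sigma thus require p
    fibres with two points each.

    For a real simple eigenvalue l of W = N conj(N), the antilinear map preserves the eigenline and
    acts on a vector of it by some c with l = |c|^2. Hence l > 0, the entry of gamma is l^(-1/2),
    and the threshold l = 4 becomes gamma = 1/2. A nonreal pair l, conj(l) is exchanged by the
    antilinear map; here gamma is the root of gamma (1 - gamma) = 1 / l with real part above 1/2,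
    and it fixes the relative scaling of the two eigenvectors.

    The linear part of sigma depends on N alone: a hypersurface fixed by a generator meets the plane
    of any two reflected coordinates outside 0, so a generator reflects at most one coordinate, and
    the p generators together reflect each coordinate exactly once. *)

Lemma normc_normr z : `|z| = (normc z)%:C%C. Proof. by []. Qed.

Lemma normc_ge0 z : 0 <= normc z.
Proof. by case: z => a b; exact: sqrtr_ge0. Qed.

Lemma normc_eq0 z : (normc z == 0) = (z == 0).
Proof.
by apply/eqP/eqP => [/eq0_normc//|->]; rewrite normc0.
Qed.

Lemma normc_gt0 z : (0 < normc z) = (z != 0).
Proof. by rewrite lt_def normc_eq0 normc_ge0 andbT. Qed.

Lemma normcX z n : normc (z ^+ n) = normc z ^+ n.
Proof. by elim: n => [|n IH]; rewrite ?normc1 // !exprS normcM IH. Qed.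

Lemma normc_distC z w : normc (z - w) = normc (w - z).
Proof. by rewrite -opprB normcN. Qed.

Lemma ler_normcB z w : normc z - normc w <= normc (z - w).
Proof. by rewrite lerBlDr; apply: le_trans (le_normcD _ _); rewrite subrK. Qed.

Lemma normc_real (x : R) : normc x%:C%C = `|x|.
Proof. by rewrite /= expr0n /= addr0 sqrtr_sqr. Qed.

Lemma normc_i : normc 'i%C = 1 :> R.
Proof. by rewrite /= expr0n /= add0r expr1n sqrtr1. Qed.

Lemma ler_Re_normc z : `|complex.Re z| <= normc z.
Proof.
case: z => a b /=; rewrite -sqrtr_sqr ler_wsqrtr // lerDl; exact: sqr_ge0.
Qed.

Lemma ler_Im_normc z : `|complex.Im z| <= normc z.
Proof.
case: z => a b /=; rewrite -sqrtr_sqr ler_wsqrtr // lerDr; exact: sqr_ge0.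
Qed.

Lemma normc_le_ReIm z : normc z <= `|complex.Re z| + `|complex.Im z|.
Proof.
rewrite [in leLHS](complexE z); apply: le_trans (le_normcD _ _) _.
by rewrite normcM normc_i mul1r !normc_real.
Qed.

End ComplexNorm.

Section Goursat.
Variable R : realType.
Local Notation C := R[i].
Implicit Types (f : C -> C) (z w l : C) (x y : R).

Lemma real_primitive (g : R -> R) (r : R) :
  (forall x : R, `|x| <= r -> {for x, continuous g}) ->
  exists G : R -> R, forall x : R, `|x| < r -> is_derive x 1 G (g x).
Proof.
move=> gc.
exists (fun y => \int[lebesgue_measure]_(t in `[(- r)%R, y]) g t)%R => x xr.
have [xl xu] : - r < x /\ x < r by move: xr; rewrite ltr_norml => /andP[].
have gi : lebesgue_measure.-integrable `[(- r)%R, r] (EFin \o g).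
  apply: continuous_compact_integrable; first exact: segment_compact.
  apply: continuous_in_subspaceT => t; rewrite inE /= in_itv /= => tr.
  by apply: gc; rewrite ler_norml.
have xr' : `|x| <= r by exact: ltW.
have [dF EF] := continuous_FTC1_closed xu gi xl (gc x xr').
by apply: DeriveDef; [exact: dF|rewrite -derive1E; exact: EF].
Qed.

(** Locating [c] by [|c - a| <= |b - a|] rather than between ordered endpoints lets later estimates
    ignore the order of [a] and [b]. *)
Lemma real_mvt (F f : R -> R) (r a b : R) :
  (forall x, `|x| < r -> is_derive x 1 F (f x)) -> `|a| < r -> `|b| < r ->
  exists2 c, `|c| < r /\ `|c - a| <= `|b - a| & F b - F a = f c * (b - a).
Proof.
move=> dF.
have main u v : u < v -> `|u| < r -> `|v| < r ->
    exists2 c, u < c < v & F v - F u = f c * (v - u).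
  move=> uv; rewrite !ltr_norml => /andP[ul ur] /andP[vl vr].
  have dFx x : u <= x <= v -> is_derive x 1 F (f x).
    by move=> xuv; apply: dF; rewrite ltr_norml; lra.
  have [||c] := @MVT R F f u v uv.
  - by move=> x; rewrite in_itv /= => xuv; apply: dFx; lra.
  - apply: continuous_in_subspaceT => x; rewrite inE /= in_itv /= => /dFx dx.
    by apply: differentiable_continuous; apply/derivable1_diffP.
  by rewrite in_itv /= => cuv E; exists c.
move=> ar br; have := ar; have := br; rewrite !ltr_norml => br' ar'.
have [ab|ba|->] := ltgtP a b.
- have [c cab E] := main a b ab ar br; exists c => //.
  by rewrite ltr_norml !ger0_norm; lra.
- have [c cab E] := main b a ba br ar; exists c; last by lra.
  by rewrite ltr_norml !ler0_norm; lra.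
- by exists b; rewrite ?subrr ?mulr0.
Qed.

(** Real and imaginary parts are kept apart because the mean value theorem holds only for each of
    them separately. *)
Definition cprim (r : R) (G g : R -> C) := forall x, `|x| < r ->
  is_derive x 1 (fun y => complex.Re (G y)) (complex.Re (g x)) /\
  is_derive x 1 (fun y => complex.Im (G y)) (complex.Im (g x)).

Definition rcont (g : R -> C) (x : R) := forall e : R, 0 < e ->
  exists2 d : R, 0 < d & forall h, `|h| < d -> normc (g (x + h) - g x) <= e.

Lemma rcont_continuous (phi : C -> R) (g : R -> C) x :
  (forall z w, phi (z - w) = phi z - phi w) ->
  (forall z, `|phi z| <= normc z) ->
  rcont g x -> {for x, continuous (phi \o g)}.
Proof.
move=> phiB phile gc; apply/cvgrPdist_le => /= e e0.
have [d d0 gd] := gc e e0; near=> t.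
rewrite -phiB; apply: le_trans (phile _) _; rewrite normc_distC.
have -> : t = x + (t - x) by ring.
apply: gd; near: t; apply/nbhs_ballP; exists d => // t /=.
by rewrite /ball /= distrC.
Unshelve. all: by end_near. Qed.

Lemma ReB z w : complex.Re (z - w) = complex.Re z - complex.Re w.
Proof. by case: z w => [a b] [c d]. Qed.

Lemma ImB z w : complex.Im (z - w) = complex.Im z - complex.Im w.
Proof. by case: z w => [a b] [c d]. Qed.

Lemma ex_cprim (g : R -> C) (r : R) :
  (forall x : R, `|x| <= r -> rcont g x) -> exists G, cprim r G g.
Proof.
move=> gc.
have [|F dF] := @real_primitive (fun x => complex.Re (g x)) r.
  move=> x /gc; apply: rcont_continuous; [exact: ReB|exact: ler_Re_normc].
have [|G dG] := @real_primitive (fun x => complex.Im (g x)) r.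
  move=> x /gc; apply: rcont_continuous; [exact: ImB|exact: ler_Im_normc].
by exists (fun x => (F x +i* G x)%C) => x xr; split; [exact: dF|exact: dG].
Qed.

(** The mean value theorem yields different intermediate points for the two parts; adding both
    bounds costs the factor 2. *)
Lemma cprim_bound (G g : R -> C) (r a b M : R) : cprim r G g ->
  `|a| < r -> `|b| < r ->
  (forall x, `|x| < r -> `|x - a| <= `|b - a| -> normc (g x) <= M) ->
  normc (G b - G a) <= 2 * M * `|b - a|.
Proof.
move=> dG ar br gM.
have [c1 [c1r c1a] E1] := real_mvt (fun x xr => (dG x xr).1) ar br.
have [c2 [c2r c2a] E2] := real_mvt (fun x xr => (dG x xr).2) ar br.
apply: le_trans (normc_le_ReIm _) _.
rewrite ReB ImB E1 E2 !normrM -mulrDl ler_wpM2r // mulr2n mulrDl mul1r.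
apply: lerD.
  exact: le_trans (ler_Re_normc _) (gM _ c1r c1a).
exact: le_trans (ler_Im_normc _) (gM _ c2r c2a).
Qed.

Lemma cprim_affine (r : R) (alpha beta : C) :
  cprim r (fun x => alpha * x%:C%C + beta * ((x ^+ 2 / 2)%:C)%C)
          (fun x => alpha + beta * x%:C%C).
Proof.
have aux (a b x : R) : is_derive x 1 (fun y => a * y + b * (y ^+ 2 / 2)) (a + b * x).
  apply: is_derive_eq; rewrite /GRing.scale /=; field => //.
move=> x _; case: alpha beta => [a1 a2] [b1 b2] /=; split.
- have -> : (fun y => complex.Re ((a1 +i* a2) * y%:C + (b1 +i* b2) * (y ^+ 2 / 2)%:C))%C
    = (fun y => a1 * y + b1 * (y ^+ 2 / 2)).
    by apply/funext => y /=; ring.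
  by rewrite (_ : _ - _ = b1 * x); [exact: aux|ring].
- have -> : (fun y => complex.Im ((a1 +i* a2) * y%:C + (b1 +i* b2) * (y ^+ 2 / 2)%:C))%C
    = (fun y => a2 * y + b2 * (y ^+ 2 / 2)).
    by apply/funext => y /=; ring.
  by rewrite (_ : _ * _ + _ = b2 * x); [exact: aux|ring].
Qed.

Lemma cprimB (r : R) (F G f g : R -> C) : cprim r F f -> cprim r G g ->
  cprim r (fun x => F x - G x) (fun x => f x - g x).
Proof.
move=> dF dG x xr; have [F1 F2] := dF x xr; have [G1 G2] := dG x xr; split.
- have -> : (fun y => complex.Re (F y - G y)) =
    (fun y => complex.Re (F y)) - (fun y => complex.Re (G y)).
    by apply/funext => y; rewrite ReB.
  by rewrite ReB; apply: is_deriveB.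
- have -> : (fun y => complex.Im (F y - G y)) =
    (fun y => complex.Im (F y)) - (fun y => complex.Im (G y)).
    by apply/funext => y; rewrite ImB.
  by rewrite ImB; apply: is_deriveB.
Qed.

Definition cder f z l := forall e : R, 0 < e -> exists2 d : R, 0 < d &
  forall h, normc h < d -> normc (f (z + h) - f z - l * h) <= e * normc h.

Definition ccont f z := forall e : R, 0 < e -> exists2 d : R, 0 < d &
  forall h, normc h < d -> normc (f (z + h) - f z) <= e.

Lemma cder_ccont f z l : cder f z l -> ccont f z.
Proof.
move=> df e e0; have [d d0 fd] := df 1 ltr01.
have l0 : 0 < 1 + normc l by rewrite ltr_pwDl ?normc_ge0.
exists (Num.min d (e / (1 + normc l))); first by rewrite lt_min d0 divr_gt0.
move=> h; rewrite lt_min ltr_pdivlMr // => /andP[hd he].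
have -> : f (z + h) - f z = (f (z + h) - f z - l * h) + l * h by ring.
apply: le_trans (le_normcD _ _) _; rewrite normcM.
have := fd h hd; have := normc_ge0 h; nra.
Qed.

End Goursat.

(** * Boundary integrals of rectangles and bisection *)

Section Rectangles.
Variable R : realType.
Local Notation C := R[i].
Implicit Types (f : C -> C) (z w l : C) (x y : R).

(* The integral of f along the boundary of [a, b] x [c, d], where A y and B x
   are primitives of f on the horizontal and vertical lines through i y and x. *)
Definition bdint (A B : R -> R -> C) (a b c d : R) : C :=
  A c b - A c a + 'i%C * (B b d - B b c) - (A d b - A d a) - 'i%C * (B a d - B a c).

(** The rectangle [a, b] x [c, d] is encoded as the pair [((a, b), (c, d))]. *)
Definition quarter (Q Q' : (R * R) * (R * R)) :=
  [/\ Q.1.1 <= Q'.1.1, Q'.1.2 <= Q.1.2, Q'.1.2 - Q'.1.1 = (Q.1.2 - Q.1.1) / 2 &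
   [/\ Q.2.1 <= Q'.2.1, Q'.2.2 <= Q.2.2 & Q'.2.2 - Q'.2.1 = (Q.2.2 - Q.2.1) / 2]].

Definition nonempty_rect (Q : (R * R) * (R * R)) := Q.1.1 <= Q.1.2 /\ Q.2.1 <= Q.2.2.

Definition bdintQ A B Q := bdint A B Q.1.1 Q.1.2 Q.2.1 Q.2.2.

(** The inner edges cancel in the sum over the four quarters, so by the triangle inequality one of
    them carries at least a fourth of the integral. *)
Lemma bdint_quarter A B Q : nonempty_rect Q -> exists Q',
  quarter Q Q' /\ normc (bdintQ A B Q) <= 4 * normc (bdintQ A B Q').
Proof.
move: Q => [[a b] [c d]] [/= ab cd]; rewrite /quarter /bdintQ /=.
have [m mE] : exists m, m = (a + b) / 2 by exists ((a + b) / 2).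
have [n nE] : exists n, n = (c + d) / 2 by exists ((c + d) / 2).
have E : bdint A B a b c d =
  bdint A B a m c n + bdint A B m b c n + (bdint A B a m n d + bdint A B m b n d).
  by rewrite /bdint; ring.
have := le_normcD (bdint A B a m c n) (bdint A B m b c n).
have := le_normcD (bdint A B a m n d) (bdint A B m b n d).
have := le_normcD (bdint A B a m c n + bdint A B m b c n)
                  (bdint A B a m n d + bdint A B m b n d).
rewrite -E => h1 h2 h3.
set I := normc (bdint A B a b c d) in h1 *.
have [k1|k1] := leP I (4 * normc (bdint A B a m c n)).
  by exists ((a, m), (c, n)) => /=; split; [split; last split|]; rewrite /=; lra.
have [k2|k2] := leP I (4 * normc (bdint A B m b c n)).
  by exists ((m, b), (c, n)) => /=; split; [split; last split|]; rewrite /=; lra.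
have [k3|k3] := leP I (4 * normc (bdint A B a m n d)).
  by exists ((a, m), (n, d)) => /=; split; [split; last split|]; rewrite /=; lra.
have [k4|k4] := leP I (4 * normc (bdint A B m b n d)).
  by exists ((m, b), (n, d)) => /=; split; [split; last split|]; rewrite /=; lra.
by lra.
Qed.

Lemma normc_le_max (x y s : R) : `|x| <= s -> `|y| <= s -> normc (x +i* y)%C <= 2 * s.
Proof. by move=> xs ys; have /= := normc_le_ReIm (x +i* y)%C; lra. Qed.

Variables (f : C -> C) (r : R) (A B : R -> R -> C).
Hypothesis dA : forall y, `|y| < r -> cprim r (A y) (fun x => f (x +i* y)%C).
Hypothesis dB : forall x, `|x| < r -> cprim r (B x) (fun y => f (x +i* y)%C).

(** An affine function has an explicit primitive and contributes nothing around a rectangle; only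
    the remainder [h] of the first-order expansion of [f] counts. It is at most 6 e s, so each of
    the four sides, of length at most 2 s, contributes at most 2 (6 e s) (2 s) = 24 e s^2. *)
Lemma bdint_local (u v e : R) l : cder f (u +i* v)%C l -> 0 < e ->
  exists2 s0, 0 < s0 & forall a b c d s, s < s0 ->
   [/\ `|a| < r, `|b| < r, `|c| < r & `|d| < r] ->
   [/\ `|a - u| <= s, `|b - u| <= s, `|c - v| <= s & `|d - v| <= s] ->
   normc (bdint A B a b c d) <= 96 * e * s ^+ 2.
Proof.
move=> df e0; have [d0 d0_gt0 fd] := df e e0.
exists (d0 / 6); first by rewrite divr_gt0.
move=> a b c d s ss0 [ar br cr dr] [au bu cv dv].
have s0 : 0 <= s by apply: le_trans au.
pose h z := f z - (f (u +i* v)%C + l * (z - (u +i* v)%C)).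
(* [cprim_bound] controls a point of a side only through its distance, at most 2 s, to an endpoint,
   hence 3 s to the centre; [normc_le_max] doubles this to 6 s. *)
have hz (x y : R) : `|x - u| <= 3 * s -> `|y - v| <= 3 * s ->
    normc (h (x +i* y)%C) <= e * (6 * s).
  move=> xu yv; have hn : normc ((x - u) +i* (y - v))%C <= 6 * s.
    by have := normc_le_max xu yv; lra.
  have := fd ((x - u) +i* (y - v))%C; rewrite /h.
  have -> : ((u +i* v) + ((x - u) +i* (y - v)) = x +i* y)%C.
    by apply/eqP; rewrite eq_complex /=; apply/andP; split; apply/eqP; ring.
  have -> : ((x +i* y) - (u +i* v) = (x - u) +i* (y - v))%C by [].
  rewrite opprD addrA => fd'; apply: le_trans (fd' _) _; first by lra.
  by rewrite ler_wpM2l // ltW.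
have dAh y : `|y| < r -> cprim r (fun x => A y x -
     ((f (u +i* v)%C + l * ('i%C * y%:C%C - (u +i* v)%C)) * x%:C%C
      + l * ((x ^+ 2 / 2)%:C)%C)) (fun x => h (x +i* y)%C).
  move=> yr; have := cprimB (dA yr) (@cprim_affine R r
     (f (u +i* v)%C + l * ('i%C * y%:C%C - (u +i* v)%C)) l).
  congr cprim; apply/funext => x; rewrite /h [(x +i* y)%C]complexE /=; ring.
have dBh x : `|x| < r -> cprim r (fun y => B x y -
     ((f (u +i* v)%C + l * (x%:C%C - (u +i* v)%C)) * y%:C%C
      + (l * 'i%C) * ((y ^+ 2 / 2)%:C)%C)) (fun y => h (x +i* y)%C).
  move=> xr; have := cprimB (dB xr) (@cprim_affine R r
     (f (u +i* v)%C + l * (x%:C%C - (u +i* v)%C)) (l * 'i%C)).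
  congr cprim; apply/funext => y; rewrite /h [(x +i* y)%C]complexE /=; ring.
have bound (G : R -> C) (g : R -> C) (p q w : R) : cprim r G g -> `|p| < r -> `|q| < r ->
    `|p - w| <= s -> `|q - w| <= s ->
    (forall x, `|x - w| <= 3 * s -> normc (g x) <= e * (6 * s)) ->
    normc (G q - G p) <= 24 * e * s ^+ 2.
  move=> dG pr qr pw qw gb.
  have qp : `|q - p| <= 2 * s.
    by rewrite (_ : q - p = (q - w) - (p - w)); [have := ler_normB (q - w) (p - w); lra|ring].
  apply: le_trans (cprim_bound dG pr qr (M := e * (6 * s)) _) _.
    move=> x xr xp; apply: gb.
    by rewrite (_ : x - w = (x - p) + (p - w)); [have := ler_normD (x - p) (p - w); lra|ring].
  rewrite (_ : 24 * e * s ^+ 2 = 2 * (e * (6 * s)) * (2 * s)); last by ring.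
  by rewrite ler_wpM2l // !mulr_ge0 // ltW.
have s3 (x w : R) : `|x - w| <= s -> `|x - w| <= 3 * s by lra.
have b1 := bound _ _ _ _ _ (dAh c cr) ar br au bu (fun x xu => hz x c xu (s3 _ _ cv)).
have b2 := bound _ _ _ _ _ (dBh b br) cr dr cv dv (fun y yv => hz b y (s3 _ _ bu) yv).
have b3 := bound _ _ _ _ _ (dAh d dr) ar br au bu (fun x xu => hz x d xu (s3 _ _ dv)).
have b4 := bound _ _ _ _ _ (dBh a ar) cr dr cv dv (fun y yv => hz a y (s3 _ _ au) yv).
move: b1 b2 b3 b4; set b1 := (X in normc X <= _ -> _).
set b2 := (X in _ -> normc X <= _ -> _).
set b3 := (X in _ -> _ -> normc X <= _ -> _).
set b4 := (X in _ -> _ -> _ -> normc X <= _ -> _).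
move=> h1 h2 h3 h4.
(* The primitives of the affine part cancel around the rectangle because i^2 = -1. *)
have -> : bdint A B a b c d = b1 + 'i%C * b2 - b3 - 'i%C * b4.
  have i2 : 'i%C * 'i%C = -1 :> C by rewrite -expr2 sqr_i.
  have sqC (x : R) : (x ^+ 2 / 2)%:C%C = x%:C%C ^+ 2 * (2^-1)%:C%C.
    by rewrite [LHS]rmorphM [X in X * _]rmorphXn.
  rewrite /bdint /b1 /b2 /b3 /b4 !sqC.
  set c1 := f _; set c2 := (u +i* v)%C; set aa := (a%:C)%C; set bb := (b%:C)%C.
  set cc := (c%:C)%C; set dd := (d%:C)%C; set hf := ((2^-1)%:C)%C.
  set ii := 'i%C in i2 *.
  have hf2 : hf * 2 = 1.
    by rewrite /hf -(rmorph_nat (real_complex R) 2) -rmorphM /= mulVf.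
  have -> : ii * (B b d - ((c1 + l * (bb - c2)) * dd + l * ii * (dd ^+ 2 * hf)) -
     (B b c - ((c1 + l * (bb - c2)) * cc + l * ii * (cc ^+ 2 * hf)))) =
     ii * (B b d - B b c) - ii * (c1 + l * (bb - c2)) * (dd - cc)
      - (ii * ii) * l * hf * (dd ^+ 2 - cc ^+ 2) by ring.
  have -> : ii * (B a d - ((c1 + l * (aa - c2)) * dd + l * ii * (dd ^+ 2 * hf)) -
     (B a c - ((c1 + l * (aa - c2)) * cc + l * ii * (cc ^+ 2 * hf)))) =
     ii * (B a d - B a c) - ii * (c1 + l * (aa - c2)) * (dd - cc)
      - (ii * ii) * l * hf * (dd ^+ 2 - cc ^+ 2) by ring.
  ring.
apply: le_trans (le_normcD _ _) _; rewrite normcN normcM normc_i mul1r.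
have := le_normcD (b1 + 'i%C * b2) (- b3); rewrite normcN.
have := le_normcD b1 ('i%C * b2); rewrite normcM normc_i mul1r.
lra.
Qed.

(** Goursat's argument: nested quarters shrink to a point (u, v) and keep at least 4^-n of the
    integral, whereas the local estimate at (u, v) bounds the n-th integral by an arbitrarily small
    multiple of 4^-n. *)
Lemma bdint_rect_eq0 (a b c d : R) :
  a <= b -> c <= d -> `|a| < r -> `|b| < r -> `|c| < r -> `|d| < r ->
  (forall x y, a <= x <= b -> c <= y <= d -> exists l, cder f (x +i* y)%C l) ->
  bdint A B a b c d = 0.
Proof.
move=> ab cd ar br cr dr df.
have [next nextP] : exists next : (R * R) * (R * R) -> (R * R) * (R * R),
    forall Q, nonempty_rect Q -> quarter Q (next Q) /\
      normc (bdintQ A B Q) <= 4 * normc (bdintQ A B (next Q)).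
  have /choice : forall Q, exists Q', nonempty_rect Q -> quarter Q Q' /\
      normc (bdintQ A B Q) <= 4 * normc (bdintQ A B Q').
    move=> Q; have [hQ|nQ] := pselect (nonempty_rect Q); last by exists Q.
    by have [Q' ?] := bdint_quarter A B hQ; exists Q'.
  by case=> next nextP; exists next.
pose Q n := iter n next ((a, b), (c, d)).
have Qne n : nonempty_rect (Q n).
  elim: n => [|n IH]; first by split.
  have [[_ _ e1 [_ _ e2]] _] := nextP _ IH; case: IH => h1 h2.
  by split; rewrite /Q iterS -/(Q n); lra.
pose L := (b - a) + (d - c); have L0 : 0 <= L by rewrite /L; lra.
pose an n := (Q n).1.1; pose bn n := (Q n).1.2.
pose cn n := (Q n).2.1; pose dn n := (Q n).2.2.
have step n : [/\ an n <= an n.+1, bn n.+1 <= bn n, bn n.+1 - an n.+1 = (bn n - an n) / 2,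
    cn n <= cn n.+1 & dn n.+1 <= dn n /\ dn n.+1 - cn n.+1 = (dn n - cn n) / 2].
  by have [[h1 h2 h3 [h4 h5 h6]] _] := nextP _ (Qne n).
have sz n : bn n - an n = (b - a) / 2 ^+ n /\ dn n - cn n = (d - c) / 2 ^+ n.
  elim: n => [|n [IH1 IH2]]; first by rewrite expr0 !divr1.
  have [_ _ -> _ [_ ->]] := step n.
  by rewrite IH1 IH2 exprS invfM !mulrA [_ / 2 / _]mulrAC [X in _ /\ X = _]mulrAC.
have anb n m : (n <= m)%N -> [/\ an n <= an m, bn m <= bn n, cn n <= cn m & dn m <= dn n].
  elim: m => [|m IH]; first by rewrite leqn0 => /eqP ->.
  rewrite leq_eqVlt => /orP[/eqP -> //|]; rewrite ltnS => /IH[h1 h2 h3 h4].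
  by have [k1 k2 _ k3 [k4 _]] := step m; split; lra.
have ne n : an n <= bn n /\ cn n <= dn n by exact: Qne.
have nest (p q : nat -> R) :
    (forall n m, (n <= m)%N -> p n <= p m /\ q m <= q n) ->
    (forall n, p n <= q n) -> exists u, forall n, p n <= u <= q n.
  move=> mon pq; exists (sup (range p)) => n.
  have ub m : p m <= q n.
    have [/mon[_ h]|/ltnW/mon[h _]] := leqP n m.
      exact: le_trans (pq m) h.
    exact: le_trans h (pq n).
  apply/andP; split.
    apply: ub_le_sup; last by exists n.
    by exists (q n) => _ [m _ <-].
  apply: ge_sup; first by exists (p 0%N), 0%N.
  by move=> _ [m _ <-].
have [u uP] := nest an bn (fun n m nm => let: And4 h1 h2 _ _ := anb n m nm in conj h1 h2)
  (fun n => (ne n).1).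
have [v vP] := nest cn dn (fun n m nm => let: And4 _ _ h1 h2 := anb n m nm in conj h1 h2)
  (fun n => (ne n).2).
have [l dl] := df u v (uP 0%N) (vP 0%N).
have decay n : normc (bdint A B a b c d) <= 4 ^+ n * normc (bdintQ A B (Q n)).
  elim: n => [|n IH]; first by rewrite expr0 mul1r.
  apply: le_trans IH _; rewrite exprSr -mulrA ler_wpM2l ?exprn_ge0 //.
  exact: (nextP _ (Qne n)).2.
apply: eq0_normc; apply/eqP; rewrite eq_le normc_ge0 andbT.
apply/ler_addgt0Pr => e e0; rewrite add0r.
(* The [+ 1] keeps the divisor positive for a rectangle reduced to a point. *)
have L1 : 0 < 96 * (L ^+ 2 + 1) by rewrite mulr_gt0 // ltr_pwDr // sqr_ge0.
have e'0 : 0 < e / (96 * (L ^+ 2 + 1)) by rewrite divr_gt0.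
have [s0 s0_gt0 small] := bdint_local dl e'0.
have [n Ln] : exists n, L / 2 ^+ n < s0.
  exists (Num.truncn (L / s0)).+1; rewrite ltr_pdivrMr ?exprn_gt0 //.
  rewrite mulrC -ltr_pdivrMr //; apply: lt_trans (truncnS_gt _) _.
  by rewrite -natrX ltr_nat ltn_expl.
have [sz1 sz2] := sz n; have := uP n; have := vP n => vn un.
have [h1 h2 h3 h4] := anb 0%N n isT; rewrite /an /bn /cn /dn /= in h1 h2 h3 h4.
have p2 : 0 < 2 ^+ n :> R by rewrite exprn_gt0.
have L2n : (b - a) / 2 ^+ n <= L / 2 ^+ n /\ (d - c) / 2 ^+ n <= L / 2 ^+ n.
  by split; rewrite ler_pM2r ?invr_gt0 // /L; lra.
case: L2n => L21 L22.
have inr (x lo hi : R) : lo <= x <= hi -> `|lo| < r -> `|hi| < r -> `|x| < r.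
  by rewrite !ltr_norml; lra.
rewrite /an /bn in un sz1; rewrite /cn /dn in vn sz2.
have hs : normc (bdintQ A B (Q n)) <= 96 * (e / (96 * (L ^+ 2 + 1))) * (L / 2 ^+ n) ^+ 2.
  apply: small Ln _ _.
    by split; [apply: (inr _ a b)|apply: (inr _ a b)|apply: (inr _ c d)|apply: (inr _ c d)] => //; lra.
  by split; rewrite ler_norml; lra.
apply: le_trans (decay n) _.
have -> : e = 4 ^+ n * (e / (4 ^+ n)).
  by rewrite mulrCA divff ?mulr1 // expf_neq0.
rewrite ler_wpM2l ?exprn_ge0 //; apply: le_trans hs _.
have -> : (L / 2 ^+ n) ^+ 2 = L ^+ 2 / 4 ^+ n.
  by rewrite expr_div_n -exprM mulnC exprM (_ : 2 ^+ 2 = 4 :> R) // -natrX.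
have q0 : 0 < 4 ^+ n :> R by rewrite exprn_gt0.
have X0 : 0 <= L ^+ 2 by exact: sqr_ge0.
move: (4 ^+ n) (L ^+ 2) q0 X0 => q X q0 X0.
have -> : 96 * (e / (96 * (X + 1))) * (X / q) = e / q * (X / (X + 1)).
  by field; rewrite !gt_eqF //; lra.
rewrite ger_pMr ?divr_gt0 // ler_pdivrMr; lra.
Qed.

End Rectangles.

Section ComplexDerivative.
Variable R : realType.
Local Notation C := R[i].
Implicit Types (f g : C -> C) (z w l : C).

Lemma gt0_realC (e : C) : 0 < e -> exists2 d : R, 0 < d & e = d%:C%C.
Proof.
case: e => a b; rewrite ltcE /= => /andP[/eqP -> a0]; by exists a.
Qed.

Lemma near0_normc (P : C -> Prop) :
  (\forall h \near (0 : C^o), P h) <->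
  exists2 d : R, 0 < d & forall h, normc h < d -> P h.
Proof.
split=> [/nbhs_ballP[e /= /gt0_realC[d d0 ->] dP]|[d d0 dP]].
  exists d => // h hd; apply: dP; rewrite /ball /= sub0r normrN.
  by rewrite normc_normr ltcR.
apply/nbhs_ballP; exists d%:C%C; first by rewrite /= ltcR.
move=> h; rewrite /ball /= sub0r normrN normc_normr ltcR; exact: dP.
Qed.

(** The bridge through which the differentiation rules reach [cder], whose real bounds suit explicit
    estimates. *)
Lemma cderP f z l : cder f z l <-> is_derive (z : C^o) (1 : C^o) (f : C^o -> C^o) l.
Proof.
have key h : h != 0 -> normc (l - h^-1 * (f (h + z) - f z)) * normc h =
    normc (f (z + h) - f z - l * h).
  move=> h0; rewrite -normcM mulrBl mulrAC mulVf // mul1r normc_distC.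
  by rewrite [h + z]addrC.
split=> [df|[dv]].
- have cv : (fun h : C^o => h^-1 *: (((f : C^o -> C^o) \o shift (z : C^o)) (h *: (1 : C^o)) - f z)) @ 0^' --> (l : C^o).
    apply/cvgrPdist_le => e /gt0_realC[e' e'0 ->].
    have [d d0 fd] := df e' e'0.
    rewrite near_withinE; apply/near0_normc; exists d => // h hd h0.
    rewrite /= [h *: 1]mulr1 normc_normr lecR.
    have hn : 0 < normc h by rewrite normc_gt0.
    rewrite -(ler_pM2r hn) key //; exact: fd.
  split; first by apply/cvg_ex; exists l.
  by apply: cvg_lim => //; exact: norm_hausdorff.
- move/cvg_ex: dv => [l' cv]; rewrite /derive => E.
  have {E cv} : (fun h : C^o => h^-1 *: (((f : C^o -> C^o) \o shift (z : C^o)) (h *: (1 : C^o)) - f z)) @ 0^' --> (l : C^o).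
    by rewrite -E; move: (cv) => /cvg_lim -> //; exact: norm_hausdorff.
  move=> /cvgrPdist_le cv e e0.
  have /cv : (0 : C) < e%:C%C by rewrite ltcR.
  rewrite near_withinE => /near0_normc[d d0 fd]; exists d => // h hd.
  have [->|h0] := eqVneq h 0; first by rewrite addr0 mulr0 subrr subr0 normc0 mulr0.
  have := fd h hd h0; rewrite /= [h *: 1]mulr1 normc_normr lecR.
  have hn : 0 < normc h by rewrite normc_gt0.
  by rewrite -(ler_pM2r hn) key.
Qed.

End ComplexDerivative.

Section ComplexDerivativeRules.
Variable R : realType.
Local Notation C := R[i].
Implicit Types (f g : C -> C) (z w l : C).

Lemma cder_cst (c z : C) : cder (fun=> c) z 0.
Proof.
move=> e e0; exists 1 => // h _.
by rewrite mul0r subr0 subrr normc0 mulr_ge0 ?normc_ge0 // ltW.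
Qed.

Lemma cder_id z : cder id z 1.
Proof.
move=> e e0; exists 1 => // h _.
by rewrite /= mul1r [z + h]addrC addrK subrr normc0 mulr_ge0 ?normc_ge0 // ltW.
Qed.

Lemma cderB f g z l m : cder f z l -> cder g z m -> cder (fun w => f w - g w) z (l - m).
Proof. by move=> /cderP df /cderP dg; apply/cderP; apply: is_deriveB. Qed.

Lemma cderM f g z l m : cder f z l -> cder g z m ->
  cder (fun w => f w * g w) z (f z * m + g z * l).
Proof. by move=> /cderP df /cderP dg; apply/cderP; apply: is_deriveM. Qed.

Lemma cderV f z l : cder f z l -> f z != 0 -> cder (fun w => (f w)^-1) z (- (f z) ^- 2 * l).
Proof.
move=> /cderP[dv <-] fz; apply/cderP; apply: DeriveDef.
  exact: (derivableV (f := f : C^o -> C^o)).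
exact: (deriveV (f := f : C^o -> C^o)).
Qed.

Lemma cderX f z l n : cder f z l -> exists m, cder (fun w => f w ^+ n) z m.
Proof.
move=> df; elim: n => [|n [m dm]]; first by exists 0; exact: cder_cst.
by exists (f z * m + f z ^+ n * l); have := cderM df dm; congr cder; apply/funext => w; rewrite exprS.
Qed.

Lemma cder_eq f g z l (d : R) : 0 < d ->
  (forall h, normc h < d -> f (z + h) = g (z + h)) -> cder f z l -> cder g z l.
Proof.
move=> d0 fg df e e0; have [d' d'0 fd] := df e e0.
exists (Num.min d d'); first by rewrite lt_min d0.
move=> h; rewrite lt_min => /andP[hd hd'].
rewrite -fg // -[X in g X]addr0 -fg ?addr0 ?normc0 //; exact: fd.
Qed.

End ComplexDerivativeRules.

(** * Rectangles with a corner at the exceptional point 0 *)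

Section Primitive.
Variable R : realType.
Local Notation C := R[i].
Variables (f : C -> C) (r : R).
Hypothesis r0 : 0 < r.
Hypothesis cf : forall x y : R, `|x| <= r -> `|y| <= r -> ccont f (x +i* y)%C.
Hypothesis df : forall x y : R, `|x| <= r -> `|y| <= r -> (x +i* y)%C != 0 ->
  exists l, cder f (x +i* y)%C l.

Let between (a b x : R) := (a <= x <= b) \/ (b <= x <= a).

Lemma ex_line_primitives : exists A B : R -> R -> C,
  (forall y, `|y| < r -> cprim r (A y) (fun x => f (x +i* y)%C)) /\
  (forall x, `|x| < r -> cprim r (B x) (fun y => f (x +i* y)%C)).
Proof.
have /choice[A dA] : forall y, exists G, `|y| < r -> cprim r G (fun x => f (x +i* y)%C).
  move=> y; have [yr|yr] := ltP `|y| r; last by exists (fun=> 0).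
  have [|G dG] := @ex_cprim R (fun x => f (x +i* y)%C) r; last by exists G.
  move=> x xr e e0; have [d d0 fd] := cf xr (ltW yr) e0.
  exists d => // h hd; have := fd h%:C%C.
  rewrite normc_real => /(_ hd); congr (normc (f _ - _) <= _).
  by apply/eqP; rewrite eq_complex /= addr0 !eqxx.
have /choice[B dB] : forall x, exists G, `|x| < r -> cprim r G (fun y => f (x +i* y)%C).
  move=> x; have [xr|xr] := ltP `|x| r; last by exists (fun=> 0).
  have [|G dG] := @ex_cprim R (fun y => f (x +i* y)%C) r; last by exists G.
  move=> y yr e e0; have [d d0 fd] := cf (ltW xr) yr e0.
  exists d => // h hd; have := fd ('i%C * h%:C%C).
  rewrite normcM normc_i mul1r normc_real => /(_ hd); congr (normc (f _ - _) <= _).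
  by apply/eqP; rewrite eq_complex /=; apply/andP; split; apply/eqP; ring.
by exists A, B.
Qed.

Variables A B : R -> R -> C.
Hypothesis dA : forall y, `|y| < r -> cprim r (A y) (fun x => f (x +i* y)%C).
Hypothesis dB : forall x, `|x| < r -> cprim r (B x) (fun y => f (x +i* y)%C).

(** Exchanging the ends of a side changes only the sign of [bdint], which reduces unordered corners
    to ordered ones. *)
Lemma bdint_oriented_eq0 a b c d : `|a| < r -> `|b| < r -> `|c| < r -> `|d| < r ->
  (forall x y, between a b x -> between c d y -> (x +i* y)%C != 0) ->
  bdint A B a b c d = 0.
Proof.
move=> ar br cr dr n0.
have main a' b' c' d' : a' <= b' -> c' <= d' ->
    `|a'| < r -> `|b'| < r -> `|c'| < r -> `|d'| < r ->
    (forall x y, a' <= x <= b' -> c' <= y <= d' -> (x +i* y)%C != 0) ->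
    bdint A B a' b' c' d' = 0.
  move=> ab cd; rewrite !ltr_norml => ar' br' cr' dr' n0'.
  apply: (bdint_rect_eq0 dA dB) => //; rewrite ?ltr_norml //.
  move=> x y xab ycd; apply: df; last exact: n0'.
    by rewrite ler_norml; lra.
  by rewrite ler_norml; lra.
have e1 : bdint A B a b c d = - bdint A B b a c d by rewrite /bdint; ring.
have e2 : bdint A B a b c d = - bdint A B a b d c by rewrite /bdint; ring.
have e3 : bdint A B b a c d = - bdint A B b a d c by rewrite /bdint; ring.
have [ab|/ltW ab] := leP a b; have [cd|/ltW cd] := leP c d.
- by apply: main => // x y hx hy; apply: n0; left.
- rewrite e2 main ?oppr0 // => x y hx hy; apply: n0; [left|right]; exact.
- rewrite e1 main ?oppr0 // => x y hx hy; apply: n0; [right|left]; exact.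
- rewrite e1 e3 main ?oppr0 // => x y hx hy; apply: n0; right; exact.
Qed.

(** At 0 the function is only continuous. Cutting off two rectangles that avoid 0 replaces x, y by t
    x, t y without changing the integral, and the small rectangle has an integral of order t since
    [f] is bounded near 0. *)
Lemma bdint_corner_eq0 x y : `|x| < r -> `|y| < r -> bdint A B 0 x 0 y = 0.
Proof.
move=> xr yr.
have [->|x0] := eqVneq x 0; first by rewrite /bdint; ring.
have [->|y0] := eqVneq y 0; first by rewrite /bdint; ring.
have z0 : `|0 : R| < r by rewrite normr0.
have tr (t u : R) : 0 < t < 1 -> `|u| < r -> `|t * u| < r.
  move=> /andP[t0 t1] ur; rewrite normrM gtr0_norm //.
  by apply: le_lt_trans ur; rewrite ler_piMl // ltW.
have shrink t : 0 < t < 1 -> bdint A B 0 x 0 y = bdint A B 0 (t * x) 0 (t * y).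
  move=> t01; have /andP[t0 t1] := t01.
  have -> : bdint A B 0 x 0 y = bdint A B 0 (t * x) 0 (t * y)
     + bdint A B (t * x) x 0 y + bdint A B 0 (t * x) (t * y) y.
    by rewrite /bdint; ring.
  have nz (u v : R) : u != 0 -> between (t * u) u v -> v != 0.
    move=> u0 tuv; apply/eqP => v0; move: tuv; rewrite v0 /between.
    have [un|up|u00] := ltgtP u 0; last by rewrite u00 eqxx in u0.
      have tu : t * u < 0 by rewrite pmulr_rlt0.
      by case=> /andP[]; lra.
    have tu : 0 < t * u by rewrite pmulr_rgt0.
    by case=> /andP[]; lra.
  have -> : bdint A B (t * x) x 0 y = 0.
    apply: bdint_oriented_eq0; rewrite ?tr //.
    by move=> u v hu _; rewrite eq_complex negb_and /= (nz x u x0 hu).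
  have -> : bdint A B 0 (t * x) (t * y) y = 0.
    apply: bdint_oriented_eq0; rewrite ?tr //.
    by move=> u v _ hv; rewrite eq_complex negb_and /= (nz y v y0 hv) orbT.
  by rewrite !addr0.
apply: eq0_normc; apply/eqP; rewrite eq_le normc_ge0 andbT.
apply/ler_addgt0Pr => e e0; rewrite add0r.
have r00 : `|0 : R| <= r by rewrite normr0 ltW.
have [d d0 fd] := cf r00 r00 ltr01.
pose M := normc (f 0) + 1; have M0 : 0 < M by rewrite ltr_wpDl ?normc_ge0.
have fM z : normc z < d -> normc (f z) <= M.
  move=> zd; have := fd z zd; rewrite add0r => h.
  by have := ler_normcB (f z) (f 0); rewrite /M; lra.
have rr : 0 < 2 * r by rewrite mulr_gt0.
have Mr : 0 < 8 * M * r by rewrite !mulr_gt0.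
(* The second condition puts the small rectangle inside the disc where |f| <= M; in the third, four
   sides contribute at most 2 M (t r) each. *)
have [t [t01 td te]] : exists t, [/\ 0 < t < 1, t * (2 * r) < d & t * (8 * M * r) <= e].
  exists (Num.min (1 / 2) (Num.min (d / (2 * r) / 2) (e / (8 * M * r)))).
  split.
  - by rewrite !lt_min gt_min !divr_gt0 //= (_ : 1 / 2 < 1) //; lra.
  - rewrite -ltr_pdivlMr //; apply: (@le_lt_trans _ _ (d / (2 * r) / 2)).
      by rewrite !ge_min lexx orbT.
    by rewrite ltr_pdivrMr // ltr_pMr ?divr_gt0 // ltr1n.
  - by rewrite -ler_pdivlMr // !ge_min lexx !orbT.
have /andP[t0 t1] := t01.
rewrite (shrink t) //.
have xt : `|t * x| <= t * r by rewrite normrM gtr0_norm // ler_wpM2l // ltW.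
have yt : `|t * y| <= t * r by rewrite normrM gtr0_norm // ler_wpM2l // ltW.
have fM' (u v : R) : `|u| <= t * r -> `|v| <= t * r -> normc (f (u +i* v)%C) <= M.
  move=> ut vt; apply: fM; apply: le_lt_trans td.
  by have := normc_le_max ut vt; lra.
have tr0 : `|0 : R| <= t * r by rewrite normr0 mulr_ge0 // ltW.
have bA v : `|v| < r -> `|v| <= t * r -> normc (A v (t * x) - A v 0) <= 2 * M * (t * r).
  move=> vr vt; apply: le_trans (cprim_bound (dA vr) z0 (tr _ _ t01 xr) (M := M) _) _.
    by move=> u ur; rewrite !subr0 => /le_trans/(_ xt) ut; exact: fM'.
  by rewrite subr0 ler_wpM2l // mulr_ge0 // ltW.
have bB v : `|v| < r -> `|v| <= t * r -> normc (B v (t * y) - B v 0) <= 2 * M * (t * r).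
  move=> vr vt; apply: le_trans (cprim_bound (dB vr) z0 (tr _ _ t01 yr) (M := M) _) _.
    by move=> u ur; rewrite !subr0 => /le_trans/(_ yt) ut; exact: fM'.
  by rewrite subr0 ler_wpM2l // mulr_ge0 // ltW.
have := bA 0 z0 tr0; have := bB (t * x) (tr _ _ t01 xr) xt.
have := bA (t * y) (tr _ _ t01 yr) yt; have := bB 0 z0 tr0.
rewrite /bdint.
move: (A 0 (t * x) - A 0 0) (B (t * x) (t * y) - B (t * x) 0)
  (A (t * y) (t * x) - A (t * y) 0) (B 0 (t * y) - B 0 0) => b1 b2 b3 b4 h4 h3 h2 h1.
apply: le_trans (le_normcD _ _) _; rewrite normcN normcM normc_i mul1r.
have := le_normcD (b1 + 'i%C * b2) (- b3); rewrite normcN.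
have := le_normcD b1 ('i%C * b2); rewrite normcM normc_i mul1r.
lra.
Qed.

End Primitive.

(** * Rolle's theorem on circles *)

Section CircleRolle.
Variable R : realType.
Local Notation C := R[i].

(** [F] integrates from 0 along the real axis and then vertically. The vanishing corner integrals
    give the same value for the path in the other order, so horizontal and vertical increments of
    [F] are both integrals of [f], and continuity of [f] yields the derivative. *)
Lemma ex_primitive (f : C -> C) (r : R) : 0 < r ->
  (forall x y : R, `|x| <= r -> `|y| <= r -> ccont f (x +i* y)%C) ->
  (forall x y : R, `|x| <= r -> `|y| <= r -> (x +i* y)%C != 0 ->
    exists l, cder f (x +i* y)%C l) ->
  exists F : C -> C, forall x y : R, `|x| < r -> `|y| < r ->
    cder F (x +i* y)%C (f (x +i* y)%C).
Proof.
move=> r0 cf df; have [A [B [dA dB]]] := ex_line_primitives cf.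
pose F (z : C) := A 0 (complex.Re z) - A 0 0 +
  'i%C * (B (complex.Re z) (complex.Im z) - B (complex.Re z) 0).
have F2 x y : `|x| < r -> `|y| < r ->
    F (x +i* y)%C = A y x - A y 0 + 'i%C * (B 0 y - B 0 0).
  move=> xr yr; have := bdint_corner_eq0 r0 cf df dA dB xr yr; rewrite /bdint /F /=.
  by move=> /eqP; rewrite subr_eq0 subr_eq => /eqP ->; rewrite addrC.
exists F => x y xr yr e e0.
(* There are two edges, and [cprim_bound] loses a factor 2 on each. *)
have e4 : 0 < e / 4 by rewrite divr_gt0.
have [d d0 fd] := cf x y (ltW xr) (ltW yr) _ e4.
exists (Num.min (d / 2) (Num.min (r - `|x|) (r - `|y|))).
  by rewrite !lt_min divr_gt0 //= !subr_gt0 xr.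
case=> a b; rewrite !lt_min => /and3P[kd kx ky].
have ak := ler_Re_normc (a +i* b)%C; have bk := ler_Im_normc (a +i* b)%C.
move: kd kx ky ak bk; set k := normc _ => kd kx ky /= ak bk.
have xar : `|x + a| < r by have := ler_normD x a; lra.
have ybr : `|y + b| < r by have := ler_normD y b; lra.
have -> : ((x +i* y) + (a +i* b) = (x + a) +i* (y + b))%C by [].
set c := f (x +i* y)%C.
have fc (u v : R) : `|u| <= `|a| -> `|v| <= `|b| ->
    normc (f ((x + u) +i* (y + v))%C - c) <= e / 4.
  move=> ua vb; have := fd (u +i* v)%C.
  have -> : ((x +i* y) + (u +i* v) = (x + u) +i* (y + v))%C by [].
  apply; apply: le_lt_trans (normc_le_ReIm _) _ => /=; lra.
have h1 : normc (A y (x + a) - c * (x + a)%:C%C - (A y x - c * x%:C%C)) <= 2 * (e / 4) * `|a|.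
  have P := cprimB (dA _ yr) (@cprim_affine R r c 0).
  have := cprim_bound (a := x) (b := x + a) (M := e / 4) P xr xar.
  rewrite !mul0r !addr0 [x + a - x]addrC addKr; apply.
  move=> u ur ux; rewrite mul0r addr0; have := fc (u - x) 0.
  by rewrite normr0 normr_ge0 addr0 [x + _]addrC subrK; exact.
have h2 : normc (B (x + a) (y + b) - c * (y + b)%:C%C - (B (x + a) y - c * y%:C%C)) <= 2 * (e / 4) * `|b|.
  have P := cprimB (dB _ xar) (@cprim_affine R r c 0).
  have := cprim_bound (a := y) (b := y + b) (M := e / 4) P yr ybr.
  rewrite !mul0r !addr0 [y + b - y]addrC addKr; apply.
  move=> u ur uy; rewrite mul0r addr0; have := fc a (u - y) (lexx _) uy.
  by rewrite [y + (_ - _)]addrC subrK.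
have -> : F ((x + a) +i* (y + b))%C - F (x +i* y)%C - c * (a +i* b)%C =
   (A y (x + a) - c * (x + a)%:C%C - (A y x - c * x%:C%C)) +
   'i%C * (B (x + a) (y + b) - c * (y + b)%:C%C - (B (x + a) y - c * y%:C%C)).
  have -> : F ((x + a) +i* (y + b))%C = F ((x + a) +i* y)%C +
      'i%C * (B (x + a) (y + b) - B (x + a) y) by rewrite /F /=; ring.
  rewrite !F2 // [(a +i* b)%C]complexE /=.
  have -> : (x + a)%:C%C = x%:C%C + a%:C%C by rewrite [LHS]rmorphD.
  have -> : (y + b)%:C%C = y%:C%C + b%:C%C by rewrite [LHS]rmorphD.
  by ring.
apply: le_trans (le_normcD _ _) _; rewrite normcM normc_i mul1r.
have ea : e * `|a| <= e * k by rewrite ler_wpM2l // ltW.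
have eb : e * `|b| <= e * k by rewrite ler_wpM2l // ltW.
lra.
Qed.

Lemma is_deriveP (phi : R -> R) (x l : R) : is_derive x 1 phi l <->
  forall e, 0 < e -> exists2 d : R, 0 < d &
    forall h, `|h| < d -> `|phi (x + h) - phi x - l * h| <= e * `|h|.
Proof.
have key h : h != 0 -> `|l - h^-1 * (phi (h + x) - phi x)| * `|h| =
    `|phi (x + h) - phi x - l * h|.
  move=> h0; rewrite -normrM mulrBl mulrAC mulVf // mul1r distrC.
  by rewrite [h + x]addrC.
have near0 (P : R -> Prop) : (\forall h \near (0 : R), P h) <->
    exists2 d : R, 0 < d & forall h, `|h| < d -> P h.
  split=> [/nbhs_ballP[d d0 dP]|[d d0 dP]].
    by exists d => // h hd; apply: dP; rewrite /ball /= sub0r normrN.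
  apply/nbhs_ballP; exists d => // h; rewrite /ball /= sub0r normrN; exact: dP.
split=> [[dv]|df].
- move/cvg_ex: dv => [l' cv]; rewrite /derive => E.
  have {E cv} : (fun h : R => h^-1 *: ((phi \o shift x) (h *: 1) - phi x)) @ 0^' --> l.
    by rewrite -E; move: (cv) => /cvg_lim -> //; exact: norm_hausdorff.
  move=> /cvgrPdist_le cv e /cv.
  rewrite near_withinE => /near0[d d0 fd]; exists d => // h hd.
  have [->|h0] := eqVneq h 0; first by rewrite addr0 mulr0 subrr subr0 normr0 mulr0.
  have := fd h hd h0; rewrite /= [h *: 1]mulr1 => fh.
  by rewrite -key // ler_wpM2r.
- have cv : (fun h : R => h^-1 *: ((phi \o shift x) (h *: 1) - phi x)) @ 0^' --> l.
    apply/cvgrPdist_le => e /df[d d0 fd].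
    rewrite near_withinE; apply/near0; exists d => // h hd h0.
    have hn : 0 < `|h| by rewrite normr_gt0.
    rewrite /= [h *: 1]mulr1 -(ler_pM2r hn) key //; exact: fd.
  split; first by apply/cvg_ex; exists l.
  by apply: cvg_lim => //; exact: norm_hausdorff.
Qed.

Definition circle (r t : R) : C := ((r * cos t) +i* (r * sin t))%C.

Lemma normc_circle r t : 0 <= r -> normc (circle r t) = r.
Proof.
by move=> r0; rewrite /= !exprMn -mulrDr cos2Dsin2 mulr1 sqrtr_sqr ger0_norm.
Qed.

Lemma circle_der r t e : 0 < e -> exists2 d : R, 0 < d & forall h, `|h| < d ->
  normc (circle r (t + h) - circle r t - 'i%C * circle r t * h%:C%C) <= e * `|h|.
Proof.
move=> e0.
have dc : is_derive t 1 (fun u => r * cos u) (- (r * sin t)).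
  by apply: is_derive_eq; rewrite /GRing.scale /=; ring.
have ds : is_derive t 1 (fun u => r * sin u) (r * cos t).
  by apply: is_derive_eq; rewrite /GRing.scale /=; ring.
have e2 : 0 < e / 2 by rewrite divr_gt0.
have [d1 d10 h1] := (is_deriveP _ _ _).1 dc _ e2.
have [d2 d20 h2] := (is_deriveP _ _ _).1 ds _ e2.
exists (Num.min d1 d2); first by rewrite lt_min d10.
move=> h; rewrite lt_min => /andP[hd1 hd2].
apply: le_trans (normc_le_ReIm _) _.
have := h1 h hd1; have := h2 h hd2; rewrite /circle /=.
have -> : r * sin (t + h) - r * sin t -
      ((0 * (r * cos t) - 1 * (r * sin t)) * 0 + (0 * (r * sin t) + 1 * (r * cos t)) * h) =
   r * sin (t + h) - r * sin t - r * cos t * h by ring.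
have -> : r * cos (t + h) - r * cos t -
      ((0 * (r * cos t) - 1 * (r * sin t)) * h - (0 * (r * sin t) + 1 * (r * cos t)) * 0) =
   r * cos (t + h) - r * cos t - - (r * sin t) * h by ring.
lra.
Qed.

(** This supplies exactly what [ex_primitive] asks for: continuity at 0, by the value [l] given to
    the quotient there, and differentiability elsewhere. *)
Lemma cder_quotient (D : C -> C) l z : D 0 = 0 -> cder D 0 l ->
  (z != 0 -> exists m, cder D z m) ->
  let k w := if w == 0 then l else D w / w in
  ccont k 0 /\ (z != 0 -> exists m, cder k z m).
Proof.
move=> D0 dD0 dDz k; split.
  move=> e e0; have [d d0 fd] := dD0 e e0; exists d => // w wd.
  rewrite add0r /k eqxx; case: eqVneq => [_|w0]; first by rewrite subrr normc0 ltW.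
  have wn : 0 < normc w by rewrite normc_gt0.
  rewrite -(ler_pM2r wn) -normcM mulrBl divfK //.
  by have := fd w wd; rewrite add0r D0 subr0.
move=> z0; have [m dm] := dDz z0.
exists (D z * (- z ^- 2 * 1) + z^-1 * m).
have zn : 0 < normc z by rewrite normc_gt0.
apply: (cder_eq (f := fun w => D w / w) zn) => [w wz|].
  rewrite /k; case: eqP => // zw; move: wz.
  by rewrite -normcN (_ : - w = z) ?ltxx //; apply/eqP; rewrite eq_sym -addr_eq0 zw.
by apply: cderM dm _; apply: cderV z0; exact: cder_id.
Qed.

(* Along the circle the derivative of Im F, for F a primitive of
   (f(z) - f(0)) / z, is Re (f(z) - f(0)): Rolle's theorem applies. *)
Lemma circle_Re_eq (f : C -> C) (rho r : R) : 0 < r -> 2 * r < rho ->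
  (forall z, normc z < rho -> exists l, cder f z l) ->
  exists2 t, t \in `](0 : R), (pi *+ 2)[ &
    complex.Re (f (circle r t)) = complex.Re (f 0).
Proof.
move=> r0 rrho df.
have [l0 dl0] : exists l, cder f 0 l by apply: df; rewrite normc0; lra.
pose h z := if z == 0 then l0 else (f z - f 0) / z.
have quot z : normc z < rho -> ccont h 0 /\ (z != 0 -> exists l, cder h z l).
  move=> zrho; apply: (@cder_quotient (fun w => f w - f 0) l0); first by rewrite subrr.
    by have := cderB dl0 (cder_cst (f 0) 0); rewrite subr0.
  by move=> _; have [l dl] := df z zrho; exists (l - 0); apply: cderB dl (cder_cst _ _).
have [ch0 _] : ccont h 0 /\ (0 != 0 :> C -> exists l, cder h 0 l) by apply: quot; rewrite normc0; lra.
have dh z zrho := (quot z zrho).2.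
(* The square |x|, |y| <= s must contain the circle, so s > r, and must lie in the disc of radius
   rho, for which 2 s < rho suffices; this is why 2 r < rho is assumed. *)
pose s := (r + rho / 2) / 2.
have [rs srho s0] : [/\ r < s, 2 * s < rho & 0 < s] by rewrite /s; split; lra.
have inrho (x y : R) : `|x| <= s -> `|y| <= s -> normc (x +i* y)%C < rho.
  by move=> xs ys; have := normc_le_max xs ys; lra.
have [||F dF] := @ex_primitive h s s0.
- move=> x y xs ys; case: (eqVneq (x +i* y)%C 0) => [->//|z0].
  by have [l dl] := dh _ (inrho _ _ xs ys) z0; exact: cder_ccont dl.
- by move=> x y xs ys; apply: dh; exact: inrho.
have dFz z : normc z <= r -> cder F z (h z).
  case: z => x y zr; apply: dF.
    exact: le_lt_trans (ler_Re_normc (x +i* y)%C) (le_lt_trans zr rs).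
  exact: le_lt_trans (ler_Im_normc (x +i* y)%C) (le_lt_trans zr rs).
pose psi t := complex.Im (F (circle r t)).
have dpsi (t : R) : is_derive t 1 psi (complex.Re (f (circle r t) - f 0)).
  set z := circle r t; have zr : normc z = r by rewrite normc_circle // ltW.
  have zn0 : z != 0 by rewrite -normc_eq0 zr gt_eqF.
  have zler : normc z <= r by rewrite zr.
  have hzz : h z * ('i%C * z) = 'i%C * (f z - f 0).
    by rewrite /h (negbTE zn0) mulrCA divfK.
  apply/is_deriveP => e e0.
  pose N := normc (h z) + 1; have N0 : 0 < N by rewrite ltr_wpDl ?normc_ge0.
  have r10 : 0 < r + 1 by lra.
  have e1 : 0 < e / 2 / (r + 1) by rewrite !divr_gt0.
  have e2 : 0 < Num.min 1 (e / 2 / N) by rewrite lt_min ltr01 !divr_gt0.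
  have [d1 d10 F1] := dFz z zler _ e1.
  have [d2 d20 C1] := circle_der r t e2.
  exists (Num.min d2 (d1 / (r + 1))); first by rewrite lt_min d20 divr_gt0.
  move=> k; rewrite lt_min ltr_pdivlMr // => /andP[kd2 kd1].
  have := C1 k kd2; rewrite -/z; set D := circle r (t + k) - z => CD.
  have [m1 m2] : Num.min 1 (e / 2 / N) <= 1 /\ Num.min 1 (e / 2 / N) <= e / 2 / N.
    by rewrite !ge_min !lexx orbT.
  move: (Num.min _ _) m1 m2 CD {e2 C1} => m m1 m2 CD.
  have k0 := normr_ge0 k.
  have Dk : normc D <= (r + 1) * `|k|.
    have := le_normcD (D - 'i%C * z * k%:C%C) ('i%C * z * k%:C%C).
    rewrite subrK !normcM normc_i mul1r zr normc_real => /le_trans; apply.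
    rewrite addrC mulrDl mul1r lerD2l; apply: le_trans CD _; exact: ler_piMl.
  have FD := F1 D (le_lt_trans Dk _); rewrite mulrC in kd1.
  have {FD} := FD kd1; rewrite (_ : z + D = circle r (t + k)); last by rewrite /D addrC subrK.
  move=> FD.
  have -> : psi (t + k) - psi t - complex.Re (f z - f 0) * k =
      complex.Im (F (circle r (t + k)) - F z - 'i%C * (f z - f 0) * k%:C%C).
    rewrite /psi -/z; move: (F _) (F z) (f z - f 0) => [a1 b1] [a2 b2] [a3 b3] /=; ring.
  apply: le_trans (ler_Im_normc _) _.
  have -> : F (circle r (t + k)) - F z - 'i%C * (f z - f 0) * k%:C%C =
     (F (circle r (t + k)) - F z - h z * D) + h z * (D - 'i%C * z * k%:C%C).
    by rewrite -hzz; ring.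
  apply: le_trans (le_normcD _ _) _; rewrite normcM.
  have t1 : e / 2 / (r + 1) * normc D <= e / 2 * `|k|.
    apply: (@le_trans _ _ (e / 2 / (r + 1) * ((r + 1) * `|k|))).
      by rewrite ler_wpM2l // ltW.
    by rewrite mulrA divfK // gt_eqF.
  have t2 : normc (h z) * normc (D - 'i%C * z * k%:C%C) <= e / 2 * `|k|.
    apply: (@le_trans _ _ (N * (e / 2 / N * `|k|))).
      apply: ler_pM; rewrite ?normc_ge0 //; first by rewrite /N lerDl.
      by apply: le_trans CD _; rewrite ler_wpM2r.
    by rewrite mulrA mulrCA divff ?mulr1 // gt_eqF.
  lra.
have pi20 : 0 < pi *+ 2 :> R by rewrite pmulrn_rgt0 // pi_gt0.
have [|||t t2pi [_ dt0]] := @Rolle R psi 0 (pi *+ 2) pi20.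
- by move=> t _; apply: ex_derive.
- apply: continuous_subspaceT => t; apply: differentiable_continuous.
  by apply/derivable1_diffP; apply: ex_derive.
- by rewrite /psi /circle -[pi *+ 2]add0r cosD2pi sinD2pi.
have [_] := dpsi t; rewrite dt0 ReB => /esym/eqP; rewrite subr_eq0 => /eqP fE.
by exists t.
Qed.

End CircleRolle.

(** * Maximum principle and second-order expansions in one variable *)

Section OneVariable.
Variable R : realType.
Local Notation C := R[i].
Implicit Types (f g : C -> C) (z w l : C).

Lemma cder_shift f a z l : cder f (a + z) l -> cder (fun w => f (a + w)) z l.
Proof.
by move=> df e e0; have [d d0 fd] := df e e0; exists d => // h; rewrite addrA; exact: fd.
Qed.

Lemma ccontM f g z : ccont f z -> ccont g z -> ccont (fun w => f w * g w) z.
Proof.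
move=> cf cg e e0.
pose Mf := normc (f z) + 1; pose Mg := normc (g z) + 1.
have Mf0 : 0 < Mf by rewrite ltr_wpDl ?normc_ge0.
have Mg0 : 0 < Mg by rewrite ltr_wpDl ?normc_ge0.
have e1 : 0 < Num.min 1 (e / 2 / Mg) by rewrite lt_min ltr01 !divr_gt0.
have e2 : 0 < e / 2 / Mf by rewrite !divr_gt0.
have [d1 d10 h1] := cf _ e1; have [d2 d20 h2] := cg _ e2.
exists (Num.min d1 d2); first by rewrite lt_min d10.
move=> h; rewrite lt_min => /andP[/h1 + /h2]; rewrite le_min => /andP[f1 f2] g2.
have -> : f (z + h) * g (z + h) - f z * g z =
  f (z + h) * (g (z + h) - g z) + (f (z + h) - f z) * g z by ring.
apply: le_trans (le_normcD _ _) _; rewrite !normcM.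
have t1 : normc (f (z + h)) * normc (g (z + h) - g z) <= Mf * (e / 2 / Mf).
  apply: ler_pM; rewrite ?normc_ge0 //.
  by have := ler_normcB (f (z + h)) (f z); rewrite /Mf; lra.
have t2 : normc (f (z + h) - f z) * normc (g z) <= e / 2 / Mg * Mg.
  by apply: ler_pM; rewrite ?normc_ge0 // /Mg lerDl.
by move: t1 t2; rewrite [Mf * _]mulrC !divfK ?gt_eqF //; lra.
Qed.

Lemma ccontX f z n : ccont f z -> ccont (fun w => f w ^+ n) z.
Proof.
move=> cf; elim: n => [|n IH].
  by move=> e e0; exists 1 => // h _; rewrite !expr0 subrr normc0 ltW.
by have := ccontM cf IH; congr ccont; apply/funext => w; rewrite exprS.
Qed.

(** A factor w turns continuity at 0 into differentiability, which removes the singularity of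
    difference quotients. *)
Lemma cder_mulid f : ccont f 0 -> cder (fun w => w * f w) 0 (f 0).
Proof.
move=> cf e e0; have [d d0 fd] := cf e e0; exists d => // h hd.
rewrite add0r mul0r subr0 [f 0 * h]mulrC -mulrBr normcM mulrC.
by rewrite ler_wpM2r ?normc_ge0 //; have := fd h hd; rewrite add0r.
Qed.

(** For w |-> f(a + w) conj(f(a)), whose value at 0 is |f(a)|^2, [circle_Re_eq] gives a point z of
    the circle with |f(z)| |f(a)| >= |f(a)|^2. *)
Lemma ex_circle_normc_ge f (a : C) (rho r : R) : 0 < r -> 2 * r < rho ->
  (forall z, normc (z - a) < rho -> exists l, cder f z l) ->
  exists2 z, normc (z - a) = r & normc (f a) <= normc (f z).
Proof.
move=> r0 rrho df.
have [|t _] := @circle_Re_eq R (fun w => f (a + w) * (f a)^*%C) rho r r0 rrho.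
  move=> z zrho; have [|l dl] := df (a + z); first by rewrite addrC addKr.
  by exists (f (a + z) * 0 + (f a)^*%C * l); apply: cderM (cder_shift dl) (cder_cst _ _).
rewrite addr0 => E; exists (a + circle r t).
  by rewrite addrC addKr normc_circle // ltW.
have [->|fa0] := eqVneq (f a) 0; first by rewrite normc0 normc_ge0.
have fa : 0 < normc (f a) by rewrite normc_gt0.
rewrite -(ler_pM2r fa).
have -> : normc (f a) * normc (f a) = complex.Re (f a * (f a)^*%C).
  case: (f a) => x y /=; rewrite -expr2 sqr_sqrtr; first by ring.
  by rewrite addr_ge0 // sqr_ge0.
rewrite -E; apply: le_trans (ler_norm _) _; apply: le_trans (ler_Re_normc _) _.
rewrite normcM; have -> // : normc (f a)^*%C = normc (f a).
by case: (f a) => x y /=; rewrite sqrrN.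
Qed.

(** If a > b, then (a / b)^n grows at least linearly by Bernoulli's inequality, against the constant
    bound M / t. *)
Lemma ler_of_expn (a b t M : R) : 0 <= a -> 0 < b -> 0 < t ->
  (forall n, t * a ^+ n <= M * b ^+ n) -> a <= b.
Proof.
move=> a0 b0 t0 H; rewrite leNgt; apply/negP => ba.
pose q := a / b - 1; have q0 : 0 < q by rewrite subr_gt0 ltr_pdivlMr // mul1r.
have bern n : 1 + n%:R * q <= (a / b) ^+ n.
  elim: n => [|n IH]; first by rewrite mul0r addr0 expr0.
  have -> : a / b = 1 + q by rewrite /q; ring.
  rewrite exprS (_ : 1 + q = a / b); last by rewrite /q; ring.
  have n0 : 0 <= n%:R * q by rewrite mulr_ge0 ?ler0n // ltW.
  apply: (@le_trans _ _ ((1 + q) * (1 + n%:R * q))).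
    by rewrite -natr1; nra.
  by rewrite (_ : a / b = 1 + q) in IH *; [rewrite ler_wpM2l //; lra|rewrite /q; ring].
have Hn n : t * (1 + n%:R * q) <= M.
  apply: (@le_trans _ _ (t * (a / b) ^+ n)); first by rewrite ler_wpM2l // ltW.
  by rewrite expr_div_n mulrA ler_pdivrMr ?exprn_gt0.
have M0 : 0 <= M by have := Hn 0%N; nra.
have tq : 0 < t * q by rewrite mulr_gt0.
have := Hn (Num.truncn (M / (t * q))).+1; have := truncnS_gt (M / (t * q)).
rewrite ltr_pdivrMr //; nra.
Qed.

(* If F(t) ~ c |t|^k then Re (F / c) > 0 on small circles, yet F(0) = 0. *)
Lemma normc_asymptotic_eq0 (F : C -> C) (c : C) (k : nat) (rho : R) :
  (0 < k)%N -> 0 < rho ->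
  (forall z, normc z < rho -> exists l, cder F z l) -> F 0 = 0 ->
  (forall e : R, 0 < e -> exists2 d : R, 0 < d & forall t, normc t < d ->
    normc (F t - c * (normc t ^+ k)%:C%C) <= e * normc t ^+ k) ->
  c = 0.
Proof.
move=> k0 rho0 dF F0 asym; apply/eqP/negPn/negP => c0.
have cn : 0 < normc c by rewrite normc_gt0.
have [d d0 Fd] := asym (normc c / 2) (divr_gt0 cn (ltr0Sn _ 1)).
pose r := Num.min rho d / 3.
have m0 : 0 < Num.min rho d by rewrite lt_min rho0.
have r0 : 0 < r by rewrite divr_gt0.
have [m1 m2] : Num.min rho d <= rho /\ Num.min rho d <= d by rewrite !ge_min !lexx orbT.
have [||t _] := @circle_Re_eq R (fun w => F w * c^-1) rho r r0.
- by rewrite /r; lra.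
- move=> z /dF[l dl]; exists (F z * 0 + c^-1 * l).
  exact: cderM dl (cder_cst _ _).
rewrite F0 mul0r; set z := circle r t.
have zr : normc z = r by rewrite normc_circle // ltW.
have := Fd z; rewrite zr => /(_ _)/=.
have rd : r < d by rewrite /r; lra.
move=> /(_ rd) Fz E.
have : normc (F z / c - (r ^+ k)%:C%C) <= 2^-1 * r ^+ k.
  rewrite -(ler_pM2r cn) -normcM mulrBl divfK // [_ * c]mulrC.
  apply: le_trans Fz _; lra.
move=> /(le_trans (ler_Re_normc _)); rewrite ReB E /= sub0r normrN.
have rk : 0 < r ^+ k by rewrite exprn_gt0.
rewrite (ger0_norm (ltW rk)); lra.
Qed.

(** Replacing t by i t changes the sign of t^2 and conj(t)^2 but not of t conj(t). So t^2 (g(t) -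
    g(i t) - 2 c0 t^2) is holomorphic and asymptotic to 2 c2 |t|^4, which gives c2 = 0; then g(t) -
    c0 t^2 is asymptotic to c1 |t|^2. *)
Lemma holo_quadratic (g : C -> C) (c0 c1 c2 : C) (rho : R) : 0 < rho ->
  (forall z, normc z < rho -> exists l, cder g z l) -> g 0 = 0 ->
  (forall e : R, 0 < e -> exists2 d : R, 0 < d & forall t, normc t < d ->
    normc (g t - (c0 * t ^+ 2 + c1 * (t * t^*%C) + c2 * t^*%C ^+ 2)) <= e * normc t ^+ 2) ->
  c1 = 0 /\ c2 = 0.
Proof.
move=> rho0 dg g0 asym.
have tt (t : C) : t * t^*%C = (normc t ^+ 2)%:C%C.
  case: t => x y /=; rewrite sqr_sqrtr ?addr_ge0 ?sqr_ge0 //.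
  by apply/eqP; rewrite eq_complex /=; apply/andP; split; apply/eqP; ring.
have ii : 'i%C * 'i%C = -1 :> C by rewrite -expr2 sqr_i.
have dgi z : normc z < rho -> exists l, cder (fun w => g ('i%C * w)) z l.
  move=> zrho; have [|l dl] := dg ('i%C * z); first by rewrite normcM normc_i mul1r.
  exists ('i%C * l) => e e0; have [d d0 gd] := dl e e0; exists d => // h hd.
  have := gd ('i%C * h); rewrite mulrDr normcM normc_i mul1r.
  by rewrite [l * _]mulrCA mulrA; apply.
have dX2 z (c : C) : cder (fun w => c * w ^+ 2) z (c * (z * 1 + z * 1) + z ^+ 2 * 0).
  apply: cderM; first exact: cder_cst.
  have := cderM (cder_id z) (cder_id z); congr cder; apply/funext => w.
have asym' e : 0 < e -> exists2 d : R, 0 < d & forall t, normc t < d ->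
    normc (g t - c0 * t ^+ 2 - (c1 * (t * t^*%C) + c2 * t^*%C ^+ 2)) <= e * normc t ^+ 2.
  move=> e0; have [d d0 gd] := asym e e0; exists d => // t /gd.
  by rewrite -[c0 * _ + _ + _]addrA opprD addrA.
have c20 : 2 * c2 = 0.
  apply: (@normc_asymptotic_eq0
    (fun t => t ^+ 2 * (g t - g ('i%C * t) - 2 * c0 * t ^+ 2)) _ 4 rho) => //.
  - move=> z zrho; have [l dl] := dg z zrho; have [m dm] := dgi z zrho.
    have d2 := dX2 z 1.
    have := cderM d2 (cderB (cderB dl dm) (dX2 z (2 * c0))) => d3.
    by eexists; move: d3; congr cder; apply/funext => w; rewrite mul1r.
  - by rewrite expr0n /= mul0r.
  move=> e e0; have e2 : 0 < e / 2 by rewrite divr_gt0.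
  have [d d0 gd] := asym' _ e2; exists d => // t td.
  have h1 := gd t td; have := gd ('i%C * t).
  rewrite normcM normc_i mul1r => /(_ td).
  have -> : g ('i%C * t) - c0 * ('i%C * t) ^+ 2 -
     (c1 * ('i%C * t * ('i%C * t)^*%C) + c2 * ('i%C * t)^*%C ^+ 2) =
     g ('i%C * t) + c0 * t ^+ 2 - (c1 * (t * t^*%C) - c2 * t^*%C ^+ 2).
    have -> : ('i%C * t)^*%C = - ('i%C * t^*%C).
      rewrite [LHS]rmorphM /= -mulNr; congr (_ * _).
      by apply/eqP; rewrite eq_complex /= oppr0 !eqxx.
    move: ii; set i0 := 'i%C; set s := t^*%C => ii.
    have -> : c0 * (i0 * t) ^+ 2 = (i0 * i0) * c0 * t ^+ 2 by ring.
    have -> : c1 * (i0 * t * - (i0 * s)) = - (i0 * i0) * c1 * (t * s) by ring.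
    have -> : c2 * (- (i0 * s)) ^+ 2 = (i0 * i0) * c2 * s ^+ 2 by ring.
    by rewrite ii; ring.
  move=> h2.
  have -> : t ^+ 2 * (g t - g ('i%C * t) - 2 * c0 * t ^+ 2) -
      2 * c2 * (normc t ^+ 4)%:C%C = t ^+ 2 *
     ((g t - c0 * t ^+ 2 - (c1 * (t * t^*%C) + c2 * t^*%C ^+ 2)) -
      (g ('i%C * t) + c0 * t ^+ 2 - (c1 * (t * t^*%C) - c2 * t^*%C ^+ 2))).
    have -> : (normc t ^+ 4)%:C%C = (t * t^*%C) ^+ 2.
      by rewrite tt (_ : 4 = 2 * 2)%N // exprM; exact: (rmorphXn (real_complex R)).
    by ring.
  rewrite normcM normcX (_ : e * normc t ^+ 4 = normc t ^+ 2 * (e * normc t ^+ 2)); last by ring.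
  rewrite ler_wpM2l ?exprn_ge0 ?normc_ge0 //.
  by apply: le_trans (le_normcD _ _) _; rewrite normcN; lra.
have {}c20 : c2 = 0.
  by move/eqP: c20; rewrite mulf_eq0 pnatr_eq0 /= => /eqP.
split => //; apply: (@normc_asymptotic_eq0 (fun t => g t - c0 * t ^+ 2) _ 2 rho) => //.
- by move=> z /dg[l dl]; eexists; exact: cderB dl (dX2 z c0).
- by rewrite g0 expr0n /= mulr0 subr0.
move=> e /asym'[d d0 gd]; exists d => // t /gd.
by rewrite c20 mul0r addr0 tt.
Qed.

End OneVariable.

(** * Complex differentiability in several variables *)

Section RealNorm.
Variable R : realType.
Local Notation C := R[i].

(** The norm of a module over [R[i]] is a complex number on the real axis; its real part is a number
    of [R], open to linear arithmetic. *)
Definition rnorm (V : normedModType C) (x : V) : R := complex.Re `|x|.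

Variable V : normedModType C.
Implicit Types (x y : V).

Lemma rnormE x : `|x| = (rnorm x)%:C%C.
Proof. by rewrite RRe_real // ger0_real. Qed.

Lemma rnorm_ge0 x : 0 <= rnorm x.
Proof. by have := normr_ge0 x; rewrite rnormE ler0c. Qed.

Lemma rnorm0 : rnorm (0 : V) = 0.
Proof. by rewrite /rnorm normr0. Qed.

Lemma rnorm_eq0 x : (rnorm x == 0) = (x == 0).
Proof. by rewrite -(normr_eq0 x) rnormE eq_complex /= eqxx andbT. Qed.

Lemma rnormD x y : rnorm (x + y) <= rnorm x + rnorm y.
Proof. by rewrite -lecR rmorphD /= -!rnormE ler_normD. Qed.

Lemma rnormZ (a : C) x : rnorm (a *: x) = normc a * rnorm x.
Proof.
by apply: complexI; rewrite rmorphM /= -!rnormE normrZ.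
Qed.

Lemma near0_rnorm (P : V -> Prop) : (\forall x \near (0 : V), P x) <->
  exists2 d : R, 0 < d & forall x, rnorm x < d -> P x.
Proof.
split=> [/nbhs_ballP[e /= /gt0_realC[d d0 ->] dP]|[d d0 dP]].
  by exists d => // h hd; apply: dP; rewrite -ball_normE /= sub0r normrN rnormE ltcR.
apply/nbhs_ballP; exists d%:C%C; first by rewrite /= ltcR.
move=> h; rewrite -ball_normE /= sub0r normrN rnormE ltcR; exact: dP.
Qed.

Lemma near0_line (P : V -> Prop) v : (\forall x \near (0 : V), P x) ->
  exists2 d : R, 0 < d & forall c : C, normc c < d -> P (c *: v).
Proof.
move=> /near0_rnorm[d d0 dP]; have v1 : 0 < rnorm v + 1 by rewrite ltr_wpDl ?rnorm_ge0.
exists (d / (rnorm v + 1)); first by rewrite divr_gt0.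
move=> c; rewrite ltr_pdivlMr // => cd; apply: dP; rewrite rnormZ.
by apply: le_lt_trans cd; rewrite ler_wpM2l ?normc_ge0 // lerDl.
Qed.

End RealNorm.

Section Frechet.
Variable R : realType.
Local Notation C := R[i].

Lemma differentiable_rnorm (V W : normedModType C) (f : V -> W) x :
  differentiable f x ->
  forall e : R, 0 < e -> exists2 d : R, 0 < d & forall h, rnorm h < d ->
    rnorm (f (x + h) - f x - 'd f x h) <= e * rnorm h.
Proof.
move=> df e e0; have := diff_locally df.
move/eqaddoP => /(_ e%:C%C); rewrite ltcR => /(_ e0) /near0_rnorm[d d0 fd].
exists d => // h /fd.
rewrite [X in X <= _]rnormE [`|_ h|]rnormE -rmorphM /= lecR.
rewrite [x + h]addrC -addrA -opprD; exact.
Qed.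

Variable V : normedModType C.
Implicit Types (f : V -> C^o) (x v h : V).

Lemma rnorm_normc (z : C^o) : rnorm z = normc (z : C).
Proof. by []. Qed.

Lemma cder_line f x v (z : C) : differentiable f (x + z *: v) ->
  cder (fun w => f (x + w *: v)) z ('d f (x + z *: v) v).
Proof.
move=> df e e0.
have v0 : 0 < rnorm v + 1 by rewrite ltr_wpDl ?rnorm_ge0.
have e1 : 0 < e / (rnorm v + 1) by rewrite divr_gt0.
have [d d0 fd] := differentiable_rnorm df e1.
exists (d / (rnorm v + 1)); first by rewrite divr_gt0.
move=> h; rewrite ltr_pdivlMr // => hd.
have hv : normc h * rnorm v <= normc h * (rnorm v + 1).
  by rewrite ler_wpM2l ?normc_ge0 // lerDl.
have := fd (h *: v); rewrite rnormZ => /(_ (le_lt_trans hv hd)).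
rewrite linearZ /= rnorm_normc scalerDl addrA [h *: ('d f _ v)]mulrC.
move=> /le_trans; apply; apply: (@le_trans _ _ (e / (rnorm v + 1) * (normc h * (rnorm v + 1)))).
  by rewrite ler_wpM2l // ltW.
by rewrite mulrCA mulrC divfK ?lexx // gt_eqF.
Qed.

(* With D(w) = psi(x + w v) - psi(x), psi = f - f(0) - df(0), and k = D/w, the
   functions w k^n are holomorphic even at 0; the maximum principle on a circle
   around t bounds k(t) after letting n go to infinity. *)
Lemma strictly_differentiable f (rho : R) : 0 < rho ->
  (forall x, rnorm x < rho -> differentiable f x) ->
  forall e : R, 0 < e -> exists2 d : R, 0 < d & forall x h,
    rnorm x < d -> rnorm h < d ->
    normc (f (x + h) - f x - 'd f 0 h : C) <= e * rnorm h.
Proof.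
move=> rho0 df e e0.
pose psi x : C^o := f x - f 0 - 'd f 0 x.
have e14 : 0 < e / 14 by rewrite divr_gt0.
have df0 : differentiable f 0 by apply: df; rewrite rnorm0.
have [d1 d10 fd] := differentiable_rnorm df0 e14.
pose dl := Num.min rho d1; have dl0 : 0 < dl by rewrite lt_min rho0.
have [dlr dld] : dl <= rho /\ dl <= d1 by rewrite !ge_min !lexx orbT.
have psib y : rnorm y < dl -> normc (psi y) <= e / 14 * rnorm y.
  by move=> yd; have := fd y (lt_le_trans yd dld); rewrite add0r.
have dpsi y : rnorm y < dl -> differentiable psi y.
  move=> yd; apply: differentiableB.
    apply: differentiableB; first by apply: df; exact: lt_le_trans dlr.
    exact: differentiable_cst.
  by apply: linear_differentiable; exact: diff_continuous df0.
exists (dl / 8); first by rewrite divr_gt0.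
move=> x h xd hd.
have -> : f (x + h) - f x - 'd f 0 h = psi (x + h) - psi x.
  by rewrite /psi linearD /=; ring.
have [->|h0] := eqVneq h 0.
  by rewrite addr0 subrr normc0 rnorm0 mulr0.
pose t := rnorm h; have t0 : 0 < t by rewrite lt_def rnorm_eq0 h0 rnorm_ge0.
pose v := (t^-1)%:C%C *: h.
have v1 : rnorm v = 1.
  by rewrite rnormZ normc_real gtr0_norm ?invr_gt0 // mulVf // gt_eqF.
have hE : h = t%:C%C *: v.
  rewrite scalerA -rmorphM /= divff ?gt_eqF // scale1r //.
pose D (w : C) : C := psi (x + w *: v) - psi x.
have wv w : rnorm (x + w *: v) <= rnorm x + normc w.
  by apply: le_trans (rnormD _ _) _; rewrite rnormZ v1 mulr1.
have dD w : normc w < 7 / 8 * dl -> exists m, cder D w m.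
  move=> wd; exists ('d psi (x + w *: v) v - 0); apply: cderB (cder_cst _ _).
  by apply: cder_line; apply: dpsi; have := wv w; lra.
have D0 : D 0 = 0 by rewrite /D scale0r addr0 subrr.
have [l dl'] : exists l, cder D 0 l by apply: dD; rewrite normc0; lra.
pose k w := if w == 0 then l else D w / w.
have ck : ccont k 0.
  by have [|//] := @cder_quotient _ D l 0 D0 dl'; rewrite eqxx.
have dk z : normc z < 7 / 8 * dl -> z != 0 -> exists m, cder k z m.
  by move=> zd z0; have [_] := cder_quotient D0 dl' (fun _ => dD z zd); exact.
have tC : normc t%:C%C = t by rewrite normc_real gtr0_norm.
have tC0 : t%:C%C != 0 :> C by rewrite -normc_eq0 tC gt_eqF.
(* As t < dl / 8, the circle of radius dl / 5 around t satisfies 3/40 dl <= |z| <= dl / 2. There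
   |D(z)| <= e / 14 * dl, and 1/14 < 3/40 gives |k(z)| <= e. *)
have key n : t * normc (k t%:C%C) ^+ n <= dl / 2 * e ^+ n.
  pose g w := w * k w ^+ n.
  have [|||z zr] := @ex_circle_normc_ge R g t%:C%C (dl / 2) (dl / 5).
  - by rewrite divr_gt0.
  - lra.
  - move=> z zt.
    have zn : normc z < 7 / 8 * dl.
      by have := ler_normcB z t%:C%C; rewrite tC -/t in hd *; lra.
    have [->|z0] := eqVneq z 0; first by exists (k 0 ^+ n); apply: cder_mulid; exact: ccontX.
    have [m /(cderX n)[m' dm]] := dk z zn z0.
    by eexists; exact: cderM (cder_id z) dm.
  rewrite /g !normcM !normcX tC => /le_trans; apply.
  have z1 : normc z <= dl / 2.
    by have := ler_normcB z t%:C%C; rewrite tC -/t in hd *; lra.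
  have z2 : 3 / 40 * dl <= normc z.
    by have := ler_normcB (z - t%:C%C) (- t%:C%C); rewrite normcN opprK subrK tC -/t in hd *; lra.
  have zn0 : z != 0 by rewrite -normc_eq0; apply/eqP; lra.
  apply: ler_pM; rewrite ?exprn_ge0 ?normc_ge0 //.
  apply: lerXn2r; rewrite ?nnegrE ?normc_ge0 ?(ltW e0) //.
  rewrite /k (negbTE zn0) normcM normcV ler_pdivrMr; last by lra.
  have h1 : normc (psi (x + z *: v)) <= e / 14 * (rnorm x + normc z).
    apply: le_trans (psib _ _) _; first by have := wv z; lra.
    by rewrite ler_wpM2l ?wv // ltW.
  have h2 : normc (psi x) <= e / 14 * rnorm x by apply: psib; lra.
  have := le_normcD (psi (x + z *: v) : C) (- psi x : C); rewrite normcN -/(D z) => h3.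
  have h4 : e / 14 * (rnorm x + normc z) + e / 14 * rnorm x <= e / 14 * dl.
    by rewrite -mulrDr ler_wpM2l ?(ltW e14) //; lra.
  have h5 : e * (3 / 40 * dl) <= e * normc z by rewrite ler_wpM2l // ltW.
  have h6 : 0 < e * dl by rewrite mulr_gt0.
  lra.
have := ler_of_expn (normc_ge0 _) e0 t0 key; rewrite /k (negbTE tC0) normcM normcV tC.
rewrite ler_pdivrMr // /D -hE; exact.
Qed.

End Frechet.

(** * Zeros on complex planes are not isolated *)

Section IsolatedZero.
Variable R : realType.
Local Notation C := R[i].

Lemma normc_circle_continuous (f : C -> C) (r : R) : 0 < r ->
  (forall t, ccont f (circle r t)) ->
  continuous (fun t : R => normc (f (circle r t))).
Proof.
move=> r0 cf t; apply/cvgrPdist_le => /= e e0.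
have [d d0 fd] := cf t e e0.
have [d1 d10 h1] := circle_der r t ltr01.
have r10 : 0 < r + 1 by lra.
have d2 : 0 < Num.min d1 (d / (r + 1)) by rewrite lt_min d10 divr_gt0.
apply/nbhs_ballP; exists (Num.min d1 (d / (r + 1))) => // s.
rewrite /ball /= distrC lt_min ltr_pdivlMr // => /andP[sd1 sd].
have := h1 (s - t) sd1; rewrite [t + _]addrC subrK; set D := circle r s - circle r t => HD.
have Dd : normc D < d.
  apply: le_lt_trans sd.
  have := le_normcD (D - 'i%C * circle r t * (s - t)%:C%C) ('i%C * circle r t * (s - t)%:C%C).
  rewrite subrK !normcM normc_i mul1r normc_circle ?(ltW r0) // normc_real.
  by move/le_trans; apply; lra.
have := fd D Dd; rewrite /D [circle r t + _]addrC subrK => H.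
have := ler_normcB (f (circle r s)) (f (circle r t)).
have := ler_normcB (f (circle r t)) (f (circle r s)).
rewrite [normc (f (circle r t) - _)]normc_distC ler_norml; lra.
Qed.

(* Otherwise 1 / u is holomorphic in a along the lines b = const != 0, and blows
   up at a = 0 as b -> 0 while staying bounded on the circles |a| = r. *)
Lemma zero_not_isolated (V : normedModType C) (u : V -> C^o) (v v' : V) (rho d : R) :
  0 < rho -> (forall x, rnorm x < rho -> differentiable u x) -> u 0 = 0 -> 0 < d ->
  exists a b : C, [/\ normc a < d, normc b < d, u (a *: v + b *: v') = 0 &
    ~ (a = 0 /\ b = 0)].
Proof.
move=> rho0 du u0 d0; apply: contrapT => noz.
have iso (a b : C) : normc a < d -> normc b < d -> u (a *: v + b *: v') = 0 -> a = 0 /\ b = 0.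
  by move=> ad bd uab; apply: contrapT => nab; apply: noz; exists a, b.
have [d2 d20 sd] := strictly_differentiable rho0 du ltr01.
pose N := rnorm v + rnorm v' + 1.
have := rnorm_ge0 v; have := rnorm_ge0 v' => v'0 v0.
have N0 : 0 < N by rewrite /N; lra.
pose s := Num.min d (Num.min (rho / N) (d2 / N)).
have s0 : 0 < s by rewrite !lt_min d0 !divr_gt0.
have [sd' srho sd2] : [/\ s <= d, s * N <= rho & s * N <= d2].
  by rewrite -!ler_pdivlMr // !ge_min !lexx !orbT.
have small (a b : C) : normc a < s -> normc b < s -> rnorm (a *: v + b *: v') < s * N.
  move=> a_s b_s; apply: le_lt_trans (rnormD _ _) _; rewrite !rnormZ.
  have : normc a * rnorm v <= s * rnorm v by rewrite ler_wpM2r // ltW.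
  have : normc b * rnorm v' <= s * rnorm v' by rewrite ler_wpM2r // ltW.
  rewrite /N; lra.
pose r := s / 3; have r0 : 0 < r by rewrite divr_gt0.
have crs t : normc (circle r t) < s by rewrite normc_circle ?(ltW r0) // /r; lra.
have n0s : normc (0 : C) < s by rewrite normc0.
pose C1 := normc ('d u 0 v' : C) + rnorm v'.
have C10 : 0 <= C1 by rewrite addr_ge0 // normc_ge0.
have lip (a b : C) : normc a < s -> normc b < s ->
    normc (u (a *: v + b *: v') - u (a *: v)) <= C1 * normc b.
  move=> a_s b_s.
  have h1 : rnorm (a *: v) < d2.
    by have := small a 0 a_s n0s; rewrite scale0r addr0; lra.
  have h2 : rnorm (b *: v') < d2.
    by have := small 0 b n0s b_s; rewrite scale0r add0r; lra.
  have := sd _ _ h1 h2; rewrite mul1r rnormZ linearZ /=.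
  set X := u _ - u _ => h.
  have := le_normcD (X - b *: 'd u 0 v' : C) (b *: 'd u 0 v' : C).
  rewrite subrK => /le_trans; apply.
  rewrite [normc (b *: _)]normcM /C1.
  by move: h; rewrite mulrDl; set Y := normc _; rewrite ![_ * normc b]mulrC; lra.
have cc t : ccont (fun a : C => u (a *: v) : C) (circle r t).
  have := @cder_line R V u 0 v (circle r t); rewrite add0r => H.
  have /H/cder_ccont : differentiable u (circle r t *: v).
    by apply: du; have := small _ 0 (crs t) n0s; rewrite scale0r addr0; lra.
  by congr ccont; apply/funext => a; rewrite add0r.
have [||t0 _ tmin] := @EVT_min R (fun t => normc (u (circle r t *: v) : C)) 0 (pi *+ 2).
- by rewrite mulrn_wge0 // pi_ge0.
- by apply: continuous_subspaceT; exact: normc_circle_continuous r0 cc.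
set m := normc _ in tmin.
have m0 : 0 < m.
  rewrite normc_gt0; apply/eqP => uz.
  have [] := iso (circle r t0) 0.
  - exact: lt_le_trans (crs _) sd'.
  - by rewrite normc0.
  - by rewrite scale0r addr0.
  by move=> c0 _; have := normc_circle t0 (ltW r0); rewrite c0 normc0; lra.
(* This size of b gives |u| <= m / 4 at a = 0 and |u| >= 3 m / 4 on the circle, which contradicts
   the inequality obtained from [circle_Re_eq] for 1 / u. *)
pose be := Num.min (s / 2) (m / (4 * (C1 + 1))).
have C11 : 0 < 4 * (C1 + 1) by lra.
have be0 : 0 < be by rewrite lt_min !divr_gt0.
have [bes beC] : be <= s / 2 /\ be * (4 * (C1 + 1)) <= m.
  by rewrite -ler_pdivlMr // !ge_min !lexx orbT.
pose b : C := be%:C%C.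
have bn : normc b = be by rewrite normc_real gtr0_norm.
have b_s : normc b < s by rewrite bn; lra.
have b0 : b != 0 by rewrite -normc_eq0 bn gt_eqF.
have ub0 (a : C) : normc a < s -> u (b *: v' + a *: v) != 0.
  move=> a_s; apply/eqP; rewrite addrC => uz.
  have [_ /eqP] := iso a b (lt_le_trans a_s sd') (lt_le_trans b_s sd') uz.
  by rewrite (negbTE b0).
have [||t t2pi] := @circle_Re_eq R (fun a => u (b *: v') * (u (b *: v' + a *: v))^-1) s r r0.
- by rewrite /r; lra.
- move=> z zs; eexists; apply: cderM (cder_cst _ _) _.
  apply: (@cderV R (fun a => u (b *: v' + a *: v))); last exact: ub0.
  apply: cder_line; apply: du; rewrite addrC; have := small z b zs b_s; lra.
rewrite scale0r addr0 divff; last by have := ub0 0 n0s; rewrite scale0r addr0.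
set z := circle r t => E.
have uz : 0 < normc (u (b *: v' + z *: v) : C) by rewrite normc_gt0 ub0 // crs.
have h1 : normc (u (b *: v' + z *: v) : C) <= normc (u (b *: v') : C).
  rewrite -[leLHS]mul1r -ler_pdivlMr //.
  have := ler_Re_normc (u (b *: v') / u (b *: v' + z *: v) : C).
  by rewrite E /= normr1 normcM normcV.
have h2 := lip 0 b n0s b_s; rewrite scale0r add0r u0 subr0 bn in h2.
have h3 := lip z b (crs t) b_s; rewrite bn [z *: v + _]addrC in h3.
have h4 : m <= normc (u (z *: v) : C).
  apply: tmin; move: t2pi; rewrite !in_itv /= => /andP[*]; by rewrite !ltW.
have := ler_normcB (u (z *: v) : C) (u (b *: v' + z *: v) : C).
rewrite normc_distC => h5; lra.
Qed.

End IsolatedZero.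

(** * Germs *)

Section GermTheory.
Variables (k : numFieldType) (n : nat).
Local Notation V := 'rV[k]_n.
Implicit Types (f g F G : V -> V).

Lemma near_germ_comp (F : V -> V) (P : V -> Prop) : F 0 = 0 -> differentiable F 0 ->
  (\forall x \near (0 : V), P x) -> \forall x \near (0 : V), P (F x).
Proof.
move=> F0 /differentiable_continuous cF nP.
by have := cF P; rewrite F0; exact.
Qed.

Lemma holomorphic_at0_differentiable (W : normedModType k) (f : V -> W) :
  holomorphic_at0 f -> differentiable f 0.
Proof. exact: nbhs_singleton. Qed.

Lemma germ_eq_sym f g : germ_eq f g -> germ_eq g f.
Proof. by rewrite /germ_eq; apply: filterS => x ->. Qed.

Lemma germ_eq_trans f g h : germ_eq f g -> germ_eq g h -> germ_eq f h.
Proof. by rewrite /germ_eq; apply: filterS2 => x -> ->. Qed.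

Lemma germ_biholo_comp f g : germ_biholo f -> germ_biholo g -> germ_biholo (f \o g).
Proof.
move=> [f0 hf [f' [f'0 hf' ff' f'f]]] [g0 hg [g' [g'0 hg' gg' g'g]]].
have dg := holomorphic_at0_differentiable hg.
have df' := holomorphic_at0_differentiable hf'.
have holo_comp (u v : V -> V) : v 0 = 0 -> holomorphic_at0 u -> holomorphic_at0 v ->
    holomorphic_at0 (u \o v).
  move=> v0 hu hv; have := near_germ_comp v0 (holomorphic_at0_differentiable hv) hu.
  by rewrite /holomorphic_at0; move: hv; apply: filterS2 => x dv du; exact: differentiable_comp.
have inv_comp (u u' v v' : V -> V) : germ_eq (u \o u') id -> germ_eq (v \o v') id ->
    u' 0 = 0 -> differentiable u' 0 -> germ_eq ((u \o v) \o (v' \o u')) id.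
  move=> uu' vv' u'0 du'; have := near_germ_comp u'0 du' vv'.
  by rewrite /germ_eq; move: uu'; apply: filterS2 => x /= e1 ->.
split; first by rewrite /= g0.
  exact: holo_comp.
exists (g' \o f'); split; first by rewrite /= f'0.
- exact: holo_comp.
- exact: inv_comp.
- exact: inv_comp.
Qed.

Lemma germ_biholo_inv f : germ_biholo f -> exists2 g, germ_biholo g &
  germ_eq (f \o g) id /\ germ_eq (g \o f) id.
Proof.
move=> [f0 hf [g [g0 hg fg gf]]]; exists g => //.
by split=> //; exists f; split.
Qed.

Lemma holo_equiv_sym (M N : set V) : holo_equiv M N -> holo_equiv N M.
Proof.
move=> [f bf MN]; have [g bg [fg gf]] := germ_biholo_inv bf.
exists g => //; have [g0 /holomorphic_at0_differentiable dg _] := bg.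
have := near_germ_comp g0 dg MN; move: fg; apply: filterS2 => x /= -> ->.
by split.
Qed.

Lemma holo_equiv_trans (M N Q : set V) :
  holo_equiv M N -> holo_equiv N Q -> holo_equiv M Q.
Proof.
move=> [f bf MN] [g bg NQ]; exists (g \o f); first exact: germ_biholo_comp.
have [f0 /holomorphic_at0_differentiable df _] := bf.
have := near_germ_comp f0 df NQ; move: MN; apply: filterS2 => x h1 h2.
exact: iff_trans h1 h2.
Qed.

Lemma germ_eq_diff f g (h : V) : germ_eq f g -> differentiable f 0 ->
  differentiable g 0 -> 'd f 0 h = 'd g 0 h.
Proof.
move=> fg df dg.
have ef := @deriveE k V V f 0 h df.
have eg := @deriveE k V V g 0 h dg.
have e := @near_eq_derive k V V f g 0 h fg.
by apply: etrans (etrans (esym ef) e) eg.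
Qed.

Lemma germ_biholo_jacobian_unit f : germ_biholo f -> 'J f 0 \in unitmx.
Proof.
move=> [f0 hf [g [g0 hg fg gf]]].
have df := holomorphic_at0_differentiable hf.
have dg := holomorphic_at0_differentiable hg.
have dgf : differentiable g (f 0) by rewrite f0.
have E : 'J f 0 *m 'J g (f 0) = 1%:M.
  apply/row_matrixP => i; rewrite !rowE mulmxA !mul_rV_lin1 /= mulmx1.
  set h := delta_mx 0 i.
  have did : is_diff (0 : 'rV[k]_n) id id by exact: is_diff_id.
  have e1 := germ_eq_diff h gf (differentiable_comp df dgf) (@ex_diff _ _ _ _ _ _ _ did).
  have e2 := congr1 (fun F => F h) (diff_comp df dgf).
  have e3 := congr1 (fun F => F h) (@diff_val _ _ _ _ _ _ _ did).
  exact: etrans (esym e2) (etrans e1 e3).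
exact: (mulmx1_unit E).1.
Qed.

End GermTheory.

Section CoordinateDifferentiability.
Variables (k : numFieldType).

Lemma differentiable_coords (V : normedModType k) n (f : V -> 'rV[k]_n) x :
  (forall j, differentiable (fun y => f y 0 j : k^o) x) -> differentiable f x.
Proof.
move=> df.
have -> : f = \sum_(j < n) (fun y => (f y 0 j : k^o) *: (delta_mx 0 j : 'rV[k]_n)).
  by apply/funext => y; rewrite fct_sumE -row_sum_delta.
by apply: differentiable_sum => j; apply: differentiableZl.
Qed.

Lemma differentiable_coord_comp (V : normedModType k) n (f : V -> 'rV[k]_n) j x :
  differentiable f x -> differentiable (fun y => f y 0 j : k^o) x.
Proof.
move=> df; have := @differentiable_coord k 1 n (f x) 0 j.
exact: (@differentiable_comp k V _ _ f (fun N : 'rV[k]_n => N 0 j : k^o)).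
Qed.

Lemma differentiable_bigsum (V : normedModType k) (I : finType) (f : I -> V -> k^o) x :
  (forall i, differentiable (f i) x) -> differentiable (fun y => \sum_i f i y) x.
Proof.
move=> df; rewrite (_ : (fun y => _) = \sum_(i < #|I|) f (enum_val i)).
  by apply: differentiable_sum.
by apply/funext => y; rewrite fct_sumE (reindex_onto _ _ (fun i _ => enum_rankK i)) //=;
  apply: eq_bigl => i; rewrite enum_valK eqxx.
Qed.

Lemma differentiable_mulmxr m n (T : 'M[k]_(m, n)) (x : 'rV[k]_m) :
  differentiable (fun y : 'rV[k]_m => y *m T) x.
Proof.
apply: differentiable_coords => j.
rewrite (_ : (fun y => _) = (fun y : 'rV[k]_m => \sum_i (y 0 i * T i j : k^o))); last first.
  by apply/funext => y; rewrite mxE.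
apply: differentiable_bigsum => i; apply: differentiableM; last exact: differentiable_cst.
exact: differentiable_coord.
Qed.

Lemma diff_coord_comp (V : normedModType k) n (f : V -> 'rV[k]_n) j x h :
  differentiable f x -> 'd (fun y => f y 0 j : k^o) x h = 'd f x h 0 j.
Proof.
move=> df; rewrite -deriveE; last exact: differentiable_coord_comp.
have dc := @differentiable_coord k 1 n (f x) 0 j.
rewrite deriveE; last exact: differentiable_coord_comp.
rewrite (@diff_comp k V _ _ f (fun N : 'rV[k]_n => N 0 j : k^o)) //=.
have @g : {linear 'rV[k]_n -> k^o}.
  by exists (fun N : 'rV[k]_n => N 0 j); do 2![eexists]; do ?[constructor];
     rewrite ?mxE// => ? *; rewrite ?mxE//; move=> ?; rewrite !mxE.
by rewrite (_ : (fun _ => _) = g) // diff_lin //; exact: coord_continuous.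
Qed.

End CoordinateDifferentiability.

(** * Equivalences of the quadrics Q_(B, gamma) *)

Section Orders.
Variable R : realType.
Local Notation C := R[i].
Implicit Types (F G : C -> C) (N M : C -> R).

(** Landau's o(|t|^k) at 0, followed by O(|t|^k); the bounds are one-sided because norms are
    substituted for [N]. *)
Definition little (k : nat) N := forall e : R, 0 < e -> exists2 d : R, 0 < d &
  forall t, normc t < d -> N t <= e * normc t ^+ k.

Definition big (k : nat) N := exists2 K : R, 0 <= K & exists2 d : R, 0 < d &
  forall t, normc t < d -> N t <= K * normc t ^+ k.

Local Notation nc F := (fun t => normc (F t)).

Lemma little_le k N M (d : R) : 0 < d -> (forall t, normc t < d -> N t <= M t) ->
  little k M -> little k N.
Proof.
move=> d0 NM sM e e0; have [d' d'0 h] := sM e e0.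
exists (Num.min d d'); first by rewrite lt_min d0.
by move=> t; rewrite lt_min => /andP[/NM h1 /h h2]; exact: le_trans h1 h2.
Qed.

Lemma littleD k F G : little k (nc F) -> little k (nc G) ->
  little k (nc (fun t => F t + G t)).
Proof.
move=> sF sG e e0; have e2 : 0 < e / 2 by rewrite divr_gt0.
have [d1 d10 h1] := sF _ e2; have [d2 d20 h2] := sG _ e2.
exists (Num.min d1 d2); first by rewrite lt_min d10.
move=> t; rewrite lt_min => /andP[/h1 + /h2].
by have := le_normcD (F t) (G t); lra.
Qed.

Lemma littleM a b F G : little a (nc F) -> big b (nc G) ->
  little (a + b) (nc (fun t => F t * G t)).
Proof.
move=> sF [K K0 [d d0 h]] e e0.
have K1 : 0 < K + 1 by lra.
have [d1 d10 h1] := sF _ (divr_gt0 e0 K1).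
exists (Num.min d d1); first by rewrite lt_min d0.
move=> t; rewrite lt_min => /andP[/h hG /h1 hF]; rewrite normcM.
apply: le_trans (ler_pM (normc_ge0 _) (normc_ge0 _) hF hG) _.
rewrite (_ : _ * (K * _) = K / (K + 1) * (e * normc t ^+ (a + b))).
  by apply: ler_piMl; [rewrite mulr_ge0 ?(ltW e0) // exprn_ge0 ?normc_ge0|rewrite ler_pdivrMr //; lra].
by rewrite exprD; field; lra.
Qed.

Lemma bigD k F G : big k (nc F) -> big k (nc G) -> big k (nc (fun t => F t + G t)).
Proof.
move=> [K K0 [d1 d10 h1]] [L L0 [d2 d20 h2]]; exists (K + L); first by rewrite addr_ge0.
exists (Num.min d1 d2); first by rewrite lt_min d10.
move=> t; rewrite lt_min => /andP[/h1 + /h2].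
by rewrite mulrDl; have := le_normcD (F t) (G t); lra.
Qed.

Lemma bigM a b F G : big a (nc F) -> big b (nc G) -> big (a + b) (nc (fun t => F t * G t)).
Proof.
move=> [K K0 [d1 d10 h1]] [L L0 [d2 d20 h2]]; exists (K * L); first by rewrite mulr_ge0.
exists (Num.min d1 d2); first by rewrite lt_min d10.
move=> t; rewrite lt_min => /andP[/h1 hF /h2 hG]; rewrite normcM exprD.
apply: le_trans (ler_pM (normc_ge0 _) (normc_ge0 _) hF hG) _.
by rewrite mulrACA.
Qed.

Lemma little_big k N : little k N -> big k N.
Proof.
by move=> sN; have [d d0 h] := sN 1 ltr01; exists 1 => //; exists d.
Qed.

Lemma big_little k N : big k.+1 N -> little k N.
Proof.
move=> [K K0 [d d0 h]] e e0; have K1 : 0 < K + 1 by lra.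
exists (Num.min d (e / (K + 1))); first by rewrite lt_min d0 divr_gt0.
move=> t; rewrite lt_min ltr_pdivlMr // => /andP[/h ht te].
apply: le_trans ht _; rewrite exprS mulrA ler_wpM2r ?exprn_ge0 ?normc_ge0 //.
have := normc_ge0 t; lra.
Qed.

Lemma big_cst (c : C) : big 0 (nc (fun=> c)).
Proof. by exists (normc c); [exact: normc_ge0|exists 1 => // t _; rewrite expr0 mulr1]. Qed.

Lemma big_id : big 1 (nc id).
Proof. by exists 1 => //; exists 1 => // t _; rewrite mul1r expr1. Qed.

Lemma normc_conj (z : C) : normc z^*%C = normc z.
Proof. by case: z => x y /=; rewrite sqrrN. Qed.

Lemma big_conj : big 1 (nc (fun t => t^*%C)).
Proof. by exists 1 => //; exists 1 => // t _; rewrite normc_conj mul1r expr1. Qed.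

Lemma little_conj k F : little k (nc F) -> little k (nc (fun t => (F t)^*%C)).
Proof.
move=> sF e e0; have [d d0 h] := sF e e0; exists d => // t /h.
by rewrite normc_conj.
Qed.

Lemma littleZ k (c : C) F : little k (nc F) -> little k (nc (fun t => c * F t)).
Proof.
move=> sF; have := littleM sF (big_cst c); rewrite addn0; apply: little_le ltr01 _ => t _.
by rewrite mulrC.
Qed.

Lemma bigZ k (c : C) F : big k (nc F) -> big k (nc (fun t => c * F t)).
Proof. exact: bigM (big_cst c). Qed.

Lemma little_sum (I : finType) k (F : I -> C -> C) : (forall i, little k (nc (F i))) ->
  little k (nc (fun t => \sum_i F i t)).
Proof.
move=> sF; elim: (index_enum I) => [|i s IH].
  move=> e e0; exists 1 => // t _; rewrite big_nil normc0.
  by rewrite mulr_ge0 ?(ltW e0) // exprn_ge0 // normc_ge0.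
by apply: little_le ltr01 _ (littleD (sF i) IH) => t _; rewrite big_cons.
Qed.

Lemma little0 k (c : C) : little k (nc (fun t => c * t ^+ k)) -> c = 0.
Proof.
move=> sc; apply/eqP/negPn/negP => c0.
have cn : 0 < normc c by rewrite normc_gt0.
have [d d0 h] := sc _ (divr_gt0 cn (ltr0Sn _ 1)).
pose t : C := (d / 2)%:C%C.
have d2 : 0 < d / 2 by rewrite divr_gt0.
have tn : normc t = d / 2 by rewrite normc_real gtr0_norm.
have := h t; rewrite tn normcM normcX tn => /(_ _)h'.
have : 0 < (d / 2) ^+ k by rewrite exprn_gt0.
have /h' : d / 2 < d by lra.
by move: ((d / 2) ^+ k) => X; nra.
Qed.

Section Frechet.
Variable V : normedModType C.
Implicit Types (phi : V -> C^o) (x h : C -> V).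

Lemma big_rnormD k x h : big k (fun t => rnorm (x t)) -> big k (fun t => rnorm (h t)) ->
  big k (fun t => rnorm (x t + h t)).
Proof.
move=> [K K0 [d1 d10 h1]] [L L0 [d2 d20 h2]]; exists (K + L); first by rewrite addr_ge0.
exists (Num.min d1 d2); first by rewrite lt_min d10.
move=> t; rewrite lt_min => /andP[/h1 + /h2].
by rewrite mulrDl; have := rnormD (x t) (h t); lra.
Qed.

Lemma big_rnormZ k F (v : V) : big k (nc F) -> big k (fun t => rnorm (F t *: v)).
Proof.
move=> [K K0 [d d0 h]]; exists (K * rnorm v); first by rewrite mulr_ge0 ?rnorm_ge0.
exists d => // t /h; rewrite rnormZ mulrAC => ht.
by rewrite ler_wpM2r // rnorm_ge0.
Qed.

Lemma big_rnorm_sum (I : finType) k (x : I -> C -> V) :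
  (forall i, big k (fun t => rnorm (x i t))) -> big k (fun t => rnorm (\sum_i x i t)).
Proof.
move=> bx; elim: (index_enum I) => [|i s IH].
  exists 0 => //; exists 1 => // t _; by rewrite big_nil rnorm0 mul0r.
have [K K0 [d d0 h]] := big_rnormD (bx i) IH.
by exists K => //; exists d => // t; rewrite big_cons; exact: h.
Qed.

Lemma big_small k N (r : R) : 0 < r -> big k.+1 N ->
  exists2 d, 0 < d & forall t, normc t < d -> N t < r.
Proof.
move=> r0 [K K0 [d d0 h]]; have K1 : 0 < K + 1 by lra.
exists (Num.min d (Num.min 1 (r / (K + 1)))); first by rewrite !lt_min d0 ltr01 divr_gt0.
move=> t; rewrite !lt_min ltr_pdivlMr // => /and3P[/h ht t1 tr].
apply: le_lt_trans ht _; rewrite exprS mulrA.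
have tk : normc t ^+ k <= 1 by rewrite exprn_ile1 ?normc_ge0 // ltW.
have Kt : 0 <= K * normc t by rewrite mulr_ge0 ?normc_ge0.
have := ler_piMr Kt tk; have := normc_ge0 t; lra.
Qed.

Lemma little_diff phi x : differentiable phi 0 -> big 1 (fun t => rnorm (x t)) ->
  little 1 (fun t => normc (phi (x t) - phi 0 - 'd phi 0 (x t) : C)).
Proof.
move=> dphi bx e e0; have [K K0 [d d0 h]] := bx; have K1 : 0 < K + 1 by lra.
have [d1 d10 h1] := differentiable_rnorm dphi (divr_gt0 e0 K1).
have [d2 d20 h2] := big_small d10 bx.
exists (Num.min d d2); first by rewrite lt_min d0.
move=> t; rewrite lt_min => /andP[/h hK /h2 /h1]; rewrite add0r => /le_trans; apply.
rewrite mulrAC ler_pdivrMr // -mulrA ler_wpM2l ?(ltW e0) //; apply: le_trans hK _.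
by rewrite mulrC ler_wpM2l ?exprn_ge0 ?normc_ge0 //; lra.
Qed.

(** The base point [x t] moves and is only O(t), while the increment [h t] has higher order.
    Differentiability at 0 alone would leave an error o(|x t|); strict differentiability makes it
    o(|h t|). *)
Lemma little_strict_diff phi x h k (rho : R) : 0 < rho ->
  (forall y, rnorm y < rho -> differentiable phi y) ->
  big 1 (fun t => rnorm (x t)) -> big k.+1 (fun t => rnorm (h t)) ->
  little k.+1 (fun t => normc (phi (x t + h t) - phi (x t) - 'd phi 0 (h t) : C)).
Proof.
move=> rho0 dphi bx bh e e0; have [K K0 [d d0 hK]] := bh; have K1 : 0 < K + 1 by lra.
have [d1 d10 h1] := strictly_differentiable rho0 dphi (divr_gt0 e0 K1).
have [d2 d20 h2] := big_small d10 bx; have [d3 d30 h3] := big_small d10 bh.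
exists (Num.min d (Num.min d2 d3)); first by rewrite !lt_min d0 d20.
move=> t; rewrite !lt_min => /and3P[/hK ht /h2 xd /h3 hd].
apply: le_trans (h1 _ _ xd hd) _.
rewrite mulrAC ler_pdivrMr // -mulrA ler_wpM2l ?(ltW e0) //; apply: le_trans ht _.
by rewrite mulrC ler_wpM2l ?exprn_ge0 ?normc_ge0 //; lra.
Qed.

End Frechet.
End Orders.

Section CoordinateOrders.
Variables (R : realType) (n : nat).
Local Notation C := R[i].
Local Notation K := (R[i] : numFieldType).
Local Notation V := 'rV[K]_n.
Variable (f : V -> V).
Hypothesis (f0 : f 0 = 0) (hf : holomorphic_at0 f).

Lemma diff_coordE i (h : V) :
  'd (fun y => f y 0 i : C^o) 0 h = (h *m 'J f 0) 0 i.
Proof.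
have df := holomorphic_at0_differentiable hf.
have e1 := diff_coord_comp i h df.
have e2 : h *m 'J f 0 = 'd f 0 h by exact: mul_rV_lin1.
exact: etrans e1 (congr1 (fun v : V => v 0 i) (esym e2)).
Qed.

Lemma little_coord i (x : C -> V) : big 1 (fun t => rnorm (x t)) ->
  little 1 (fun t => normc (f (x t) 0 i - (x t *m 'J f 0) 0 i)).
Proof.
move=> bx; have df := holomorphic_at0_differentiable hf.
have H := little_diff (differentiable_coord_comp i df) bx.
apply: (little_le ltr01 _ H) => t _.
have -> : (x t *m 'J f 0) 0 i = 'd (fun y => f y 0 i : C^o) 0 (x t).
  exact: esym (diff_coordE _ _).
have -> : f 0 0 i = 0 by rewrite f0 mxE.
by rewrite subr0.
Qed.

Lemma little_strict_coord i (x h : C -> V) k :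
  big 1 (fun t => rnorm (x t)) -> big k.+1 (fun t => rnorm (h t)) ->
  little k.+1 (fun t => normc (f (x t + h t) 0 i - f (x t) 0 i - (h t *m 'J f 0) 0 i)).
Proof.
move=> bx bh; have [rho rho0 df] := (near0_rnorm _).1 hf.
have dphi y : rnorm y < rho -> differentiable (fun y => f y 0 i : C^o) y.
  by move=> /df; exact: differentiable_coord_comp.
have H := little_strict_diff rho0 dphi bx bh.
apply: (little_le ltr01 _ H) => t _.
have -> : (h t *m 'J f 0) 0 i = 'd (fun y => f y 0 i : C^o) 0 (h t).
  exact: esym (diff_coordE _ _).
exact: lexx.
Qed.

Lemma near_big (P : V -> Prop) (x : C -> V) : (\forall y \near (0 : V), P y) ->
  big 1 (fun t => rnorm (x t)) -> exists2 d : R, 0 < d & forall t, normc t < d -> P (x t).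
Proof.
move=> /near0_rnorm[r r0 Pr] /(big_small r0)[d d0 h]; exists d => // t /h; exact: Pr.
Qed.

End CoordinateOrders.

(** * Second-order terms of an equivalence of two quadrics *)

Section SecondOrder.
Variables (R : realType) (p : nat).
Local Notation C := R[i].
Local Notation K := (R[i] : numFieldType).
Local Notation V := 'rV[K]_(p + p).
Variables (B g B' g' : 'M[C]_p) (f : V -> V).
Hypothesis (f0 : f 0 = 0) (hf : holomorphic_at0 f).
Hypothesis fQ : \forall x \near (0 : V), quadQ B g x -> quadQ B' g' (f x).

Let J := 'J f 0.

Lemma conjvE m n (A : 'M[C]_(m, n)) i j : conjv A i j = (A i j)^*%C.
Proof. by rewrite mxE. Qed.

Lemma LmapE (M N : 'M[C]_p) z w j :
  Lmap M N z w 0 j = (M *m z^T) j 0 - 2 * (M *m (N *m w^T)) j 0.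
Proof. by rewrite /Lmap mxE mulmxBr -scalemxAr !mxE. Qed.

Lemma mulmx_trE (M : 'M[C]_p) (v : 'rV[C]_p) j : (M *m v^T) j 0 = \sum_i M j i * v 0 i.
Proof. by rewrite mxE; apply: eq_bigr => i _; rewrite mxE. Qed.

Variable (z : 'rV[C]_p).

(** Along the curve t z the k-th form is t [al k] - conj(t) [be k]. The point of the quadric above t
    z splits into [x0 t], complex linear in t, and [x1 t], which is O(|t|^2) but not holomorphic. *)
Let al k := (B *m z^T) k 0.
Let be k := 2 * (B *m (g *m (conjv z)^T)) k 0.
Let eta t k := (t * al k - t^*%C * be k) ^+ 2.
Let x0 t : V := t *: row_mx z 0.
Let x1 t : V := \sum_k eta t k *: row_mx (0 : 'rV_p) (delta_mx 0 k).

Let x0x1E t : x0 t + x1 t = row_mx (t *: z) (\row_k eta t k).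
Proof.
rewrite /x0 /x1 scale_row_mx scaler0.
have -> : \sum_k eta t k *: row_mx (0 : 'rV[C]_p) (delta_mx 0 k : 'rV_p) =
    row_mx 0 (\row_k eta t k).
  rewrite [X in row_mx 0 X]row_sum_delta.
  under eq_bigr do rewrite scale_row_mx scaler0.
  elim/big_rec2: _ => [|k u v _ ->]; first by rewrite row_mx0.
  by rewrite add_row_mx add0r mxE.
by rewrite add_row_mx addr0 add0r.
Qed.

Let LmE t k : Lmap B g (t *: z) (conjv (t *: z)) 0 k = t * al k - t^*%C * be k.
Proof.
have -> : conjv (t *: z) = t^*%C *: conjv z.
  by apply/matrixP => i j; rewrite !mxE rmorphM.
rewrite LmapE ![(_ *: _)^T]linearZ /= -!scalemxAr mxE [X in _ - 2 * X]mxE.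
by rewrite /al /be; ring.
Qed.

Let xQ t : quadQ B g (x0 t + x1 t).
Proof.
move=> j; rewrite x0x1E row_mxKl row_mxKr LmE mxE //.
Qed.

Let big_lin a b : big 1 (fun t : C => normc (t * a - t^*%C * b)).
Proof.
have h1 : big 1 (fun t : C => normc (a * t)) by apply: bigZ; exact: big_id.
have h2 : big 1 (fun t : C => normc (- b * t^*%C)) by apply: bigZ; exact: big_conj.
have [K K0 [d d0 h]] := bigD h1 h2; exists K => //; exists d => // t /h.
by rewrite mulNr ![_ * a]mulrC ![_ * b]mulrC.
Qed.

Let big_x0 : big 1 (fun t => rnorm (x0 t)).
Proof. by apply: big_rnormZ; exact: big_id. Qed.

Let big_x1 : big 2 (fun t => rnorm (x1 t)).
Proof.
by apply: big_rnorm_sum => k; apply: big_rnormZ; exact: (bigM (big_lin _ _) (big_lin _ _)).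
Qed.

Let big_x : big 1 (fun t => rnorm (x0 t + x1 t)).
Proof. by apply: big_rnormD big_x0 _; apply: little_big; apply: big_little. Qed.

Let a := (z *m ulsubmx J).
Let al' j := (B' *m a^T) j 0.
Let be' j := 2 * (B' *m (g' *m (conjv a)^T)) j 0.

Let x0J t : x0 t *m J = row_mx (t *: a) (t *: (z *m ursubmx J)).
Proof.
rewrite /x0 -scalemxAl -[J in LHS]submxK mul_row_block !mul0mx !addr0.
by rewrite scale_row_mx.
Qed.

Let x1J t : x1 t *m J = row_mx ((\row_k eta t k) *m dlsubmx J) ((\row_k eta t k) *m drsubmx J).
Proof.
have -> : x1 t = row_mx 0 (\row_k eta t k).
  have := x0x1E t; rewrite /x0 scale_row_mx scaler0 => E.
  apply: (addrI (row_mx (t *: z) 0)); rewrite E add_row_mx addr0 add0r //.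
by rewrite -[J in LHS]submxK mul_row_block !mul0mx !add0r.
Qed.

Let little_eta (M : 'M[C]_p) j : little 1 (fun t => normc (((\row_k eta t k) *m M) 0 j)).
Proof.
have H : little 1 (fun t => normc (\sum_k M k j * eta t k)).
  apply: little_sum => k; apply: littleZ; apply: big_little.
  exact: (bigM (big_lin _ _) (big_lin _ _)).
apply: (little_le ltr01 _ H) => t _; rewrite mxE le_eqVlt; apply/orP; left; apply/eqP.
by congr normc; apply: eq_bigr => k _; rewrite mxE mulrC.
Qed.

Let little_l i : little 1 (fun t => normc (lsubmx (f (x0 t + x1 t)) 0 i - t * a 0 i)).
Proof.
have h1 := little_coord (n := p + p) f0 hf (lshift p i) big_x.
have h2 := littleD h1 (little_eta (dlsubmx J) i).
apply: (little_le ltr01 _ h2) => t _; rewrite le_eqVlt; apply/orP; left; apply/eqP.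
congr normc; rewrite mulmxDl -/J x0J x1J.
rewrite [X in _ - X + _]mxE !row_mxEl [X in _ - (X + _) + _]mxE ![lsubmx _ _ _]mxE; ring.
Qed.

Let little_r j : little 1 (fun t => normc (rsubmx (f (x0 t + x1 t)) 0 j - t * (z *m ursubmx J) 0 j)).
Proof.
have h1 := little_coord (n := p + p) f0 hf (rshift p j) big_x.
have h2 := littleD h1 (little_eta (drsubmx J) j).
apply: (little_le ltr01 _ h2) => t _; rewrite le_eqVlt; apply/orP; left; apply/eqP.
congr normc; rewrite mulmxDl -/J x0J x1J.
rewrite [X in _ - X + _]mxE !row_mxEr [X in _ - (X + _) + _]mxE ![rsubmx _ _ _]mxE; ring.
Qed.

Let L' j t := Lmap B' g' (lsubmx (f (x0 t + x1 t))) (conjv (lsubmx (f (x0 t + x1 t)))) 0 j.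

Let little_L' j : little 1 (fun t => normc (L' j t - (t * al' j - t^*%C * be' j))).
Proof.
have h1 : little 1 (fun t => normc (\sum_i B' j i * (lsubmx (f (x0 t + x1 t)) 0 i - t * a 0 i))).
  by apply: little_sum => i; apply: littleZ; exact: little_l.
have h2 : little 1 (fun t => normc (\sum_i (- 2 * (B' *m g') j i) *
    (lsubmx (f (x0 t + x1 t)) 0 i - t * a 0 i)^*%C)).
  by apply: little_sum => i; apply: littleZ; apply: little_conj; exact: little_l.
apply: (little_le ltr01 _ (littleD h1 h2)) => t _; rewrite le_eqVlt; apply/orP; left; apply/eqP.
congr normc; rewrite /L' LmapE /al' /be' !mulmxA; set l := lsubmx _.
rewrite !mulmx_trE !mulr_sumr -!sumrB -big_split /=; apply: eq_bigr => i _.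
by rewrite !conjvE rmorphB rmorphM /=; ring.
Qed.

Let near_L' : exists2 d : R, 0 < d & forall t, normc t < d -> forall j,
  rsubmx (f (x0 t + x1 t)) 0 j = L' j t ^+ 2.
Proof.
have [d d0 h] := near_big fQ big_x.
by exists d => // t td; exact: h td (xQ t).
Qed.

Let little_L'2 j : little 2 (fun t => normc (L' j t ^+ 2 - (t * al' j - t^*%C * be' j) ^+ 2)).
Proof.
have b1 := big_lin (al' j) (be' j).
have b2 := littleD (little_L' j) (little_L' j).
have h1 := littleM (little_L' j) (little_big (little_L' j)).
have h2 := littleM (little_L' j) b1.
apply: (little_le ltr01 _ (littleD h1 (littleD h2 h2))) => t _.
rewrite le_eqVlt; apply/orP; left; apply/eqP; congr normc; ring.
Qed.

(** On the target quadric the last coordinates are squares of quantities O(t), so their first-order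
    part vanishes. *)
Lemma second_order_ur j : (z *m ursubmx J) 0 j = 0.
Proof.
have [d d0 h] := near_L'.
have b2 : big 2 (fun t => normc ((t * al' j - t^*%C * be' j) * (t * al' j - t^*%C * be' j))).
  exact: (bigM (big_lin (al' j) (be' j)) (big_lin (al' j) (be' j))).
have h1 : little 1 (fun t => normc (L' j t ^+ 2)).
  have h0 := bigD (little_big (little_L'2 j)) b2.
  apply: big_little; have [K K0 [e e0 H]] := h0; exists K => //; exists e => // t /H.
  by congr (normc _ <= _); ring.
have h2 := littleD h1 (littleZ (-1) (little_r j)).
apply: (@little0 R 1); apply: (little_le d0 _ h2) => t /h/(_ j) E.
by rewrite E le_eqVlt; apply/orP; left; apply/eqP; congr normc; ring.
Qed.

(* The point x0 t + x1 t lies on the quadric; t |-> f (x0 t) is holomorphic, so its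
   expansion has neither a t conj(t) nor a conj(t)^2 term. *)
Lemma second_order_quadratic j :
  al' j * be' j = \sum_k al k * be k * drsubmx J k j /\
  be' j ^+ 2 = \sum_k be k ^+ 2 * drsubmx J k j.
Proof.
have [d d0 h] := near_L'.
pose G (t : C) : C := f (t *: row_mx z 0) 0 (rshift p j).
have h1 := little_strict_coord (n := p + p) hf (rshift p j) big_x0 big_x1.
have h2 := littleD (littleZ (-1) h1) (little_L'2 j).
have [rho rho0 df] := (near0_rnorm _).1 hf.
have G0 : G 0 = 0 by rewrite /G scale0r f0 mxE.
pose v : V := row_mx z 0.
have v0 : 0 < rnorm v + 1 by rewrite ltr_wpDl ?rnorm_ge0.
have dG t : normc t < rho / (rnorm v + 1) -> exists l, cder G t l.
  rewrite ltr_pdivlMr // => td.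
  have dft : differentiable (fun y : V => f y 0 (rshift p j) : C^o) ((0 : V) + t *: v : V).
    rewrite add0r; apply: differentiable_coord_comp; apply: df; rewrite rnormZ.
    by apply: le_lt_trans td; rewrite ler_wpM2l ?normc_ge0 // lerDl.
  exists ('d (fun y : V => f y 0 (rshift p j) : C^o) ((0 : V) + t *: v : V) v).
  have := cder_line dft; congr cder; apply/funext => w; by rewrite add0r.
(* The three coefficients come from expanding (t al' - conj(t) be')^2 - sum_k eta_k J_kj in t^2, t
   conj(t) and conj(t)^2. *)
have [|c1 c2] := @holo_quadratic R G
  (al' j ^+ 2 - \sum_k al k ^+ 2 * drsubmx J k j)
  (- 2 * (al' j * be' j - \sum_k al k * be k * drsubmx J k j))
  (be' j ^+ 2 - \sum_k be k ^+ 2 * drsubmx J k j)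
  (rho / (rnorm v + 1)) (divr_gt0 rho0 v0) dG G0.
  (* G(t) is the j-th last coordinate of f(x0 + x1), i.e. the square of the target form, minus the
     linear part of f applied to x1, up to o(|t|^2). *)
  have h3 : little 2 (fun t => normc (G t - ((t * al' j - t^*%C * be' j) ^+ 2 -
      \sum_k eta t k * drsubmx J k j))).
    apply: (little_le d0 _ h2) => t /h/(_ j) E.
    rewrite le_eqVlt; apply/orP; left; apply/eqP; congr normc.
    rewrite -E -/J x1J row_mxEr [X in _ = -1 * (_ - X) + _]mxE.
    rewrite [rsubmx _ _ _]mxE /G -/(x0 t).
    have -> : \sum_k (\row_k0 eta t k0) 0 k * drsubmx J k j = \sum_k eta t k * drsubmx J k j.
      by apply: eq_bigr => k _; rewrite mxE.
    ring.
  move=> e /h3[d' d'0 H]; exists d' => // t /H.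
  congr (normc (_ - _) <= _).
  rewrite /eta.
  have -> : \sum_k (t * al k - t^*%C * be k) ^+ 2 * drsubmx J k j =
     t ^+ 2 * (\sum_k al k ^+ 2 * drsubmx J k j)
     - 2 * (t * t^*%C) * (\sum_k al k * be k * drsubmx J k j)
     + t^*%C ^+ 2 * (\sum_k be k ^+ 2 * drsubmx J k j).
    by rewrite !mulr_sumr -sumrB -big_split /=; apply: eq_bigr => k _; ring.
  ring.
split; last by apply/eqP; rewrite -subr_eq0 c2.
apply/eqP; rewrite -subr_eq0; move/eqP: c1.
by rewrite mulf_eq0 oppr_eq0 pnatr_eq0.
Qed.

End SecondOrder.

(** * Linear algebra: conjugation, polarisation, monomial matrices *)

Section ConjugateMatrix.
Variable R : realType.
Local Notation C := R[i].

Lemma conjvM m n q (A : 'M[C]_(m, n)) (B : 'M[C]_(n, q)) :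
  conjv (A *m B) = conjv A *m conjv B.
Proof. exact: (map_mxM (conjc : {rmorphism C -> C})). Qed.

Lemma conjvD m n (A B : 'M[C]_(m, n)) : conjv (A + B) = conjv A + conjv B.
Proof. by apply/matrixP => i j; rewrite !mxE rmorphD. Qed.

Lemma conjvZ m n (a : C) (A : 'M[C]_(m, n)) : conjv (a *: A) = a^*%C *: conjv A.
Proof. by apply/matrixP => i j; rewrite !mxE rmorphM. Qed.

Lemma conjvK m n (A : 'M[C]_(m, n)) : conjv (conjv A) = A.
Proof. by apply/matrixP => i j; rewrite !mxE conjcK. Qed.

Lemma conjv_tr m n (A : 'M[C]_(m, n)) : conjv A^T = (conjv A)^T.
Proof. by apply/matrixP => i j; rewrite !mxE. Qed.

Lemma conjv1 n : conjv (1%:M : 'M[C]_n) = 1%:M.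
Proof. by apply/matrixP => i j; rewrite !mxE; case: eqP => _; rewrite ?conjc1 ?conjc0. Qed.

Lemma conjv_delta m n (i : 'I_m) (j : 'I_n) :
  conjv (delta_mx i j : 'M[C]_(m, n)) = delta_mx i j.
Proof. by apply/matrixP => a b; rewrite !mxE; case: andP => _; rewrite ?conjc1 ?conjc0. Qed.

Lemma conjv_unitmx n (A : 'M[C]_n) : (conjv A \in unitmx) = (A \in unitmx).
Proof. exact: (map_unitmx (conjc : {rmorphism C -> C})). Qed.

Lemma conjv_invmx n (A : 'M[C]_n) : conjv (invmx A) = invmx (conjv A).
Proof. exact: (map_invmx (conjc : {rmorphism C -> C})). Qed.

Lemma delta_form (K : comNzRingType) n (S : 'M[K]_n) a b :
  ((delta_mx a (0 : 'I_1))^T *m S *m delta_mx b (0 : 'I_1)) = (S a b)%:M.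
Proof.
by rewrite trmx_delta -rowE -colE [LHS]mx11_scalar !mxE.
Qed.

(** Polarisation: on a sum of a-th and s times b-th basis vectors, s = 1 and s = i separate [S a b]
    from [S b a]. *)
Lemma hermitian_form_eq0 n (S : 'M[C]_n) :
  (forall u : 'cV[C]_n, u^T *m S *m conjv u = 0) -> S = 0.
Proof.
move=> S0; apply/matrixP => a b; rewrite [RHS]mxE.
have Sd i : S i i = 0.
  have := S0 (delta_mx i 0); rewrite conjv_delta delta_form.
  by move/matrixP/(_ 0 0); rewrite !mxE.
have E (s : C) : s^*%C * S a b + s * S b a = 0.
  have := S0 (delta_mx a 0 + s *: delta_mx b 0).
  have -> : (delta_mx a 0 + s *: delta_mx b 0 : 'cV[C]_n)^T =
      (delta_mx a 0)^T + s *: (delta_mx b 0)^T by rewrite linearD linearZ.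
  rewrite conjvD conjvZ !conjv_delta !mulmxDl !mulmxDr.
  rewrite -!scalemxAl -!scalemxAr !delta_form !Sd.
  by move/matrixP/(_ 0 0); rewrite !mxE !eqxx !mulr1n !mulr0 addr0 add0r.
have := E 1; have := E 'i%C; rewrite conjc1 !mul1r => Ei E1.
have {}Ei : 'i%C * (S b a - S a b) = 0.
  rewrite -Ei mulrBr addrC; congr (_ + _); rewrite -mulNr; congr (_ * _).
  by apply/eqP; rewrite eq_complex /= oppr0 !eqxx.
have i0 : 'i%C != 0 :> C by rewrite -normc_eq0 normc_i oner_eq0.
move/eqP: Ei; rewrite mulf_eq0 (negbTE i0) subr_eq0 /= => /eqP Eab.
move: E1; rewrite Eab => /eqP; rewrite -mulr2n -mulr_natl mulf_eq0 pnatr_eq0.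
by move=> /eqP.
Qed.

End ConjugateMatrix.

Section Monomial.
Variables (R : realType) (p : nat).
Local Notation C := R[i].

Lemma perm_diag_mul (nu : 'S_p) (d e : 'rV[C]_p) :
  (forall j, d 0 j * e 0 (nu j) = 1) ->
  perm_diag nu d *m perm_diag (nu^-1)%g e = 1%:M.
Proof.
move=> de; apply/matrixP => j k; rewrite !mxE (bigD1 (nu j)) //= big1; last first.
  by move=> l lj; rewrite !mxE (negbTE lj) mul0r.
rewrite !mxE eqxx addr0 permK; by case: (eqVneq j k) => _; rewrite ?de ?mulr0.
Qed.

Lemma perm_diag_inv (nu : 'S_p) (d : 'rV[C]_p) : (forall j, d 0 j != 0) ->
  exists2 e : 'rV[C]_p, forall j, e 0 j != 0 &
    perm_diag nu d = invmx (perm_diag (nu^-1)%g e).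
Proof.
move=> d0; exists (\row_j (d 0 ((nu^-1)%g j))^-1).
  by move=> j; rewrite mxE invr_eq0.
have E : perm_diag nu d *m perm_diag (nu^-1)%g (\row_j (d 0 ((nu^-1)%g j))^-1) = 1%:M.
  by apply: perm_diag_mul => j; rewrite mxE permK divff.
have [_ u] := mulmx1_unit E.
by rewrite -[LHS]mulmx1 -(mulmxV u) mulmxA E mul1mx.
Qed.

Lemma perm_diag_unit (nu : 'S_p) (d : 'rV[C]_p) : (forall j, d 0 j != 0) ->
  perm_diag nu d \in unitmx.
Proof.
move=> d0; have E : perm_diag nu d *m perm_diag (nu^-1)%g (\row_j (d 0 ((nu^-1)%g j))^-1) = 1%:M.
  by apply: perm_diag_mul => j; rewrite mxE permK divff.
exact: (mulmx1_unit E).1.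
Qed.

(** The product condition leaves at most one nonzero entry per row; invertibility leaves no zero row
    and no zero column, so the positions of these entries form a permutation. *)
Lemma monomial_of_orthogonal (c : 'M[C]_p) : c \in unitmx ->
  (forall j a b, a != b -> c j a * c j b = 0) ->
  exists (nu : 'S_p) (d : 'rV[C]_p), (forall j, d 0 j != 0) /\ c = perm_diag nu d.
Proof.
move=> cu co.
have ex j : exists k, c j k != 0.
  apply: contrapT => nk; have c0 k : c j k = 0.
    by apply/eqP/negPn/negP => h; apply: nk; exists k.
  have : row j c *m invmx c = 0.
    have -> : row j c = 0 by apply/rowP => k; rewrite !mxE.
    by rewrite mul0mx.
  rewrite -row_mul mulmxV // => /rowP/(_ j).
  by rewrite !mxE eqxx => /eqP; rewrite oner_eq0.
have [nu nuP] := choice ex.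
have uni j k : c j k != 0 -> k = nu j.
  move=> ck; apply/eqP/negPn/negP => kn.
  have /eqP := co j _ _ kn; rewrite mulf_eq0 (negbTE ck) /=.
  by rewrite (negbTE (nuP j)).
have surj k : exists j, nu j = k.
  apply: contrapT => nj; have c0 j : c j k = 0.
    by apply/eqP/negPn/negP => h; apply: nj; exists j; rewrite (uni _ _ h).
  have : invmx c *m col k c = 0.
    have -> : col k c = 0 by apply/colP => j; rewrite !mxE.
    by rewrite mulmx0.
  rewrite colE mulmxA mulVmx // mul1mx => /colP/(_ k).
  by rewrite !mxE !eqxx => /eqP; rewrite oner_eq0.
have inj : injective nu.
  have [mu muP] := choice surj.
  have muI : injective mu by apply: (can_inj (g := nu)); exact: muP.
  have [nu' h1 h2] := injF_bij muI.
  have E : nu =1 nu' by move=> x; rewrite -{1}[x]h2 muP.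
  by move=> x y; rewrite !E => /(can_inj h2).
exists (perm inj), (\row_j c j (nu j)); split; first by move=> j; rewrite mxE.
apply/matrixP => j k; rewrite !mxE permE; case: eqVneq => [->//|kn].
by apply/eqP/negPn/negP => /uni E; rewrite E eqxx in kn.
Qed.

End Monomial.

Section QuadricEquivalence.
Variables (R : realType) (p : nat).
Local Notation C := R[i].

(** [P] is the transposed linear part of the equivalence on z'. The second identity of
    [second_order_quadratic] writes squares of the forms in [c] as sums of squares of coordinates,
    so mixed terms vanish and [c] is monomial. The first identity, polarised, forces [c1 = c], which
    contains both matrix relations. *)
Lemma quadQ_equiv_linear (B g B' g' : 'M[C]_p) :
  B \in unitmx -> g \in unitmx -> B' \in unitmx -> g' \in unitmx ->
  holo_equiv (quadQ B g) (quadQ B' g') ->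
  exists (P : 'M[C]_p) (nu : 'S_p) (d : 'rV[C]_p), [/\ P \in unitmx, forall j, d 0 j != 0,
    B' *m P = invmx (perm_diag nu d) *m B & g' *m conjv P = P *m g].
Proof.
move=> Bu gu B'u g'u [f bf MN].
have fQ : \forall x \near (0 : 'rV[R[i] : numFieldType]_(p + p)), quadQ B g x -> quadQ B' g' (f x).
  by move: MN; apply: filterS => x [].
have Ju := germ_biholo_jacobian_unit bf.
have [f0 hf _] := bf.
have ur := second_order_ur f0 hf fQ.
have quad := second_order_quadratic f0 hf fQ.
move: ('J f 0) Ju ur quad => J Ju ur quad.
have Jur : ursubmx J = 0.
  by apply/row_matrixP => i; apply/rowP => j; rewrite rowE ur linear0 mxE.
have [Jul Jdr] : ulsubmx J \in unitmx /\ drsubmx J \in unitmx.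
  move: Ju; rewrite -[J]submxK Jur unitmxE det_lblock unitrM => /andP[h1 h2].
  by rewrite !unitmxE block_mxKul block_mxKdr.
pose P := (ulsubmx J)^T; have Pu : P \in unitmx by rewrite unitmx_tr.
have cPu : conjv P \in unitmx by rewrite conjv_unitmx.
pose U := drsubmx J.
(* [c1] and [c] express the target forms B' P x and B' g' conj(P) conj(x) through B x and B g
   conj(x). *)
pose c1 := B' *m P *m invmx B.
pose c := B' *m g' *m conjv P *m invmx (B *m g).
have Bgu : B *m g \in unitmx by rewrite unitmx_mul Bu.
have cu : c \in unitmx by rewrite !unitmx_mul B'u g'u cPu unitmx_inv.
have quad' (x : 'cV[C]_p) j :
   (B' *m P *m x) j 0 * (B' *m g' *m conjv P *m conjv x) j 0 =
     \sum_k (B *m x) k 0 * (B *m g *m conjv x) k 0 * U k j /\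
   (B' *m g' *m conjv P *m conjv x) j 0 ^+ 2 = \sum_k (B *m g *m conjv x) k 0 ^+ 2 * U k j.
  have [] := quad x^T j; rewrite conjv_tr !trmxK.
  have aT : (x^T *m ulsubmx J)^T = P *m x by rewrite trmx_mul trmxK.
  have -> : (conjv (x^T *m ulsubmx J))^T = conjv P *m conjv x by rewrite -conjv_tr aT conjvM.
  rewrite aT !mulmxA -/U; set X := (_ *m x) j 0; set Y := (_ *m conjv x) j 0.
  have n2 : (2 : C) != 0 by rewrite pnatr_eq0.
  have n4 : (2 ^+ 2 : C) != 0 by rewrite expf_neq0.
  move=> q1 q2; split.
    apply: (mulfI n2); rewrite mulrCA q1 mulr_sumr; apply: eq_bigr => k _; ring.
  apply: (mulfI n4); rewrite -exprMn q2 mulr_sumr; apply: eq_bigr => k _; ring.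
have sq (y : 'cV[C]_p) j : (c *m y) j 0 ^+ 2 = \sum_k y k 0 ^+ 2 * U k j.
  have [_] := quad' (conjv (invmx (B *m g) *m y)) j; rewrite conjvK.
  by rewrite !mulmxA mulmxV // mul1mx -[_ *m conjv P *m _ *m y]/(c *m y).
have cE j k : (c *m (delta_mx k 0 : 'cV[C]_p)) j 0 = c j k.
  by rewrite -colE mxE.
have deltaE (k l : 'I_p) : (delta_mx k 0 : 'cV[C]_p) l 0 = (l == k)%:R.
  by rewrite mxE andbT.
have addE (X Y : 'cV[C]_p) l : (X + Y) l 0 = X l 0 + Y l 0 by rewrite mxE.
have csq j k : c j k ^+ 2 = U k j.
  rewrite -cE sq (bigD1 k) //= deltaE eqxx expr1n mul1r big1 ?addr0 // => l lk.
  by rewrite deltaE (negbTE lk) expr0n /= mul0r.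
have corth j a b : a != b -> c j a * c j b = 0.
  move=> ab; have := sq (delta_mx a 0 + delta_mx b 0) j.
  rewrite mulmxDr addE !cE (bigD1 a) //= (bigD1 b) 1?eq_sym //= big1; last first.
    move=> l /andP[la lb]; rewrite addE !deltaE (negbTE la) (negbTE lb).
    by rewrite addr0 expr0n /= mul0r.
  rewrite !addE !deltaE !eqxx [b == a]eq_sym (negbTE ab) !addr0 add0r.
  rewrite !expr1n !mul1r -!csq => /eqP.
  rewrite -subr_eq0 (_ : _ - _ = 2 * (c j a * c j b)); last by ring.
  by rewrite mulf_eq0 pnatr_eq0 => /eqP.
(* With u = B x the first identity reads u^T S D conj(u) = 0 for every u, where D is invertible;
   hence S = 0, which is the claim entry by entry. *)
have c1c j a b : c1 j a * c j b = (if a == b then U a j else 0).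
  pose D := B *m g *m conjv (invmx B).
  have Du : D \in unitmx by rewrite unitmx_mul Bgu conjv_unitmx unitmx_inv.
  pose S := (row j c1)^T *m row j c - diag_mx (\row_k U k j).
  have S0 : S *m D = 0.
    apply: hermitian_form_eq0 => u.
    have [q1 _] := quad' (invmx B *m u) j.
    have e1 : B' *m P *m (invmx B *m u) = c1 *m u by rewrite mulmxA.
    have e2 : B *m (invmx B *m u) = u by rewrite mulmxA mulmxV // mul1mx.
    have e3 : B *m g *m conjv (invmx B *m u) = D *m conjv u by rewrite conjvM mulmxA.
    have e4 : B' *m g' *m conjv P *m conjv (invmx B *m u) = c *m (D *m conjv u).
      by rewrite -e3 /c [in RHS]mulmxA mulmxKV.
    have -> : u^T *m (S *m D) *m conjv u = u^T *m (S *m (D *m conjv u)).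
      by rewrite !mulmxA.
    move: q1; rewrite e1 e2 e3 e4; move: (D *m conjv u) => w q1.
    have Sw k : (S *m w) k 0 = c1 j k * (c *m w) j 0 - U k j * w k 0.
      have subE (X Y : 'cV[C]_p) l : (X - Y) l 0 = X l 0 - Y l 0 by rewrite !mxE.
      rewrite /S mulmxBl mul_diag_mx -mulmxA -row_mul subE; congr (_ - _).
        by rewrite mxE big_ord1; congr (_ * _); rewrite ?mxE // [LHS]mxE.
      by rewrite !mxE.
    apply/matrixP => i i'; rewrite !ord1 [RHS]mxE mxE.
    under eq_bigr => k _ do rewrite Sw mulrBr.
    rewrite sumrB (_ : \sum_i _ = (c1 *m u) j 0 * (c *m w) j 0); last first.
      rewrite [(c1 *m u) _ _]mxE mulr_suml; apply: eq_bigr => k _.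
      by rewrite mxE mulrCA mulrA.
    rewrite q1 -sumrB big1 // => k _; rewrite [u^T _ _]mxE; ring.
  have {}S0 : S = 0 by rewrite -[S]mulmx1 -(mulmxV Du) mulmxA S0 mul0mx.
  move/matrixP/(_ a b): S0; rewrite /S !mxE big_ord1 !mxE => /eqP.
  by rewrite subr_eq0 => /eqP ->; case: eqVneq; rewrite ?mulr1n ?mulr0n.
have [nu [d [d0 cd]]] := monomial_of_orthogonal cu corth.
have c1E : c1 = c.
  apply/matrixP => j a; have cj : c j (nu j) != 0 by rewrite cd mxE eqxx.
  apply: (mulIf cj); rewrite c1c; case: eqVneq => [->|an].
    by rewrite -csq expr2.
  by rewrite corth.
have [e e0 ce] := perm_diag_inv nu d0.
exists P, (nu^-1)%g, e; split => //.
  by rewrite -ce -cd -c1E /c1 mulmxKV.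
have : c *m (B *m g) = c1 *m B *m g by rewrite -c1E mulmxA.
rewrite /c /c1 mulmxKV // mulmxKV // -!mulmxA => /(can_inj (mulKmx B'u)).
by [].
Qed.

End QuadricEquivalence.

Section LinearChange.

Lemma germ_biholo_mulmxr (k : numFieldType) n (T : 'M[k]_n) : T \in unitmx ->
  germ_biholo (fun x : 'rV[k]_n => x *m T).
Proof.
move=> Tu; split; first exact: mul0mx.
  by apply: filterE => x; exact: differentiable_mulmxr.
exists (fun x => x *m invmx T); split; first exact: mul0mx.
- by apply: filterE => x; exact: differentiable_mulmxr.
- by apply: filterE => x /=; exact: mulmxKV.
- by apply: filterE => x /=; exact: mulmxK.
Qed.

Variables (R : realType) (p : nat).
Local Notation C := R[i].

Lemma perm_diag_mulE (nu : 'S_p) (d : 'rV[C]_p) m (A : 'M[C]_(p, m)) j k :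
  (perm_diag nu d *m A) j k = d 0 j * A (nu j) k.
Proof.
rewrite mxE (bigD1 (nu j)) //= mxE eqxx big1 ?addr0 // => l lj.
by rewrite mxE (negbTE lj) mul0r.
Qed.

Lemma perm_squares (nu : 'S_p) (d w L w' L' : 'I_p -> C) : (forall j, d j != 0) ->
  (forall j, w' j = d j ^+ 2 * w (nu j)) -> (forall j, L' j = d j * L (nu j)) ->
  (forall j, w j = L j ^+ 2) <-> (forall j, w' j = L' j ^+ 2).
Proof.
move=> d0 wE LE; split=> H j; first by rewrite wE H LE exprMn.
have := H ((nu^-1)%g j); rewrite wE LE exprMn permKV => /mulfI; apply.
exact: expf_neq0.
Qed.

(** The equivalence acts by [P] on z' and permutes the last coordinates with factors d_j^2, because
    the forms are permuted with factors d_j. *)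
Lemma quadQ_linear_equiv (B g B' g' P : 'M[C]_p) (nu : 'S_p) (d : 'rV[C]_p) :
  P \in unitmx -> (forall j, d 0 j != 0) ->
  B' *m P = perm_diag nu d *m B -> g' *m conjv P = P *m g ->
  holo_equiv (quadQ B g) (quadQ B' g').
Proof.
move=> Pu d0 BP gP.
pose d2 : 'rV[C]_p := \row_j (d 0 j ^+ 2).
have d20 j : d2 0 j != 0 by rewrite mxE expf_neq0.
pose T : 'M[C]_(p + p) := block_mx P^T 0 0 (perm_diag nu d2)^T.
have Tu : T \in unitmx.
  by rewrite unitmxE det_ublock unitrM -!unitmxE !unitmx_tr Pu perm_diag_unit.
exists (fun x => x *m T); first exact: (@germ_biholo_mulmxr (R[i])).
apply: filterE => x; pose z := lsubmx x; pose w := rsubmx x.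
have LE j : Lmap B' g' (z *m P^T) (conjv (z *m P^T)) 0 j = d 0 j * Lmap B g z (conjv z) 0 (nu j).
  have e1 : (z *m P^T)^T = P *m z^T by rewrite trmx_mul trmxK.
  have e2 : (conjv (z *m P^T))^T = conjv P *m (conjv z)^T by rewrite -conjv_tr e1 conjvM conjv_tr.
  rewrite /Lmap e1 e2 [in RHS]mxE [LHS]mxE; move: ((conjv z)^T) (z^T) => v u.
  have -> : g' *m (conjv P *m v) = P *m (g *m v) by rewrite mulmxA gP mulmxA.
  rewrite scalemxAr -mulmxBr; move: (u - _) => y.
  by rewrite mulmxA BP -mulmxA perm_diag_mulE.
have wE j : (w *m (perm_diag nu d2)^T) 0 j = d 0 j ^+ 2 * w 0 (nu j).
  by rewrite -[w *m _]trmxK trmx_mul trmxK mxE perm_diag_mulE !mxE.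
have xT : x *m T = row_mx (z *m P^T) (w *m (perm_diag nu d2)^T).
  by rewrite -[x]hsubmxK mul_row_block !mulmx0 addr0 add0r.
rewrite xT; have key := @perm_squares nu (d 0) (w 0) (Lmap B g z (conjv z) 0) _ _ d0 wE LE.
have El := row_mxKl (z *m P^T) (w *m (perm_diag nu d2)^T).
have Er := row_mxKr (z *m P^T) (w *m (perm_diag nu d2)^T).
move: El Er; move: (row_mx _ _) => y El Er; split=> H.
  move=> j; rewrite El Er; exact: (key.1 H j).
apply: key.2 => j; have := H j; rewrite El Er; exact.
Qed.

(** [G] multiplies conj(z'), so a linear change of z' acts on it by consimilarity. *)
Lemma quadQ_change_basis (A G P : 'M[C]_p) : P \in unitmx ->
  holo_equiv (quadQ A G) (quadQ (A *m P) (invmx P *m G *m conjv P)).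
Proof.
move=> Pu; apply: (@quadQ_linear_equiv _ _ _ _ (invmx P) 1%g (const_mx 1)).
- by rewrite unitmx_inv.
- by move=> j; rewrite mxE oner_neq0.
- rewrite mulmxK //; apply/matrixP => i j.
  by rewrite perm_diag_mulE mxE mul1r perm1.
- by rewrite conjv_invmx mulmxK // conjv_unitmx.
Qed.

End LinearChange.

(** * Matrices intertwining gamma with their conjugates *)

Section GammaMatrix.
Variables (R : realType) (e h s : nat).
Local Notation C := R[i].
Variables (ge : 'rV[R]_e) (gh : 'rV[R]_h) (gs : 'rV[C]_s).
Hypothesis rg : gamma_range ge gh gs.

Let g := gamma_mx erefl ge gh gs.

(** The diagonal of [g *m conjv g]: the off-diagonal layout of the last block of gamma makes this
    product diagonal. *)
Definition gamma_sq : 'rV[C]_(e + h + (s + s)) :=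
  row_mx (row_mx (\row_i (ge 0 i ^+ 2)%:C%C) (\row_i (gh 0 i ^+ 2)%:C%C))
    (row_mx (\row_i (gs 0 i * (1 - gs 0 i))) (\row_i ((gs 0 i)^*%C * (1 - (gs 0 i)^*%C)))).

Lemma gamma_mx_id : g = block_mx
       (block_mx (diag_mx (map_mx (real_complex R) ge)) 0
                 0 (diag_mx (map_mx (real_complex R) gh))) 0
       0 (block_mx 0 (diag_mx gs) (1%:M - conjv (diag_mx gs)) 0).
Proof. by rewrite /g /gamma_mx castmx_id. Qed.

Lemma conjv_block m1 m2 n1 n2 (A : 'M[C]_(m1, n1)) B D (E : 'M[C]_(m2, n2)) :
  conjv (block_mx A B D E) = block_mx (conjv A) (conjv B) (conjv D) (conjv E).
Proof. exact: map_block_mx. Qed.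

Lemma conjv0 m n : conjv (0 : 'M[C]_(m, n)) = 0.
Proof. by apply/matrixP => i j; rewrite !mxE conjc0. Qed.

Lemma conjv_diag n (d : 'rV[C]_n) : conjv (diag_mx d) = diag_mx (conjv d).
Proof. by apply/matrixP => i j; rewrite !mxE rmorphMn. Qed.

Lemma scalar_sub_diag n (d : 'rV[C]_n) : 1%:M - diag_mx d = diag_mx (const_mx 1 - d).
Proof. by rewrite linearB /= diag_const_mx. Qed.

Lemma gamma_mulJ : g *m conjv g = diag_mx gamma_sq.
Proof.
have Er n (v : 'rV[R]_n) : \row_j (map_mx (real_complex R) v 0 j *
    conjv (map_mx (real_complex R) v) 0 j) = \row_i (v 0 i ^+ 2)%:C%C.
  by apply/rowP => i; rewrite !mxE conjc_real -rmorphM.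
have E3 : \row_j (gs 0 j * conjv (const_mx 1 - conjv gs) 0 j) = \row_i (gs 0 i * (1 - gs 0 i)).
  have cc (x : C) : (1 - x^*%C)^*%C = 1 - x.
    by case: x => a b; apply/eqP; rewrite eq_complex /=; apply/andP; split; apply/eqP; ring.
  by apply/rowP => i; rewrite !mxE cc.
have E4 : \row_j ((const_mx 1 - conjv gs) 0 j * conjv gs 0 j) =
    \row_i ((gs 0 i)^*%C * (1 - (gs 0 i)^*%C)).
  by apply/rowP => i; rewrite !mxE mulrC.
rewrite gamma_mx_id !conjv_diag scalar_sub_diag !conjv_block !conjv0 !conjv_diag.
rewrite !mulmx_block !mulmx0 !mul0mx !addr0 !add0r !mulmx_diag /gamma_sq !diag_mx_row.
by rewrite !Er E3 E4.
Qed.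

Lemma gamma_sq_neq0 i : gamma_sq 0 i != 0.
Proof.
have [ge0 gh0 gs0] := rg.
rewrite /gamma_sq; case: (split_ordP i) => j ->.
  rewrite row_mxEl; case: (split_ordP j) => k ->.
    rewrite row_mxEl mxE eq_complex /= eqxx andbT.
    by rewrite expf_neq0 // gt_eqF //; have /andP[] := ge0 k.
  rewrite row_mxEr mxE eq_complex /= eqxx andbT.
  rewrite expf_neq0 // gt_eqF //; apply: lt_trans (gh0 k).
  by rewrite invr_gt0.
have gn (z : C) : complex.Im z != 0 -> z * (1 - z) != 0.
  move=> z0; rewrite mulf_neq0 //; first by apply/eqP => E; rewrite E eqxx in z0.
  rewrite subr_eq0; apply/eqP => E; rewrite -E eqxx in z0 => //.
rewrite row_mxEr; case: (split_ordP j) => k ->.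
  by rewrite row_mxEl mxE gn // gt_eqF //; have [] := gs0 k.
rewrite row_mxEr mxE gn //.
by have [_] := gs0 k; case: (gs 0 k) => x y /= y0; rewrite oppr_eq0 gt_eqF.
Qed.

Lemma gamma_mx_unit : g \in unitmx.
Proof.
have u : diag_mx gamma_sq \in unitmx.
  by rewrite unitmxE det_diag unitfE; apply/prodf_neq0 => i _; exact: gamma_sq_neq0.
by move: u; rewrite -gamma_mulJ unitmx_mul => /andP[].
Qed.

Lemma diag_commute n (d : 'rV[C]_n) (P : 'M[C]_n) : injective (d 0) ->
  P *m diag_mx d = diag_mx d *m P -> P = diag_mx (\row_i P i i).
Proof.
move=> dI E; apply/matrixP => i j; rewrite !mxE.
case: (eqVneq i j) => [->//|ij]; rewrite mulr0n.
have /matrixP/(_ i j) := E; rewrite mul_mx_diag mul_diag_mx !mxE => Eij.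
have dij : d 0 j - d 0 i != 0.
  by rewrite subr_eq0; apply/eqP => /dI ji; rewrite ji eqxx in ij.
by apply: (mulIf dij); rewrite mul0r mulrBr Eij mulrC subrr.
Qed.

Lemma diag_distinct n (d : 'rV[C]_n) : distinct_eigenvalues (diag_mx d) -> injective (d 0).
Proof.
move=> [mu [mu_uniq /allP mu_ev]].
have sub : {subset mu <= codom (d 0)}.
  move=> x /mu_ev /eigenvalueP[v vd v0].
  have [i vi] : exists i, v 0 i != 0.
    apply: contrapT => nv; move/eqP: v0; apply; apply/rowP => i; rewrite mxE.
    by apply/eqP/negPn/negP => vi; apply: nv; exists i.
  have /rowP/(_ i) := vd; rewrite mul_mx_diag !mxE mulrC => /(mulIf vi) <-.
  exact: codom_f.
apply/injectiveP; apply: (leq_size_uniq mu_uniq sub).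
have -> : size mu = n by exact: size_tuple.
by rewrite -[X in (_ <= X)%N](card_ord n) cardE size_map.
Qed.

(** Using the relation once as it stands and once conjugated shows that [P] commutes with
    [g *m conjv g], a diagonal matrix with distinct entries. *)
Lemma gamma_commutant_diag (P : 'M[C]_(e + h + (s + s))) :
  distinct_eigenvalues (g *m conjv g) -> g *m conjv P = P *m g ->
  P = diag_mx (\row_i P i i).
Proof.
rewrite gamma_mulJ => /diag_distinct dI gP; apply: diag_commute dI _.
rewrite -gamma_mulJ mulmxA -gP -mulmxA -conjvM -gP conjvM conjvK.
by rewrite !mulmxA.
Qed.

(** For diagonal P with entries a_i the relation reads g_ij conj(a_j) = a_i g_ij. The nonzero real
    diagonal entries of gamma make a_i real, and the entries [gs] make the two halves of the last
    block conjugate. The inverse of P appears because P has to be moved to the side of [B]. *)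
Lemma gamma_commutant (P : 'M[C]_(e + h + (s + s))) :
  P \in unitmx -> distinct_eigenvalues (g *m conjv g) -> g *m conjv P = P *m g ->
  exists (ae : 'rV[R]_e) (ah : 'rV[R]_h) (as_ : 'rV[C]_s), [/\ forall i, ae 0 i != 0, forall i, ah 0 i != 0,
    forall i, as_ 0 i != 0 & invmx P = diag_mx (a_vector erefl ae ah as_)].
Proof.
move=> Pu dg gP; have PE := gamma_commutant_diag dg gP.
move: (\row_i P i i) PE => a PE; rewrite PE in Pu gP *.
have a0 i : a 0 i != 0.
  by move: Pu; rewrite unitmxE det_diag unitfE => /prodf_neq0/(_ i isT).
have gPE i j : g i j * (a 0 j)^*%C = a 0 i * g i j.
  by have /matrixP/(_ i j) := gP; rewrite conjv_diag mul_mx_diag mul_diag_mx !mxE.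
have [ge0 gh0 gs0] := rg.
have real_of (z : C) (t : R) : t != 0 -> t%:C%C * z^*%C = z * t%:C%C -> complex.Im z = 0.
  case: z => x y t0 /eqP; rewrite eq_complex /= => /andP[_ /eqP].
  rewrite mul0r addr0 mulr0 add0r => E.
  have : t * (2 * y) = 0 by move: E; lra.
  by move/eqP; rewrite mulf_eq0 (negbTE t0) mulf_eq0 pnatr_eq0 => /eqP.
pose b : 'rV[C]_(e + h + (s + s)) := \row_i (a 0 i)^-1.
have ab : diag_mx a *m diag_mx b = 1%:M.
  rewrite mulmx_diag -diag_const_mx; congr diag_mx; apply/rowP => i.
  by rewrite !mxE divff.
have inv_ab : invmx (diag_mx a) = diag_mx b.
  by rewrite -[LHS]mulmx1 -ab mulmxA mulVmx // mul1mx.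
pose ie (i : 'I_e) := lshift (s + s) (lshift h i).
pose ih (i : 'I_h) := lshift (s + s) (rshift e i).
pose is1 (i : 'I_s) := rshift (e + h) (lshift s i).
pose is2 (i : 'I_s) := rshift (e + h) (rshift s i).
have aeR i : complex.Im (b 0 (ie i)) = 0.
  have /real_of : (ge 0 i)%:C%C * (a 0 (ie i))^*%C = a 0 (ie i) * (ge 0 i)%:C%C.
    have := gPE (ie i) (ie i); rewrite gamma_mx_id /ie !block_mxEul.
    by rewrite !mxE eqxx mulr1n.
  move=> /(_ _) E; have {}E : complex.Im (a 0 (ie i)) = 0.
    by apply: E; rewrite gt_eqF //; have /andP[] := ge0 i.
  by rewrite mxE; move: E; case: (a 0 (ie i)) => x y /= ->; rewrite !(mul0r, oppr0).
have ahR i : complex.Im (b 0 (ih i)) = 0.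
  have /real_of : (gh 0 i)%:C%C * (a 0 (ih i))^*%C = a 0 (ih i) * (gh 0 i)%:C%C.
    have := gPE (ih i) (ih i); rewrite gamma_mx_id /ih !block_mxEul !block_mxEdr.
    by rewrite !mxE eqxx mulr1n.
  move=> /(_ _) E; have {}E : complex.Im (a 0 (ih i)) = 0.
    by apply: E; rewrite gt_eqF //; apply: lt_trans (gh0 i); rewrite invr_gt0.
  by rewrite mxE; move: E; case: (a 0 (ih i)) => x y /= ->; rewrite !(mul0r, oppr0).
have asR i : b 0 (is2 i) = (b 0 (is1 i))^*%C.
  have : gs 0 i * (a 0 (is2 i))^*%C = a 0 (is1 i) * gs 0 i.
    have := gPE (is1 i) (is2 i); rewrite gamma_mx_id /is1 /is2 !block_mxEdr !block_mxEur.
    by rewrite !mxE eqxx mulr1n.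
  have g0 : gs 0 i != 0.
    by apply/eqP => E; have [_] := gs0 i; rewrite E ltxx.
  rewrite [RHS]mulrC => /(mulfI g0) E.
  by rewrite !mxE -E conjc_inv conjcK.
exists (\row_i complex.Re (b 0 (ie i))), (\row_i complex.Re (b 0 (ih i))), (\row_i b 0 (is1 i)).
have b0 i : b 0 i != 0 by rewrite mxE invr_eq0.
have Rb i : complex.Im (b 0 i) = 0 -> complex.Re (b 0 i) != 0.
  move=> I0; apply/eqP => R0; move/eqP: (b0 i); apply.
  by move: I0 R0; case: (b 0 i) => x y /= -> ->.
split=> [i|i|i|].
- by rewrite mxE Rb.
- by rewrite mxE Rb.
- by rewrite mxE.
rewrite inv_ab; congr diag_mx; rewrite /a_vector castmx_id; apply/rowP => i.
have Cb j : complex.Im (b 0 j) = 0 -> b 0 j = (complex.Re (b 0 j))%:C%C.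
  by move=> I0; rewrite {1}[b 0 j]complexE I0 mulr0 addr0.
case: (split_ordP i) => j ->.
  rewrite row_mxEl; case: (split_ordP j) => k ->.
    rewrite row_mxEl [RHS]mxE [X in (X)%:C%C]mxE; exact: (Cb _ (aeR k)).
  rewrite row_mxEr [RHS]mxE [X in (X)%:C%C]mxE; exact: (Cb _ (ahR k)).
rewrite row_mxEr; case: (split_ordP j) => k ->.
  by rewrite row_mxEl [RHS]mxE.
by rewrite row_mxEr conjvE [X in X^*%C]mxE -asR.
Qed.

End GammaMatrix.

Section Uniqueness.
Variable R : realType.
Local Notation C := R[i].

Lemma distinct_eigenvalues_similar n (X Y P : 'M[C]_n) : P \in unitmx ->
  X *m P = P *m Y -> distinct_eigenvalues Y -> distinct_eigenvalues X.
Proof.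
move=> Pu XP [mu [mu_uniq /allP mu_ev]]; exists mu; split => //.
apply/allP => x /mu_ev /eigenvalueP[v vx v0]; apply/eigenvalueP.
exists (v *m invmx P).
  have -> : X = P *m Y *m invmx P by rewrite -XP mulmxK.
  by rewrite !mulmxA mulmxKV // vx -scalemxAl.
apply/eqP => E; move/eqP: v0; apply.
by rewrite -[v]mulmx1 -(mulVmx Pu) mulmxA E mul0mx.
Qed.

Lemma quadQ_equiv_distinct p (A G B g : 'M[C]_p) :
  A \in unitmx -> G \in unitmx -> B \in unitmx -> g \in unitmx ->
  holo_equiv (quadQ A G) (quadQ B g) ->
  distinct_eigenvalues (G *m conjv G) -> distinct_eigenvalues (g *m conjv g).
Proof.
move=> Au Gu Bu gu AB; have [P [nu [d [Pu _ _ gP]]]] := quadQ_equiv_linear Au Gu Bu gu AB.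
apply: distinct_eigenvalues_similar Pu _.
rewrite mulmxA -gP -[RHS]mulmxA -conjvM -gP conjvM conjvK.
by rewrite !mulmxA.
Qed.

Lemma gamma_diag_comm (e h s : nat) (ge : 'rV[R]_e) (gh : 'rV[R]_h) (gs : 'rV[C]_s)
    (ae : 'rV[R]_e) (ah : 'rV[R]_h) (as_ : 'rV[C]_s) :
  let g := gamma_mx erefl ge gh gs in
  let a := diag_mx (a_vector erefl ae ah as_) in
  g *m conjv a = a *m g.
Proof.
move=> g a; rewrite /a conjv_diag /a_vector castmx_id /g gamma_mx_id.
have -> : conjv (row_mx (row_mx (map_mx (real_complex R) ae) (map_mx (real_complex R) ah))
    (row_mx as_ (conjv as_))) =
  row_mx (row_mx (map_mx (real_complex R) ae) (map_mx (real_complex R) ah))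
    (row_mx (conjv as_) as_).
  have cr m n q (X : 'M[C]_(m, n)) (Y : 'M[C]_(m, q)) :
      conjv (row_mx X Y) = row_mx (conjv X) (conjv Y) by exact: map_row_mx.
  have rr n (v : 'rV[R]_n) : conjv (map_mx (real_complex R) v) = map_mx (real_complex R) v.
    by apply/rowP => i; rewrite !mxE conjc_real.
  by rewrite !cr !rr conjvK.
rewrite conjv_diag scalar_sub_diag !diag_mx_row !mulmx_block !mulmx0 !mul0mx !addr0 !add0r.
have dc n (u v : 'rV[C]_n) : diag_mx u *m diag_mx v = diag_mx v *m diag_mx u.
  by rewrite !mulmx_diag; congr diag_mx; apply/rowP => i; rewrite !mxE mulrC.
by rewrite [diag_mx (map_mx _ ge) *m _]dc [diag_mx (map_mx _ gh) *m _]dc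
  [diag_mx gs *m _]dc [diag_mx (_ - _) *m _]dc.
Qed.

Lemma invmx_perm_diag p (nu : 'S_p) (d : 'rV[C]_p) : (forall j, d 0 j != 0) ->
  exists2 e : 'rV[C]_p, forall j, e 0 j != 0 &
    invmx (perm_diag nu d) = perm_diag (nu^-1)%g e.
Proof.
move=> /perm_diag_inv - /(_ nu)[e e0 E]; exists e => //.
by rewrite E invmxK.
Qed.

Lemma gamma_mx_unitmx (p e h s : nat) (Ep : (e + h + (s + s))%N = p)
    (ge : 'rV[R]_e) (gh : 'rV[R]_h) (gs : 'rV[C]_s) :
  gamma_range ge gh gs -> gamma_mx Ep ge gh gs \in unitmx.
Proof. by case: p / Ep; exact: gamma_mx_unit. Qed.

Lemma quadQ_gamma_equivP (p e h s : nat) (Ep : (e + h + (s + s))%N = p)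
    (ge : 'rV[R]_e) (gh : 'rV[R]_h) (gs : 'rV[C]_s) :
  let g := gamma_mx Ep ge gh gs in
  gamma_range ge gh gs -> distinct_eigenvalues (g *m conjv g) ->
  forall B B' : 'M[C]_p, B \in unitmx -> B' \in unitmx ->
  holo_equiv (quadQ B g) (quadQ B' g) <-> B_equiv Ep B B'.
Proof.
case: p / Ep => g rg dg B B' Bu B'u; have gu := gamma_mx_unit rg.
split=> [BB'|[nu [d [ae [ah [as_ [d0 ae0 ah0 as0 ->]]]]]]].
  have [P [nu [d [Pu d0 BP gP]]]] := quadQ_equiv_linear Bu gu B'u gu BB'.
  have [ae [ah [as_ [ae0 ah0 as0 iP]]]] := gamma_commutant rg Pu dg gP.
  exists nu, d, ae, ah, as_; split => //.
  by rewrite -BP -iP mulmxK.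
set D := diag_mx _.
have Du : D \in unitmx.
  rewrite unitmxE det_diag unitfE; apply/prodf_neq0 => i _.
  rewrite /a_vector castmx_id.
  case: (split_ordP i) => j ->.
    rewrite row_mxEl; case: (split_ordP j) => k ->.
      by rewrite row_mxEl mxE eq_complex /= eqxx andbT.
    by rewrite row_mxEr mxE eq_complex /= eqxx andbT.
  rewrite row_mxEr; case: (split_ordP j) => k ->; first by rewrite row_mxEl.
  by rewrite row_mxEr mxE conjc_eq0.
have [c c0 ->] := invmx_perm_diag nu d0.
have gD := gamma_diag_comm ge gh gs ae ah as_.
apply: (@quadQ_linear_equiv _ _ _ _ _ _ (invmx D) (nu^-1)%g c) => //.
- by rewrite unitmx_inv.
- by rewrite mulmxK.
rewrite conjv_invmx; have cDu : conjv D \in unitmx by rewrite conjv_unitmx.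
apply: (can_inj (mulmxK cDu)); rewrite mulmxKV // -mulmxA.
by rewrite [g *m _]gD mulmxA mulVmx // mul1mx.
Qed.

End Uniqueness.

(** * Normal form of N under consimilarity *)

Section Eigenvectors.
Variables (F : fieldType) (n : nat).

Lemma row_diag_mul m (d : 'rV[F]_n) (A : 'M[F]_(n, m)) i :
  row i (diag_mx d *m A) = d 0 i *: row i A.
Proof. by rewrite row_mul row_diag_mx -scalemxAl -rowE. Qed.

(** Applying the product of the W - d_j over j other than i to a vanishing combination of the rows
    isolates its i-th coefficient. *)
Lemma eigenvectors_unit (W A : 'M[F]_n) (d : 'rV[F]_n) : injective (d 0) ->
  A *m W = diag_mx d *m A -> (forall i, row i A != 0) -> A \in unitmx.
Proof.
move=> dI AW A0; rewrite -row_free_unit; apply: inj_row_free => u uA.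
have key (r : seq 'I_n) :
    (\row_k (u 0 k * \prod_(j <- r) (d 0 k - d 0 j))) *m A = 0.
  elim: r => [|x r IH].
    by rewrite -[RHS]uA; congr (_ *m A); apply/rowP => k; rewrite mxE big_nil mulr1.
  set w := (\row_k _) in IH.
  have -> : \row_k (u 0 k * \prod_(j <- x :: r) (d 0 k - d 0 j)) =
      w *m diag_mx d - d 0 x *: w.
    by apply/rowP => k; rewrite mul_mx_diag !mxE big_cons; ring.
  by rewrite mulmxBl -mulmxA -AW mulmxA IH mul0mx -scalemxAl IH scaler0 subr0.
apply/rowP => i; rewrite mxE; have := key [seq j <- enum 'I_n | j != i].
set c := \prod_(j <- [seq j <- enum 'I_n | j != i]) (d 0 i - d 0 j).
have -> : \row_k (u 0 k * \prod_(j <- [seq j <- enum 'I_n | j != i]) (d 0 k - d 0 j)) =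
    (u 0 i * c) *: delta_mx 0 i.
  apply/rowP => k; rewrite !mxE eqxx /=; case: (eqVneq k i) => [->|ki]; first by rewrite mulr1.
  apply/eqP; rewrite !mulr0 mulf_eq0; apply/orP; right; rewrite prodf_seq_eq0.
  apply/hasP; exists k; first by rewrite mem_filter ki mem_enum.
  by apply/eqP; exact: subrr.
rewrite -scalemxAl -rowE => /eqP; rewrite scaler_eq0 (negbTE (A0 i)) orbF mulf_eq0.
suff /negbTE -> : c != 0 by rewrite orbF => /eqP.
rewrite prodf_seq_neq0; apply/allP => j; rewrite mem_filter => /andP[ji _].
by rewrite implyTb subr_eq0; apply: contra ji => /eqP/dI ->.
Qed.

Lemma size_eigenvalues (W : 'M[F]_n) (s : seq F) : uniq s -> all (eigenvalue W) s ->
  (size s <= n)%N.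
Proof.
move=> us /allP sW; rewrite -ltnS -(size_char_poly W); apply: max_poly_roots => //.
  by rewrite monic_neq0 // char_poly_monic.
by apply/allP => x /sW; rewrite eigenvalue_root_char.
Qed.

End Eigenvectors.

Section Consimilarity.
Variables (R : realType) (p : nat).
Local Notation C := R[i].
Variable (N : 'M[C]_p) (lam : p.-tuple C).
Let W := N *m conjv N.
Hypothesis lam_uniq : uniq lam.
Hypothesis lam_ev : all (eigenvalue W) lam.
Hypothesis lam0 : forall l, l \in lam -> l != 0 /\ l != 4.

(* phi is antilinear, phi \o phi = W, and conj P = N^T P gamma expresses that
   phi acts on the columns of P through gamma. *)
Let phi (v : 'rV[C]_p) := conjv (v *m N).

Let phiZ (c : C) v : phi (c *: v) = c^*%C *: phi v.
Proof. by rewrite /phi -scalemxAl conjvZ. Qed.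

Let phi_phi v : phi (phi v) = v *m W.
Proof. by rewrite /phi conjvM conjvK mulmxA. Qed.

Let phiW v (l : C) : v *m W = l *: v -> phi v *m W = l^*%C *: phi v.
Proof. by move=> vW; rewrite -phi_phi (phi_phi v) vW phiZ. Qed.

Let lam_mem l : (l \in lam) = eigenvalue W l.
Proof.
apply/idP/idP => [/(allP lam_ev)//|lW]; apply/negPn/negP => nl.
have := @size_eigenvalues _ _ W (l :: lam); rewrite /= nl lam_uniq lW lam_ev size_tuple ltnn.
by move/(_ isT isT).
Qed.

Let phi_neq0 v l : v != 0 -> l != 0 -> v *m W = l *: v -> phi v != 0.
Proof.
move=> v0 l0 vW; apply/eqP => pv.
have : l *: v = 0 by rewrite -vW -phi_phi pv /phi mul0mx conjv0.
by move/eqP; rewrite scaler_eq0 (negbTE v0) (negbTE l0).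
Qed.

(** [phi] carries eigenvectors for l to eigenvectors for conj(l), and is injective on them since l
    is not 0. *)
Let lam_conj l : l \in lam -> l^*%C \in lam.
Proof.
move=> llam; have [l0 _] := lam0 llam; move: llam.
rewrite !lam_mem => /eigenvalueP[v vW v0]; apply/eigenvalueP.
by exists (phi v); [exact: phiW|exact: phi_neq0 v0 l0 vW].
Qed.

(** Since W has p distinct eigenvalues, [u] extends to a basis of eigenvectors, in which an
    eigenvector for l has only the coordinate along [u]. *)
Let eigen_line l (u v : 'rV[C]_p) : u != 0 -> u *m W = l *: u -> v *m W = l *: v ->
  exists c, v = c *: u.
Proof.
move=> u0 uW vW.
have /choice[w wP] : forall i : 'I_p, exists w : 'rV[C]_p,
    [/\ w != 0, w *m W = tnth lam i *: w & tnth lam i = l -> w = u].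
  move=> i; have [E|ne] := eqVneq (tnth lam i) l; first by exists u; rewrite E.
  have /eigenvalueP[w wW w0] : eigenvalue W (tnth lam i) by rewrite -lam_mem mem_tnth.
  by exists w; split => // E; rewrite E eqxx in ne.
pose A := \matrix_(i < p) w i.
pose d : 'rV[C]_p := \row_i tnth lam i.
have rA i : row i A = w i by rewrite rowK.
have AW : A *m W = diag_mx d *m A.
  apply/row_matrixP => i; rewrite row_mul rA row_diag_mul rA mxE.
  by have [_ -> _] := wP i.
have dI : injective (d 0).
  by move=> i j; rewrite !mxE => E; apply: (tuple_uniqP lam lam_uniq).
have Au : A \in unitmx.
  by apply: eigenvectors_unit dI AW _ => i; rewrite rA; have [] := wP i.
have lm : l \in lam by rewrite lam_mem; apply/eigenvalueP; exists u.
have /tnthP[i li] := lm.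
pose c := v *m invmx A.
have vE : v = c *m A by rewrite mulmxKV.
exists (c 0 i).
have cd : c *m diag_mx d = l *: c.
  have : (c *m diag_mx d) *m A = (l *: c) *m A.
    by rewrite -mulmxA -AW mulmxA -vE vW -scalemxAl -vE.
  by move/(can_inj (mulmxK Au)).
clearbody c.
have c0 j : j != i -> c 0 j = 0.
  move=> ji; have /rowP/(_ j) := cd; rewrite mul_mx_diag !mxE => E.
  have : (tnth lam j - l) * c 0 j = 0 by rewrite mulrBl -E mulrC subrr.
  move/eqP; rewrite mulf_eq0 subr_eq0 => /orP[/eqP E'|/eqP//].
  by case/eqP: ji; apply: (tuple_uniqP lam lam_uniq); rewrite E' li.
rewrite vE mulmx_sum_row (bigD1 i) //= big1 ?addr0 => [|j ji].
  by rewrite rA; have [_ _ ->] := wP i.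
by rewrite c0 // scale0r.
Qed.

(** [phi] preserves the eigenline, so phi(u) = c u and l = c conj(c) > 0. Scaling u by a square root
    a of c replaces c by conj(a) a = |c|, the positive root of l. *)
Let real_eigenvector l : l \in lam -> complex.Im l = 0 ->
  exists v, [/\ v != 0, v *m W = l *: v, 0 < complex.Re l &
    phi v = (Num.sqrt (complex.Re l))%:C%C *: v].
Proof.
move=> llam lR; have [l0 _] := lam0 llam.
have lE : l = (complex.Re l)%:C%C by rewrite [LHS]complexE lR mulr0 addr0.
have lJ : l^*%C = l by rewrite lE conjc_real.
move: (llam); rewrite lam_mem => /eigenvalueP[u uW u0].
have [|c cE] := eigen_line (v := phi u) u0 uW; first by rewrite (phiW uW) lJ.
have lcc : l = c * c^*%C.
  have : l *: u = (c * c^*%C) *: u.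
    by rewrite -uW -phi_phi cE phiZ cE scalerA mulrC.
  move/eqP; rewrite -subr_eq0 -scalerBl scaler_eq0 (negbTE u0) orbF subr_eq0.
  by move/eqP.
have c0 : c != 0 by apply/eqP => E; rewrite lcc E mul0r eqxx in l0.
have Rl : complex.Re l = normc c ^+ 2.
  rewrite lcc; case: (c) => x y /=; rewrite sqr_sqrtr ?addr_ge0 ?sqr_ge0 //; ring.
have cn : 0 < normc c by rewrite normc_gt0.
pose a := sqrtc c; have aa : a ^+ 2 = c by exact: sqr_sqrtc.
have a0 : a != 0 by apply/eqP => E; rewrite -aa E expr0n eqxx in c0.
exists (a *: u); split.
- by rewrite scaler_eq0 negb_or a0 u0.
- by rewrite -scalemxAl uW !scalerA mulrC.
- by rewrite Rl exprn_gt0.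
rewrite Rl sqrtr_sqr ger0_norm ?normc_ge0 // phiZ cE !scalerA; congr (_ *: _).
have aJ : a * a^*%C = (normc c)%:C%C.
  rewrite -aa normcX; case: (a) => x y /=; rewrite sqr_sqrtr ?addr_ge0 ?sqr_ge0 //.
  by apply/eqP; rewrite eq_complex /=; apply/andP; split; apply/eqP; ring.
by rewrite -aJ -aa expr2; ring.
Qed.

(** The principal root sends the upper half-plane into the open first quadrant; this produces the
    inequalities required of gamma_s. *)
Lemma sqrtc_gt0 (z : C) : 0 < complex.Im z ->
  0 < complex.Re (sqrtc z) /\ 0 < complex.Im (sqrtc z).
Proof.
case: z => a b /= b0; rewrite gt_eqF // gtr0_sg // mul1r.
have ab : `|a| < Num.sqrt (a ^+ 2 + b ^+ 2).
  by rewrite -sqrtr_sqr ltr_sqrt ?ltrDl ?exprn_gt0 // ltr_wpDl ?sqr_ge0 ?exprn_gt0.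
move: ab; rewrite ltr_norml => /andP[a1 a2].
by rewrite !sqrtr_gt0; split; lra.
Qed.

(* gam l and 1 - gam l are the roots of x (1 - x) = l^-1. *)
Let gam (l : C) : C := 2^-1 + sqrtc (4^-1 - l^-1).

Let gam_mul l : gam l * (1 - gam l) = l^-1.
Proof.
have n2 : (2 : C) != 0 by rewrite pnatr_eq0.
have n4 : (4 : C) != 0 by rewrite pnatr_eq0.
have -> : gam l * (1 - gam l) = 4^-1 - sqrtc (4^-1 - l^-1) ^+ 2.
  by rewrite /gam; move: (sqrtc _) => x; field.
by rewrite sqr_sqrtc; ring.
Qed.

Let Re_ratio (n : nat) : (n%:R : C)^-1 = ((n%:R)^-1 : R)%:C%C.
Proof. by rewrite fmorphV rmorph_nat. Qed.

Let gam_range l : 0 < complex.Im l -> 2^-1 < complex.Re (gam l) /\ 0 < complex.Im (gam l).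
Proof.
move=> l0; have : 0 < complex.Im (4^-1 - l^-1).
  rewrite (Re_ratio 4); case: l l0 => x y /= y0; rewrite sub0r opprK divr_gt0 //.
  by rewrite ltr_wpDl ?sqr_ge0 ?exprn_gt0.
move/sqrtc_gt0; rewrite /gam (Re_ratio 2).
by case: (sqrtc _) => x y /= [x0 y0]; rewrite add0r ltrDl.
Qed.

Let ex_vec : exists v0 : C -> 'rV[C]_p, forall l, l \in lam ->
  [/\ v0 l != 0, v0 l *m W = l *: v0 l & complex.Im l = 0 ->
    0 < complex.Re l /\ phi (v0 l) = (Num.sqrt (complex.Re l))%:C%C *: v0 l].
Proof.
have /choice[v0 v0P] : forall l, exists v : 'rV[C]_p, l \in lam ->
    [/\ v != 0, v *m W = l *: v & complex.Im l = 0 ->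
    0 < complex.Re l /\ phi v = (Num.sqrt (complex.Re l))%:C%C *: v].
  move=> l; have [llam|nl] := boolP (l \in lam); last by exists 0.
  have [lR|lI] := eqVneq (complex.Im l) 0.
    by have [v [v1 v2 v3 v4]] := real_eigenvector llam lR; exists v.
  move: (llam); rewrite lam_mem => /eigenvalueP[v vW v0]; exists v; split => // lR.
  by rewrite lR eqxx in lI.
by exists v0.
Qed.

Lemma consimilarity_rows :
  exists (e h s : nat) (Ep : (e + h + (s + s))%N = p)
         (ge : 'rV[R]_e) (gh : 'rV[R]_h) (gs : 'rV[C]_s)
         (A : 'M[C]_(e + h + (s + s), p)) (d : 'rV[C]_(e + h + (s + s))),
    [/\ gamma_range ge gh gs, injective (d 0), A *m W = diag_mx d *m A,
        forall i, row i A != 0 &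
        conjv A = (gamma_mx erefl ge gh gs)^T *m (A *m N)].
Proof.
have [v0 v0P] := ex_vec.
(* The entry l^(-1/2) is below 1/2 exactly when l > 4. *)
pose le := [seq l <- lam | (complex.Im l == 0) && (4 < complex.Re l)].
pose lh := [seq l <- lam | (complex.Im l == 0) && (complex.Re l < 4)].
pose ls := [seq l <- lam | 0 < complex.Im l].
pose L := (le ++ lh) ++ (ls ++ map conjc ls).
have leP l : l \in le -> [/\ l \in lam, complex.Im l = 0 & 4 < complex.Re l].
  by rewrite mem_filter => /andP[/andP[/eqP h1 h2] h3].
have lhP l : l \in lh -> [/\ l \in lam, complex.Im l = 0 & complex.Re l < 4].
  by rewrite mem_filter => /andP[/andP[/eqP h1 h2] h3].
have lsP l : l \in ls -> l \in lam /\ 0 < complex.Im l.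
  by rewrite mem_filter => /andP[h1 h2].
have ImJ (l : C) : complex.Im l^*%C = - complex.Im l by case: l.
have Lu : uniq L.
  rewrite !cat_uniq (map_inj_uniq (can_inj (@conjcK R))) !filter_uniq //=.
  rewrite !andbT; apply/and3P; split.
  - apply/hasPn => l /lhP[_ _ l4]; apply/negP => /leP[_ _]; lra.
  - apply/hasPn => l; rewrite !mem_cat negb_or => ll.
    have lI : complex.Im l != 0.
      case/orP: ll => [/lsP[_ l0]|/mapP[m /lsP[_ m0] ->]]; first by rewrite gt_eqF.
      by rewrite ImJ oppr_eq0 gt_eqF.
    apply/andP; split; apply/negP => H; move: lI.
      by have [_ -> _] := leP _ H; rewrite eqxx.
    by have [_ -> _] := lhP _ H; rewrite eqxx.
  - apply/hasPn => l /mapP[m /lsP[_ m0] ->]; apply/negP => /lsP[_].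
    by rewrite ImJ; lra.
have Lmem : L =i lam.
  move=> l; rewrite !mem_cat; apply/idP/idP.
    case/orP => [/orP[/leP[]//|/lhP[]//]|/orP[/lsP[]//|/mapP[m /lsP[mlam _] ->]]].
    exact: lam_conj.
  move=> llam; have [n0 n4] := lam0 llam.
  have [lI|lI|lI] := ltgtP (complex.Im l) 0.
  - have : l \in map conjc ls.
      apply/mapP; exists l^*%C; last by rewrite conjcK.
      by rewrite mem_filter lam_conj // andbT ImJ oppr_gt0.
    by move=> ->; rewrite !orbT.
  - have -> : l \in ls by rewrite mem_filter lI llam.
    by rewrite !orbT.
  - have [l4|l4|l4] := ltgtP (complex.Re l) 4.
    + have -> : l \in lh by rewrite mem_filter lI eqxx l4 llam.
      by rewrite !orbT.
    + by have -> : l \in le by rewrite mem_filter lI eqxx l4 llam.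
    + case/eqP: n4; apply/eqP; rewrite eq_complex lI l4.
      by rewrite -[4 in X in _ == X]/(4%:R) -(rmorph_nat (real_complex R)) /= !eqxx.
have Ep : (size le + size lh + (size ls + size ls))%N = p.
  have /perm_size : perm_eq L lam by apply: uniq_perm.
  by rewrite /L !size_cat size_map size_tuple.
(* The eigenvector for conj(l) is conj(gam l) phi(v) rather than phi(v): with this scaling phi acts
   on the pair through the two off-diagonal blocks of gamma. *)
pose V (l : C) : 'rV[C]_p :=
  if complex.Im l < 0 then (gam l^*%C)^*%C *: phi (v0 l^*%C) else v0 l.
have gam0 l : 0 < complex.Im l -> gam l != 0.
  by move=> /gam_range[_ g0]; apply/eqP => E; rewrite E ltxx in g0.
have VP l : l \in lam -> V l != 0 /\ V l *m W = l *: V l.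
  move=> llam; rewrite /V; case: ifP => lI; last by have [? ? _] := v0P _ llam.
  have lJ := lam_conj llam; have [n0 _] := lam0 lJ.
  have [w0 wW _] := v0P _ lJ; split.
    rewrite scaler_eq0 negb_or (phi_neq0 w0 n0 wW) andbT conjc_eq0 gam0 //.
    by rewrite ImJ oppr_gt0.
  by rewrite -scalemxAl (phiW wW) conjcK !scalerA mulrC.
pose e := size le; pose h := size lh; pose s := size ls.
pose Ae : 'M[C]_(e, p) := \matrix_(i < e) V (nth 0 le i).
pose Ah : 'M[C]_(h, p) := \matrix_(i < h) V (nth 0 lh i).
pose As : 'M[C]_(s, p) := \matrix_(i < s) V (nth 0 ls i).
pose At : 'M[C]_(s, p) := \matrix_(i < s) V (nth 0 ls i)^*%C.
pose A : 'M[C]_(e + h + (s + s), p) := col_mx (col_mx Ae Ah) (col_mx As At).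
pose ge : 'rV[R]_e := \row_i (Num.sqrt (complex.Re (nth 0 le i)))^-1.
pose gh : 'rV[R]_h := \row_i (Num.sqrt (complex.Re (nth 0 lh i)))^-1.
pose gs : 'rV[C]_s := \row_i gam (nth 0 ls i).
have rowA i : row i A = V (nth 0 L i).
  rewrite /A /L; case: (split_ordP i) => j ->.
    rewrite rowKu; case: (split_ordP j) => k ->.
      by rewrite rowKu rowK /= !nth_cat size_cat ltn_addr // ltn_ord.
    rewrite rowKd rowK /= !nth_cat size_cat ltn_add2l ltn_ord.
    by rewrite ltnNge leq_addr /= addKn.
  rewrite rowKd; case: (split_ordP j) => k ->.
    rewrite rowKu rowK /= nth_cat size_cat ltnNge leq_addr /= addKn.
    by rewrite nth_cat ltn_ord.
  rewrite rowKd rowK /= nth_cat size_cat ltnNge leq_addr /= addKn.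
  by rewrite nth_cat ltnNge leq_addr /= addKn (nth_map 0).
have Lsz : size L = (e + h + (s + s))%N by rewrite /L !size_cat size_map.
have nthL (i : 'I_(e + h + (s + s))) : nth 0 L i \in lam.
  by rewrite -Lmem mem_nth // Lsz.
exists e, h, s, Ep, ge, gh, gs, A, (\row_i nth 0 L i).
have rg : gamma_range ge gh gs.
  split=> i; rewrite mxE.
  - have /leP[_ _ l4] : nth 0 le i \in le by rewrite mem_nth.
    have sq : 2 < Num.sqrt (complex.Re (nth 0 le i)).
      have -> : 2 = Num.sqrt (4 : R) by rewrite (_ : 4 = 2 ^+ 2) ?sqrtr_sqr ?ger0_norm // -natrX.
      by rewrite ltr_sqrt //; lra.
    by rewrite invr_gt0 ltf_pV2 ?posrE; lra.
  - have /lhP[llam lR l4] : nth 0 lh i \in lh by rewrite mem_nth.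
    have [_ _ /(_ lR)[l0 _]] := v0P _ llam.
    have sq : Num.sqrt (complex.Re (nth 0 lh i)) < 2.
      have -> : 2 = Num.sqrt (4 : R) by rewrite (_ : 4 = 2 ^+ 2) ?sqrtr_sqr ?ger0_norm // -natrX.
      by rewrite ltr_sqrt.
    have sq0 : 0 < Num.sqrt (complex.Re (nth 0 lh i)) by rewrite sqrtr_gt0.
    by rewrite ltf_pV2 ?posrE.
  - by apply: gam_range; have [] := lsP _ (mem_nth 0 (ltn_ord i)).
split => //.
- move=> i j; rewrite !mxE => /eqP; rewrite nth_uniq ?Lsz // => /eqP; exact: val_inj.
- apply/row_matrixP => i; rewrite row_mul row_diag_mul mxE rowA.
  by have [_] := VP _ (nthL i).
- by move=> i; rewrite rowA; have [] := VP _ (nthL i).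
have conjv_col m1 m2 n (X : 'M[C]_(m1, n)) (Y : 'M[C]_(m2, n)) :
    conjv (col_mx X Y) = col_mx (conjv X) (conjv Y) by exact: map_col_mx.
have rowJ m (X : 'M[C]_(m, p)) i : row i (conjv X) = conjv (row i X).
  by apply/rowP => j; rewrite !mxE.
have phiE (c : C) u v : conjv u = c *: (v *m N) <-> u = c^*%C *: phi v.
  rewrite /phi; split=> [E|E]; first by rewrite -[LHS]conjvK E conjvZ.
  by rewrite [in LHS]E conjvZ conjcK conjvK.
have AN : A *m N = col_mx (col_mx (Ae *m N) (Ah *m N)) (col_mx (As *m N) (At *m N)).
  by rewrite /A !mul_col_mx.
rewrite gamma_mx_id AN /A conjv_diag scalar_sub_diag !tr_block_mx !trmx0 !tr_diag_mx.
rewrite !mul_block_col !mul0mx !add0r !addr0 !conjv_col.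
have RJ (x : R) : (x%:C%C)^*%C = x%:C%C by exact: conjc_real.
have realE (l : C) : l \in lam -> complex.Im l = 0 ->
    V l = (((Num.sqrt (complex.Re l))^-1)%:C%C)^*%C *: phi (V l).
  move=> llam lR; have [_ _ /(_ lR)[l0 vE]] := v0P _ llam.
  rewrite RJ /V lR ltxx vE scalerA -rmorphM /= mulVf ?scale1r //.
  by rewrite gt_eqF // sqrtr_gt0.
have Ae_eq : conjv Ae = diag_mx (map_mx (real_complex R) ge) *m (Ae *m N).
  apply/row_matrixP => i; rewrite rowJ row_diag_mul row_mul !rowK; apply/phiE.
  rewrite mxE [X in (real_complex R X)]mxE.
  by have /leP[llam lR _] := mem_nth 0 (ltn_ord i); exact: realE.
have Ah_eq : conjv Ah = diag_mx (map_mx (real_complex R) gh) *m (Ah *m N).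
  apply/row_matrixP => i; rewrite rowJ row_diag_mul row_mul !rowK; apply/phiE.
  rewrite mxE [X in (real_complex R X)]mxE.
  by have /lhP[llam lR _] := mem_nth 0 (ltn_ord i); exact: realE.
have VJ l : 0 < complex.Im l -> V l^*%C = (gam l)^*%C *: phi (V l).
  by move=> l0; rewrite /V ImJ oppr_lt0 l0 conjcK ltNge (ltW l0).
(* As phi(phi(v)) = l v, this amounts to (1 - gam l) (gam l) l = 1, the equation defining [gam]. *)
have As_eq : conjv As = diag_mx (const_mx 1 - conjv gs) *m (At *m N).
  apply/row_matrixP => i; rewrite rowJ row_diag_mul row_mul !rowK; apply/phiE.
  have [llam l0] := lsP _ (mem_nth 0 (ltn_ord i)); rewrite !mxE.
  move: (nth 0 ls i) llam l0 => l llam l0; rewrite (VJ _ l0) phiZ conjcK.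
  have [_ vW] := VP _ llam; rewrite phi_phi vW !scalerA.
  have -> : (1 - (gam l)^*%C)^*%C = 1 - gam l.
    by rewrite rmorphB rmorph1 /= conjcK.
  have [n0 _] := lam0 llam.
  by rewrite [_ * gam l]mulrC gam_mul mulVf // scale1r.
have At_eq : conjv At = diag_mx gs *m (As *m N).
  apply/row_matrixP => i; rewrite rowJ row_diag_mul row_mul !rowK; apply/phiE.
  have [llam l0] := lsP _ (mem_nth 0 (ltn_ord i)); rewrite mxE; exact: VJ.
by rewrite Ae_eq Ah_eq As_eq At_eq.
Qed.

End Consimilarity.

Lemma consimilarity_normal_form (R : realType) p (N : 'M[R[i]]_p) (lam : p.-tuple R[i]) :
  uniq lam -> all (eigenvalue (N *m conjv N)) lam ->
  (forall l, l \in lam -> l != 0 /\ l != 4) ->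
  exists (e h s : nat) (Ep : (e + h + (s + s))%N = p)
         (ge : 'rV[R]_e) (gh : 'rV[R]_h) (gs : 'rV[R[i]]_s) (P : 'M[R[i]]_p),
    [/\ gamma_range ge gh gs, P \in unitmx &
        conjv P = N^T *m P *m gamma_mx Ep ge gh gs].
Proof.
move=> lu lW l04; have [e [h [s [Ep [ge [gh [gs [A [d [rg dI AW A0 AE]]]]]]]]]] :=
  consimilarity_rows lu lW l04.
exists e, h, s, Ep, ge, gh, gs.
case: p / Ep N lam lu lW l04 A AW A0 AE => N lam lu lW l04 A AW A0 AE.
exists A^T; split => //; first by rewrite unitmx_tr; exact: eigenvectors_unit dI AW A0.
by rewrite conjv_tr AE !trmx_mul trmxK.
Qed.

(** * Deck transformations *)

Section FiniteOrder.
Variable R : rcfType.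
Local Notation C := R[i].

Lemma not_unitmx_kernel (F : fieldType) n (A : 'M[F]_n) : A \notin unitmx ->
  exists2 v : 'rV[F]_n, v != 0 & v *m A = 0.
Proof.
rewrite -row_free_unit -kermx_eq0 => /rowV0Pn[v /sub_kermxP vA v0].
by exists v.
Qed.

(** Here (X^2 - 1) g = X^(2m) - 1 kills T. Since g takes the value m wherever x^2 = 1, no root of g
    is an eigenvalue of T, so g(T) is invertible and T^2 - 1 vanishes. *)
Lemma finite_order_involution n (T : 'M[C]_n) m : (0 < m)%N -> T ^+ m = 1 ->
  (forall (v : 'rV[C]_n) (x : C), v != 0 -> v *m T = x *: v -> x ^+ 2 = 1) -> T *m T = 1%:M.
Proof.
case: n T => [|n] T m0 Tm ev; first by apply/matrixP => -[].
pose g : {poly C} := \sum_(i < m) ('X^2) ^+ i.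
have gE x : g.[x] = \sum_(i < m) (x ^+ 2) ^+ i.
  by rewrite horner_sum; apply: eq_bigr => i _; rewrite !hornerE.
have [rs gP] := closed_field_poly_normal g.
have g1 : g.[1] = m%:R.
  by rewrite gE (eq_bigr (fun=> 1)) ?sumr_const ?card_ord // => i _; rewrite !expr1n.
have m0' : m%:R != 0 :> C by rewrite pnatr_eq0 -lt0n.
have g0 : g != 0 by apply/eqP => E; move: g1; rewrite E horner0 => /esym/eqP; rewrite (negbTE m0').
have rs1 r : r \in rs -> r ^+ 2 != 1.
  move=> rrs; apply/eqP => r2.
  have : g.[r] = 0.
    rewrite gP hornerZ; apply/eqP; rewrite mulf_eq0; apply/orP; right.
    by rewrite -/(root _ r) root_prod_XsubC.
  rewrite gE r2 (eq_bigr (fun=> 1)) ?sumr_const ?card_ord; last by move=> i _; rewrite expr1n.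
  by move/eqP; rewrite (negbTE m0').
have gu : horner_mx T g \in unitmx.
  rewrite gP linearZ /= rmorph_prod unitmxZ ?unitfE ?lead_coef_eq0 //.
  elim: rs rs1 {gP} => [|r rs IH] rs1; first by rewrite big_nil unitmx1.
  rewrite big_cons unitmx_mul IH ?andbT => [|x xrs]; last by rewrite rs1 // inE xrs orbT.
  rewrite rmorphB /= horner_mx_X horner_mx_C.
  case U : (T - r%:M \in unitmx) => //; have [v v0] := not_unitmx_kernel (negbT U).
  rewrite mulmxBr mul_mx_scalar => /eqP; rewrite subr_eq0 => /eqP /(ev _ _ v0) r2.
  by have := rs1 r; rewrite inE eqxx r2 eqxx => /(_ isT).
have gT : horner_mx T g = \sum_(i < m) (T ^+ 2) ^+ i.
  by rewrite rmorph_sum; apply: eq_bigr => i _; rewrite !rmorphXn /= horner_mx_X.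
have : (T ^+ 2 - 1) * horner_mx T g = 0.
  by rewrite gT -subrX1 -exprM mulnC exprM Tm expr1n subrr.
move=> E; have : (T ^+ 2 - 1) *m horner_mx T g *m invmx (horner_mx T g) = 0.
  by rewrite [_ *m horner_mx T g]E mul0mx.
by rewrite mulmxK // => /eqP; rewrite subr_eq0 => /eqP.
Qed.

(** The projections (1 + D) / 2 and (1 - D) / 2 onto the eigenspaces add up to the identity. *)
Lemma involution_diagonalizable n (D : 'M[C]_n) : D *m D = 1%:M ->
  exists2 rs, uniq rs & (\sum_(r <- rs) eigenspace D r :=: 1%:M)%MS.
Proof.
move=> DD; exists [:: 1; -1].
  by rewrite /= andbT inE -addr_eq0 -mulr2n pnatr_eq0.
apply/eqmxP; rewrite submx1 /= !big_cons big_nil.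
have h1 : ((2^-1 : C) *: (1%:M + D) <= eigenspace D 1)%MS.
  by apply/eigenspaceP; rewrite scale1r -scalemxAl mulmxDl mul1mx DD addrC.
have h2 : ((2^-1 : C) *: (1%:M - D) <= eigenspace D (-1))%MS.
  by apply/eigenspaceP; rewrite scaleN1r -scalemxAl mulmxBl mul1mx DD -scalerN opprB.
have <- : (2^-1 : C) *: (1%:M + D) + (2^-1 : C) *: (1%:M - D) = 1%:M.
  by apply/matrixP => i j; rewrite !mxE; move: (_ == _)%:R (D i j) => x y; field.
exact: addmx_sub_adds h1 (submx_trans h2 (addsmxSl _ _)).
Qed.

Lemma commuting_involutions n (I : finType) (D : I -> 'M[C]_n) :
  (forall i, D i *m D i = 1%:M) -> (forall i j, D i *m D j = D j *m D i) ->
  exists (P : 'M[C]_n) (d : I -> 'rV[C]_n), P \in unitmx /\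
    forall i, P *m D i = diag_mx (d i) *m P /\ forall k, (d i 0 k == 1) || (d i 0 k == -1).
Proof.
move=> DD DC; pose Ds := [seq D i | i <- enum I].
have [|P Pu /allP Pd] := (codiagonalizableP Ds).1.
  split; first by move=> A B /mapP[i _ ->] /mapP[j _ ->]; exact: DC.
  by move=> A /mapP[i _ ->]; apply/diagonalizablePeigen; exact: involution_diagonalizable.
have /choice[d dP] : forall i, exists d, P *m D i = diag_mx d *m P.
  move=> i; have /Pd /diagonalizable_forPex[d] : D i \in Ds by rewrite map_f // mem_enum.
  by move/(simmxP Pu) => E; exists d.
exists P, d; split => // i; split => // k.
have : diag_mx (d i) *m diag_mx (d i) = 1%:M.
  have : diag_mx (d i) *m diag_mx (d i) *m P = P.
    by rewrite -mulmxA -dP mulmxA -dP -mulmxA DD mulmx1.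
  by move/(congr1 (mulmx^~ (invmx P))); rewrite mulmxK // mulmxV.
move/matrixP/(_ k k); rewrite mulmx_diag !mxE eqxx mulr1n => /eqP.
by rewrite -expr2 sqrf_eq1.
Qed.

End FiniteOrder.

Lemma nat_ord_collision m (idx : nat -> 'I_m) : exists k1 k2, (k1 < k2)%N /\ idx k1 = idx k2.
Proof.
have ninj : ~ injective (fun k : 'I_m.+1 => idx k).
  by move=> /leq_card; rewrite !card_ord ltnn.
have [x [y [xy Exy]]] : exists x y : 'I_m.+1, x != y /\ idx x = idx y.
  apply: contrapT => no; apply: ninj => x y Exy; apply/eqP/negPn/negP => xy.
  by apply: no; exists x, y.
case: (ltngtP x y) => [xy'|yx|/val_inj E']; last by rewrite E' eqxx in xy.
  by exists x, y.
by exists y, x.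
Qed.

Section LinearGerms.
Variables (R : realType) (n : nat).
Local Notation C := R[i].
Local Notation K := (R[i] : numFieldType).
Local Notation V := 'rV[K]_n.

Lemma near0_scale (P : V -> Prop) (c : C) :
  (\forall x \near (0 : V), P x) -> \forall x \near (0 : V), P (c *: x).
Proof.
move=> /near0_rnorm[d d0 dP]; apply/near0_rnorm.
have c1 : 0 < normc c + 1 by rewrite ltr_wpDl ?normc_ge0.
exists (d / (normc c + 1)); first by rewrite divr_gt0.
move=> x; rewrite ltr_pdivlMr // => xd; apply: dP; rewrite rnormZ.
by apply: le_lt_trans xd; rewrite mulrC ler_wpM2l ?rnorm_ge0 // lerDl.
Qed.

(** Scaling x into the neighbourhood extends a germ identity between homogeneous maps to every
    point. *)
Lemma near0_homogeneous (P : V -> Prop) : (\forall x \near (0 : V), P x) ->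
  forall x, exists2 c : C, c != 0 & P (c *: x).
Proof.
move=> nP x; have [d d0 dP] := near0_line x nP; exists (d / 2)%:C%C.
  by rewrite eq_complex /= gt_eqF // divr_gt0.
by apply: dP; rewrite normc_real gtr0_norm ?divr_gt0 // ltr_pdivrMr // ltr_pMr // ltr1n.
Qed.

Lemma linear_germ_eq (S T : 'M[C]_n) :
  germ_eq (fun x : V => x *m S) (fun x => x *m T) -> S = T.
Proof.
move=> /near0_homogeneous H; apply/row_matrixP => i; rewrite !rowE.
have [c c0] := H (delta_mx 0 i : V); rewrite -!scalemxAl => /(congr1 ( *:%R c^-1)).
by rewrite !scalerA mulVf // !scale1r.
Qed.

(* F(x) = c^-m F(c^m x), and the right-hand side tends to dF(0) x. *)
Lemma homogeneous_germ_linear (F : V -> V) (c : C) : F 0 = 0 -> differentiable F 0 ->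
  c != 0 -> normc c < 1 -> (\forall x \near (0 : V), F (c *: x) = c *: F x) ->
  germ_eq F (fun x => x *m 'J F 0).
Proof.
move=> F0 dF c0 c1 /near0_rnorm[d d0 FcE].
have c_gt0 : 0 < normc c by rewrite normc_gt0.
have iterE m x : rnorm x < d -> F (c ^+ m *: x) = c ^+ m *: F x.
  move=> xd; elim: m => [|m IH]; first by rewrite expr0 !scale1r.
  rewrite exprS -!scalerA -IH FcE // rnormZ normcX.
  apply: le_lt_trans xd; apply: ler_piMl; first exact: rnorm_ge0.
  by apply: exprn_ile1; [exact: normc_ge0|exact: ltW].
apply/near0_rnorm; exists d => // x xd.
apply/eqP; rewrite -subr_eq0 -rnorm_eq0 eq_le rnorm_ge0 andbT.
apply/ler_addgt0Pr => e e0; rewrite add0r.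
have x1 : 0 < rnorm x + 1 by rewrite ltr_wpDl ?rnorm_ge0.
have [d1 d10 Fd] := differentiable_rnorm dF (divr_gt0 e0 x1).
have [m md] : exists m, normc c ^+ m * rnorm x < d1.
  have cv : (fun m => normc c ^+ m) @ \oo --> (0 : R).
    by apply: cvg_expr; rewrite ger0_norm ?normc_ge0.
  have /cvgrPdist_lt/(_ (d1 / (rnorm x + 1)) (divr_gt0 d10 x1))[m _ mP] := cv.
  exists m; have := mP m (leqnn m).
  rewrite /= sub0r normrN ger0_norm ?exprn_ge0 ?normc_ge0 // ltr_pdivlMr //.
  apply: le_lt_trans; rewrite ler_wpM2l ?exprn_ge0 ?normc_ge0 //; lra.
have := Fd (c ^+ m *: x); rewrite rnormZ normcX => /(_ md).
have -> : 'd F 0 (c ^+ m *: x) = c ^+ m *: (x *m 'J F 0).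
  by rewrite scalemxAl; exact: esym (mul_rV_lin1 _ _).
rewrite add0r F0 subr0 iterE // -scalerBr rnormZ normcX mulrCA ler_pM2l ?exprn_gt0 //.
move=> /le_trans; apply; rewrite mulrAC ler_pdivrMr // ler_wpM2l ?(ltW e0) //; lra.
Qed.

End LinearGerms.

Section Deck.
Variables (R : realType) (p : nat).
Local Notation C := R[i].
Local Notation K := (R[i] : numFieldType).
Local Notation V := 'rV[K]_(p + p).
Variables (H K' : 'I_p -> 'M[C]_p).
Hypothesis q0 : [set w | qmap K' w = 0] = [set 0].
Hypothesis maxd : max_deck H K'.

Let E := Emap H K'.

Lemma EmapZ c z w : E (c *: z) (c *: w) = c ^+ 2 *: E z w.
Proof.
apply/rowP => j; rewrite !mxE mulrDr !mulr_sumr; congr (_ + _); apply: eq_bigr => k _;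
  rewrite mulr_sumr; apply: eq_bigr => l _; rewrite !mxE; ring.
Qed.

(** The condition is imposed globally: for a linear map, homogeneity of [E] makes it equivalent to
    the condition near 0. *)
Definition linear_deck (T : 'M[C]_(p + p)) := forall x : V,
  lsubmx (x *m T) = lsubmx x /\
  E (lsubmx (x *m T)) (rsubmx (x *m T)) = E (lsubmx x) (rsubmx x).

Lemma qmap_eq0 w : qmap K' w = 0 -> w = 0.
Proof.
move=> qw; have : [set w | qmap K' w = 0] w by [].
by rewrite q0.
Qed.

Lemma Emap0 w : E 0 w = qmap K' w.
Proof.
apply/rowP => j; rewrite !mxE big1 ?add0r // => k _; rewrite big1 // => l _.
by rewrite mxE mulr0 mul0r.
Qed.

(** A kernel vector has first half 0 and second half a zero of q, hence vanishes. *)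
Lemma linear_deck_unit T : linear_deck T -> T \in unitmx.
Proof.
move=> dT; case U : (T \in unitmx) => //.
have [v v0 vT] := not_unitmx_kernel (negbT U).
have [] := dT v; rewrite vT !linear0 => lv; rewrite -lv Emap0.
rewrite Emap0 => qv; have wv : rsubmx v = 0.
  by apply: qmap_eq0; rewrite -qv; apply/rowP => j; rewrite !mxE big1 // => k _; rewrite big1 // => l _; rewrite !mxE mulr0.
by move: v0; rewrite -[v]hsubmxK -lv wv row_mx0 eqxx.
Qed.

Lemma linear_deckM S T : linear_deck S -> linear_deck T -> linear_deck (S *m T).
Proof.
move=> dS dT x; have [h1 h2] := dS x; have [h3 h4] := dT (x *m S).
by rewrite mulmxA; split; [exact: etrans h3 h1|exact: etrans h4 h2].
Qed.

Lemma linear_deck1 : linear_deck 1%:M.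
Proof. by move=> x; rewrite mulmx1. Qed.

Lemma deck_linear T : linear_deck T -> deck H K' (fun x => x *m T).
Proof.
move=> dT; split; first exact/germ_biholo_mulmxr/linear_deck_unit.
apply: filterE => x; have [h1 h2] := dT x.
by rewrite /pi1 /cplx_point /=; congr row_mx.
Qed.

Lemma pi1_eqP (x y : V) : pi1 H K' x = pi1 H K' y <->
  lsubmx x = lsubmx y /\ E (lsubmx x) (rsubmx x) = E (lsubmx y) (rsubmx y).
Proof.
rewrite /pi1 /cplx_point /=; split=> [/eq_row_mx//|[h1 h2]].
by congr row_mx.
Qed.

Lemma pi1_scale (c : C) (x y : V) : c != 0 ->
  pi1 H K' (c *: x) = pi1 H K' (c *: y) <-> pi1 H K' x = pi1 H K' y.
Proof.
move=> c0; have c20 : c ^+ 2 != 0 by rewrite expf_neq0.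
rewrite !pi1_eqP ![lsubmx (_ *: _)]linearZ ![rsubmx (_ *: _)]linearZ /= !EmapZ.
split=> [[/(can_inj (scalerK c0)) h1 /(can_inj (scalerK c20)) h2]//|[h1 h2]].
by split; [rewrite h1|rewrite h2].
Qed.

Lemma deck_scale (F : V -> V) (c : C) : c != 0 -> deck H K' F ->
  deck H K' (fun x => c^-1 *: F (c *: x)).
Proof.
move=> c0 [bF pF]; split.
  have bl (a : C) : a != 0 -> germ_biholo (fun x : V => x *m a%:M).
    by move=> a0; apply: germ_biholo_mulmxr; rewrite unitmxE det_scalar unitfE expf_neq0.
  have := germ_biholo_comp (germ_biholo_comp (bl _ (invr_neq0 c0)) bF) (bl _ c0).
  by congr germ_biholo; apply/funext => x /=; rewrite !mul_mx_scalar.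
have := near0_scale c pF; apply: filterS => x Fx.
have e : c *: (c^-1 *: F (c *: x)) = F (c *: x) by rewrite scalerA divff // scale1r.
apply: (pi1_scale (c^-1 *: F (c *: x)) x c0).1.
exact: etrans (congr1 (pi1 H K') e) Fx.
Qed.

Lemma deck_is_linear (F : V -> V) : deck H K' F ->
  exists2 T, linear_deck T & germ_eq F (fun x => x *m T).
Proof.
move=> dF; have [D [dD DI Dex]] := maxd.
pose c k : C := (2 ^- k).
have c0 k : c k != 0 by rewrite invr_neq0 // expf_neq0 // pnatr_eq0.
pose Fs k := fun x : V => (c k)^-1 *: F (c k *: x).
have /choice[idx idxP] : forall k : nat, exists i, germ_eq (Fs k) (D i).
  by move=> k; apply: Dex; exact: deck_scale.
(* Two of the rescalings by 2^-k are the same germ, so F(b x) = b F(x) near 0 with b = 2^-(k2 -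
   k1). *)
have [k1 [k2 [k12 Ek]]] := nat_ord_collision idx.
have FE : germ_eq (Fs k1) (Fs k2).
  by apply: germ_eq_trans (idxP k1) _; apply: germ_eq_sym; rewrite Ek.
pose b := c (k2 - k1)%N.
have bE : c k2 = b * c k1 by rewrite /b /c -invfM -exprD subnK // ltnW.
have [bF pF] := dF; have [F0 hF _] := bF.
have dF0 := holomorphic_at0_differentiable hF.
have b0 : b != 0 by exact: c0.
have b1 : normc b < 1.
  rewrite normcV normcX; have -> : normc (2 : C) = 2.
    by rewrite -(rmorph_nat (real_complex R)) normc_real ger0_norm.
  by rewrite invf_lt1 ?exprn_gt0 // exprn_egt1 ?ltr1n // subn_eq0 -ltnNge.
have Fb : \forall x \near (0 : V), F (b *: x) = b *: F x.
  have := near0_scale (c k1)^-1 FE; apply: filterS => x.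
  rewrite /Fs bE scalerA divff // scale1r scalerA mulfK //.
  move=> /(congr1 ( *:%R (b * c k1))); rewrite scalerA mulfK // => ->.
  by rewrite scalerA mulfV ?scale1r // mulf_neq0.
have lF := homogeneous_germ_linear F0 dF0 b0 b1 Fb.
exists ('J F 0) => //.
have pJ : \forall x \near (0 : V), pi1 H K' (x *m 'J F 0) = pi1 H K' x.
  by move: lF pF; apply: filterS2 => x /= <-.
move=> x; have [t t0] := near0_homogeneous pJ x.
by rewrite -scalemxAl => /(pi1_scale _ _ t0)/pi1_eqP.
Qed.

End Deck.

(** * Linear deck transformations as sign changes *)

Section DeckMatrix.
Variables (R : realType) (p : nat).
Local Notation C := R[i].
Implicit Types (P N : 'M[C]_p) (s : {ffun 'I_p -> bool}).

Definition sign_row s : 'rV[C]_p := \row_k (-1) ^+ s k.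

Definition sign_mx P s : 'M[C]_p := invmx P *m diag_mx (sign_row s) *m P.

(* (z, zN/2 + w) |-> (z, zN/2 + wD), where D has sign (-1)^(s k) on row k of P. *)
Definition deck_mx P N s : 'M[C]_(p + p) :=
  block_mx 1%:M (2^-1 *: (N *m (1%:M - sign_mx P s))) 0 (sign_mx P s).

Lemma sign_mxK P s : P \in unitmx -> P *m sign_mx P s = diag_mx (sign_row s) *m P.
Proof. by move=> Pu; rewrite /sign_mx -mulmxA mulKVmx. Qed.

Lemma sign_mx_all P : P \in unitmx -> sign_mx P [ffun=> true] = - 1%:M.
Proof.
move=> Pu; rewrite /sign_mx (_ : diag_mx _ = - 1%:M); last first.
  by apply/matrixP => i j; rewrite !mxE ffunE expr1 mulNrn.
by rewrite mulmxN mulmx1 mulNmx mulVmx.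
Qed.

Lemma mul_deck_mx P N s (z w : 'rV[C]_p) : row_mx z (2^-1 *: (z *m N) + w) *m deck_mx P N s =
  row_mx z (2^-1 *: (z *m N) + w *m sign_mx P s).
Proof.
rewrite mul_row_block mulmx1 mulmx0 addr0; congr row_mx.
rewrite mulmxDl addrA; congr (_ + _).
by rewrite -scalemxAr -scalemxAl -scalerDr mulmxA -mulmxDr subrK mulmx1.
Qed.

End DeckMatrix.

Section DeckStructure.
Variables (R : realType) (p : nat).
Local Notation C := R[i].
Local Notation K := (R[i] : numFieldType).
Local Notation V := 'rV[K]_(p + p).
Variables (H K' : 'I_p -> 'M[C]_p).
Hypothesis q0 : [set w | qmap K' w = 0] = [set 0].
Hypothesis maxd : max_deck H K'.

Local Notation ldeck := (linear_deck H K').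

Lemma linear_deck_enum : exists Ts : 'I_(2 ^ p) -> 'M[C]_(p + p),
  [/\ forall i, ldeck (Ts i), injective Ts & forall T, ldeck T -> exists i, T = Ts i].
Proof.
have [D [dD DI Dex]] := maxd.
have /choice[Ts TsP] : forall i, exists T, ldeck T /\ germ_eq (D i) (fun x => x *m T).
  by move=> i; have [T lT DT] := deck_is_linear maxd (dD i); exists T.
exists Ts; split; first by move=> i; have [] := TsP i.
- move=> i j Eij; apply: DI; apply: germ_eq_trans (TsP i).2 _.
  by rewrite Eij; apply: germ_eq_sym; exact: (TsP j).2.
- move=> T lT; have [i FD] := Dex _ (deck_linear q0 lT).
  by exists i; apply: linear_germ_eq; exact: germ_eq_trans FD (TsP i).2.
Qed.

Lemma linear_deckX T k : ldeck T -> ldeck (T ^+ k).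
Proof.
move=> lT; elim: k => [|k IH]; first by rewrite expr0; exact: linear_deck1.
by rewrite exprS; exact: linear_deckM.
Qed.

(** For x other than 1 the eigenvector has z' = 0, where E reduces to q; then x^2 q(w) = q(w) with
    q(w) nonzero. *)
Lemma linear_deck_eigenvalue T (v : 'rV[C]_(p + p)) x :
  ldeck T -> v != 0 -> v *m T = x *: v -> x ^+ 2 = 1.
Proof.
move=> lT v0 vT; have [] := lT v; rewrite vT !linearZ /= => h1.
have [->|x1] := eqVneq x 1; first by rewrite expr1n.
have lv : lsubmx v = 0.
  apply/eqP; have : (x - 1) *: lsubmx v = 0 by rewrite scalerBl h1 scale1r subrr.
  by move/eqP; rewrite scaler_eq0 subr_eq0 (negbTE x1).
rewrite [Emap H K' _ _]EmapZ lv Emap0 => h2.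
have qv : qmap K' (rsubmx v) != 0.
  apply/eqP => /(qmap_eq0 q0) rv; move: v0.
  by rewrite -[v]hsubmxK lv rv row_mx0 eqxx.
apply/eqP; rewrite -subr_eq0.
have : (x ^+ 2 - 1) *: qmap K' (rsubmx v) = 0 by rewrite scalerBl h2 scale1r subrr.
by move/eqP; rewrite scaler_eq0 (negbTE qv) orbF.
Qed.

Lemma linear_deck_involution T : ldeck T -> T *m T = 1%:M.
Proof.
move=> lT; have [Ts [_ _ Tex]] := linear_deck_enum.
have /choice[idx idxP] : forall k, exists i, T ^+ k = Ts i.
  by move=> k; apply: Tex; exact: linear_deckX.
have [k1 [k2 [k12 Ek]]] := nat_ord_collision idx.
apply: (@finite_order_involution _ _ _ (k2 - k1)); first by rewrite subn_gt0.
  have : T ^+ k1 * T ^+ (k2 - k1) = T ^+ k1.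
    by rewrite -exprD subnKC ?(ltnW k12) // !idxP Ek.
  move/(congr1 (mulmx (invmx (T ^+ k1)))).
  have U := linear_deck_unit q0 (linear_deckX k1 lT).
  by rewrite [X in _ *m X](_ : _ = T ^+ k1 *m T ^+ (k2 - k1)) // mulKmx // mulVmx.
by move=> v x v0 vT; exact: linear_deck_eigenvalue vT.
Qed.

Lemma linear_deck_comm S T : ldeck S -> ldeck T -> S *m T = T *m S.
Proof.
move=> lS lT; have lST := linear_deck_involution (linear_deckM lS lT).
have SS := linear_deck_involution lS; have TT := linear_deck_involution lT.
have : S *m (S *m T *m (S *m T)) *m T = S *m T by rewrite lST mulmx1.
by rewrite !mulmxA SS mul1mx -!mulmxA TT mulmx1 => ->.
Qed.

Lemma linear_deck_block T : ldeck T -> T = block_mx 1%:M (ursubmx T) 0 (drsubmx T).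
Proof.
move=> lT; rewrite -{1}[T]submxK; suff [-> ->] : ulsubmx T = 1%:M /\ dlsubmx T = 0 by [].
have lsE (z w : 'rV[C]_p) : z *m ulsubmx T + w *m dlsubmx T = z.
  have [+ _] := lT (row_mx z w).
  by rewrite -{1}[T]submxK mul_row_block !row_mxKl.
split; apply/row_matrixP => i; rewrite !rowE.
  by have := lsE (delta_mx 0 i) 0; rewrite mul0mx addr0 mulmx1.
by have := lsE 0 (delta_mx 0 i); rewrite mul0mx add0r mulmx0.
Qed.

(** The lower right block of [S *m T] is the identity; an involution of this block form is the
    identity, whence T is the inverse of S, that is, S. *)
Lemma linear_deck_inj S T : ldeck S -> ldeck T -> drsubmx S = drsubmx T -> S = T.
Proof.
move=> lS lT ST; have SE := linear_deck_block lS; have TE := linear_deck_block lT.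
have := linear_deck_involution (linear_deckM lS lT).
have := linear_deck_involution lS.
rewrite SE TE ST; move: (drsubmx T) (ursubmx S) (ursubmx T) => D A B.
rewrite !mulmx_block !mul1mx !mul0mx !mulmx0 !addr0 !add0r.
rewrite scalar_mx_block => /eq_block_mx[_ AA _ DD].
rewrite DD !mulmx1 => /eq_block_mx[_ /eqP + _ _].
rewrite mul1mx -mulr2n -scaler_nat scaler_eq0 pnatr_eq0 /= => /eqP AB; congr block_mx.
by apply/(addIr (A *m D)); rewrite AA AB.
Qed.

(** The lower right blocks are commuting involutions, diagonal in a common basis. The 2^p deck
    transformations inject into the 2^p sign patterns, so every pattern occurs. *)
Lemma linear_deck_sign : exists2 P, P \in unitmx &
  (forall T, ldeck T -> exists s, drsubmx T = sign_mx P s) /\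
  (forall s, exists2 T, ldeck T & drsubmx T = sign_mx P s).
Proof.
have [Ts [lTs Tinj Tex]] := linear_deck_enum.
have drM S T : ldeck S -> ldeck T -> drsubmx (S *m T) = drsubmx S *m drsubmx T.
  move=> /linear_deck_block -> /linear_deck_block ->.
  by rewrite mulmx_block !block_mxKdr mul0mx add0r.
have [||P [d [Pu Pd]]] := @commuting_involutions R p _ (fun i => drsubmx (Ts i)).
- by move=> i; rewrite -drM // linear_deck_involution // scalar_mx_block block_mxKdr.
- by move=> i j; rewrite -!drM // linear_deck_comm.
exists P => //; pose sg i : {ffun 'I_p -> bool} := [ffun k => d i 0 k == -1].
have TsE i : drsubmx (Ts i) = sign_mx P (sg i).
  have [Pi di] := Pd i.
  rewrite -[LHS](mulKmx Pu) Pi /sign_mx -mulmxA; congr (_ *m (diag_mx _ *m _)).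
  apply/rowP => k; rewrite mxE ffunE.
  case/orP: (di k) => /eqP ->; last by rewrite eqxx expr1.
  have -> : (1 == -1 :> C) = false by rewrite -addr_eq0 -mulr2n pnatr_eq0.
  by rewrite expr0.
have sgI : injective sg.
  move=> i j Eij; apply: Tinj; apply: linear_deck_inj => //.
  by rewrite !TsE Eij.
have [|sg' _ sg'K] := inj_card_bij sgI; first by rewrite card_ffun card_bool !card_ord.
split=> [T /Tex[i ->]|s]; first by exists (sg i).
by exists (Ts (sg' s)); rewrite ?TsE ?sg'K.
Qed.

(** N is the upper right block of the deck transformation J flipping all signs. For T with
    right-hand blocks A and D, the equality T J = J T gives 2 A = N (1 - D). *)
Lemma linear_deck_normal_form : exists P N, [/\ P \in unitmx,
  forall T, ldeck T -> exists s, T = deck_mx P N s & forall s, ldeck (deck_mx P N s)].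
Proof.
have [P Pu [Ts sT]] := linear_deck_sign.
have [J lJ JE] := sT [ffun=> true].
have TE T s : ldeck T -> drsubmx T = sign_mx P s -> T = deck_mx P (ursubmx J) s.
  move=> lT Es; have TE := linear_deck_block lT.
  have := linear_deck_comm lT lJ; rewrite (linear_deck_block lJ) JE sign_mx_all //.
  rewrite TE block_mxKur Es mulmx_block mulmx_block.
  rewrite !mul1mx !mulmx1 !mulmx0 !mul0mx !addr0 => /eq_block_mx[_ + _ _].
  rewrite /deck_mx mulmxN mulmx1.
  move: (ursubmx J) (ursubmx T) (sign_mx P s) => N A D AE; congr block_mx.
  apply: (scalerI (_ : 2 != 0 :> C)); first by rewrite pnatr_eq0.
  rewrite scalerA divff ?pnatr_eq0 // scale1r mulmxBr mulmx1 scaler_nat mulr2n.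
  by rewrite -[N in N - _](subrK A) AE addrAC addrK.
exists P, (ursubmx J); split => // [T lT|s].
  by have [s sE] := Ts T lT; exists s; exact: TE.
by have [T lT sE] := sT s; rewrite -(TE T s lT sE).
Qed.

End DeckStructure.

(** * The map E as a sum of squares *)

Section DeckQuadric.
Variables (R : realType) (p : nat).
Local Notation C := R[i].
Variables (H K' : 'I_p -> 'M[C]_p) (P N : 'M[C]_p).
Hypothesis q0 : [set w | qmap K' w = 0] = [set 0].
Hypothesis Pu : P \in unitmx.
Hypothesis deckP : forall s, linear_deck H K' (deck_mx P N s).

Let E := Emap H K'.

Definition square_mx : 'M[C]_p := \matrix_k qmap K' (row k P).

Lemma Emap_parallelogram (z w u : 'rV[C]_p) :
  E z (w + u) + E z (w - u) = 2 *: (E z w + qmap K' u).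
Proof.
apply/rowP => j; rewrite !mxE mulrDr mulrDr.
have hE : (\sum_k \sum_l H j k l * z 0 k * (w + u) 0 l) +
   (\sum_k \sum_l H j k l * z 0 k * (w - u) 0 l) = 2 * (\sum_k \sum_l H j k l * z 0 k * w 0 l).
  rewrite -big_split /= mulr_sumr; apply: eq_bigr => k _.
  rewrite -big_split /= mulr_sumr; apply: eq_bigr => l _; rewrite !mxE; ring.
have qE : (\sum_k \sum_l K' j k l * (w + u) 0 k * (w + u) 0 l) +
   (\sum_k \sum_l K' j k l * (w - u) 0 k * (w - u) 0 l) =
   2 * (\sum_k \sum_l K' j k l * w 0 k * w 0 l) + 2 * (\sum_k \sum_l K' j k l * u 0 k * u 0 l).
  rewrite !mulr_sumr -!big_split /=; apply: eq_bigr => k _.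
  rewrite !mulr_sumr -!big_split /=; apply: eq_bigr => l _; rewrite !mxE; ring.
by rewrite addrACA hE qE addrA.
Qed.

Lemma qmapZ c w : qmap K' (c *: w) = c ^+ 2 *: qmap K' w.
Proof. by rewrite -!(Emap0 H) -EmapZ scaler0. Qed.

Lemma row_sign_mx k s : row k P *m sign_mx P s = (-1) ^+ s k *: row k P.
Proof. by rewrite -row_mul sign_mxK // row_mul row_diag_mx -scalemxAl -rowE mxE. Qed.

(** The deck transformation flipping only the k-th coordinate preserves E and, as [k \notin r],
    leaves [w] unchanged. *)
Lemma Emap_reflection (z : 'rV[C]_p) (y : 'I_p -> C) (r : seq 'I_p) k t : k \notin r ->
  let w := 2^-1 *: (z *m N) + \sum_(l <- r) y l *: row l P in
  E z (w + t *: row k P) = E z (w - t *: row k P).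
Proof.
move=> kr w; pose s : {ffun 'I_p -> bool} := [ffun l => l == k].
have [_] := deckP s (row_mx z (w + t *: row k P)).
rewrite -addrA mul_deck_mx !row_mxKl !row_mxKr -/E => <-.
rewrite mulmxDl -scalemxAl row_sign_mx ffunE eqxx expr1 scaleN1r scalerN addrA.
congr (E z (_ + _ - _)); rewrite mulmx_suml !big_seq; apply: eq_bigr => l lr.
rewrite -scalemxAl row_sign_mx ffunE (_ : l == k = false) ?expr0 ?scale1r //.
by apply: contraNF kr => /eqP <-.
Qed.

(* Reflecting the coordinates one at a time and using the parallelogram law kills
   the linear and the mixed terms. *)
Lemma Emap_squares (z : 'rV[C]_p) (y : 'rV[C]_p) :
  E z (2^-1 *: (z *m N) + y *m P) =
  E z (2^-1 *: (z *m N)) + (\row_k y 0 k ^+ 2) *m square_mx.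
Proof.
have aux (r : seq 'I_p) : uniq r ->
    E z (2^-1 *: (z *m N) + \sum_(l <- r) y 0 l *: row l P) =
    E z (2^-1 *: (z *m N)) + \sum_(l <- r) y 0 l ^+ 2 *: qmap K' (row l P).
  elim: r => [|k r IH] /=; first by rewrite !big_nil !addr0.
  case/andP=> kr ur; rewrite !big_cons.
  rewrite addrCA [RHS]addrCA -IH // -qmapZ addrC [RHS]addrC.
  apply: (scalerI (_ : 2 != 0 :> C)); first by rewrite pnatr_eq0.
  rewrite -Emap_parallelogram -(@Emap_reflection z (y 0)) //.
  by rewrite scaler_nat mulr2n.
have -> : y *m P = \sum_l y 0 l *: row l P by rewrite mulmx_sum_row.
rewrite aux ?index_enum_uniq //; congr (_ + _).
by rewrite mulmx_sum_row; apply: eq_bigr => l _; rewrite rowK mxE.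
Qed.

(** A nonzero kernel vector c would give, with y_k a square root of c_k, a nonzero zero y P of q. *)
Lemma square_mx_unit : square_mx \in unitmx.
Proof.
case U : (square_mx \in unitmx) => //; have [c c0 cE] := not_unitmx_kernel (negbT U).
pose y : 'rV[C]_p := \row_k sqrtc (c 0 k).
have yc : \row_k y 0 k ^+ 2 = c by apply/rowP => k; rewrite !mxE sqr_sqrtc.
have := Emap_squares 0 y; rewrite yc cE addr0 mul0mx scaler0 add0r.
rewrite /E !Emap0 => qy; have {qy} : qmap K' (y *m P) = 0.
  by rewrite qy; apply/rowP => j; rewrite !mxE big1 // => k _; rewrite big1 // => l _; rewrite !mxE mulr0.
move/(qmap_eq0 q0)/(congr1 (mulmx^~ (invmx P))); rewrite mulmxK // mul0mx => y0.
by move: c0; rewrite -yc y0; case/eqP; apply/rowP => k; rewrite !mxE expr0n.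
Qed.

End DeckQuadric.

Section LinearJacobian.
Variables (R : realType) (n : nat).
Local Notation C := R[i].
Local Notation K := (R[i] : numFieldType).
Local Notation V := 'rV[K]_n.

Lemma germ_linear_jacobian (f : V -> V) (S : 'M[C]_n) :
  germ_eq f (fun x => x *m S) -> 'J f 0 = S.
Proof.
move=> fS; have f0 : f 0 = 0 by rewrite (nbhs_singleton fS) mul0mx.
have cS : continuous (mulmxr S : {linear V -> V}).
  by move=> y; exact: (differentiable_continuous (differentiable_mulmxr S y)).
have E : 'd f 0 = (mulmxr S : {linear V -> V}) :> (V -> V).
  apply: diff_unique => //; apply/eqaddoP => e e0.
  move: fS; apply: filterS => h fh.
  rewrite [X in `|X|](_ : _ = f (h + 0) - (f 0 + h *m S)) //.
  by rewrite addr0 fh f0 add0r subrr normr0 mulr_ge0 ?normr_ge0 // ltW.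
apply/row_matrixP => i; rewrite !rowE.
apply: etrans (mul_rV_lin1 _ _) _.
exact: (congr1 (fun F : V -> V => F (delta_mx 0 i : V)) E).
Qed.

End LinearJacobian.

Section Signs.
Variables (R : realType) (p : nat).
Local Notation C := R[i].
Variables (P N : 'M[C]_p).
Hypothesis Pu : P \in unitmx.
Implicit Types s : {ffun 'I_p -> bool}.

Lemma sign_mxM s s' : sign_mx P s *m sign_mx P s' = sign_mx P [ffun i => s i (+) s' i].
Proof.
have E : P *m (sign_mx P s *m sign_mx P s') = diag_mx (sign_row R [ffun i => s i (+) s' i]) *m P.
  rewrite mulmxA sign_mxK // -mulmxA sign_mxK // mulmxA mulmx_diag; congr (diag_mx _ *m _).
  by apply/rowP => i; rewrite !mxE ffunE signr_addb.
by rewrite -[LHS](mulKmx Pu) E mulmxA.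
Qed.

Lemma deck_mxM s s' : deck_mx P N s *m deck_mx P N s' = deck_mx P N [ffun i => s i (+) s' i].
Proof.
apply/row_matrixP => i; rewrite !rowE mulmxA; move: (delta_mx _ _) => x.
have [z [w ->]] : exists z w, x = row_mx z (2^-1 *: (z *m N) + w).
  exists (lsubmx x), (rsubmx x - 2^-1 *: (lsubmx x *m N)).
  by rewrite addrC subrK hsubmxK.
apply: etrans (congr1 (mulmx^~ _) (mul_deck_mx P N s z w)) _.
apply: etrans (mul_deck_mx P N s' z _) _; apply: etrans _ (esym (mul_deck_mx P N _ z w)).
have e : w *m sign_mx P s *m sign_mx P s' = w *m sign_mx P [ffun i => s i (+) s' i].
  by rewrite -mulmxA sign_mxM.
exact: (congr1 (fun u => row_mx z (2^-1 *: (z *m N) + u)) e).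
Qed.

Lemma deck_mx0 : deck_mx P N [ffun=> false] = 1%:M.
Proof.
rewrite /deck_mx /sign_mx (_ : sign_row _ _ = const_mx 1).
  by rewrite diag_const_mx mulmx1 mulVmx // subrr mulmx0 scaler0 -scalar_mx_block.
by apply/rowP => i; rewrite !mxE ffunE.
Qed.

Lemma deck_mx_all : deck_mx P N [ffun=> true] = block_mx 1%:M N 0 (- 1%:M).
Proof.
rewrite /deck_mx sign_mx_all // opprK; congr block_mx.
by rewrite mulmxDr mulmx1 -mulr2n -[N *+ 2]scaler_nat scalerA mulVf ?scale1r // pnatr_eq0.
Qed.

End Signs.

(** * Generators and the linear part of sigma *)

Section Generators.
Variables (R : realType) (p : nat).
Local Notation C := R[i].
Local Notation K := (R[i] : numFieldType).
Local Notation V := 'rV[K]_(p + p).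
Variables (P N : 'M[C]_p).
Hypothesis Pu : P \in unitmx.

(** If two coordinates were reflected, F would act as -1 on the plane they span, where
    [zero_not_isolated] finds zeros of u other than 0 arbitrarily close to 0; these would have to be
    fixed. *)
Lemma fixes_hypersurface_sign (F : V -> V) s i k : fixes_hypersurface F ->
  germ_eq F (fun x => x *m deck_mx P N s) -> s i -> s k -> i = k.
Proof.
move=> [u [/near0_rnorm[rho rho0 du] u0 _ uF]] FT si sk; apply/eqP/negPn/negP => ik.
have /near0_rnorm[d d0 dP] : \forall x \near (0 : V), u x = 0 -> x *m deck_mx P N s = x.
  by move: uF FT; apply: filterS2 => x Fx <-.
pose v l : V := row_mx 0 (row l P).
have m0 : 0 < rnorm (v i) + rnorm (v k) + 1 by rewrite ltr_wpDl // addr_ge0 ?rnorm_ge0.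
have d'0 : 0 < d / (rnorm (v i) + rnorm (v k) + 1) by rewrite divr_gt0.
have [a [b [ad bd uab]]] := zero_not_isolated (v i) (v k) rho0 du u0 d'0.
apply; have /dP/(_ uab) : rnorm (a *: v i + b *: v k) < d.
  apply: le_lt_trans (rnormD _ _) _; rewrite !rnormZ.
  rewrite -(divfK (lt0r_neq0 m0) d); move: ad bd; set d' := d / _ => ad bd.
  apply: le_lt_trans (_ : d' * (rnorm (v i) + rnorm (v k)) < _).
    by rewrite mulrDr lerD // ler_wpM2r ?rnorm_ge0 // ltW.
  by rewrite ltr_pM2l // ltrDl.
have -> : a *: v i + b *: v k =
    row_mx 0 (2^-1 *: (0 *m N) + (a *: row i P + b *: row k P)).
  by rewrite mul0mx scaler0 add0r !scale_row_mx add_row_mx !scaler0 addr0.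
rewrite mul_deck_mx => /eq_row_mx[_ /addrI].
rewrite mulmxDl -!scalemxAl !row_sign_mx // si sk !expr1 !scaleN1r !scalerN -opprD.
move/eqP; rewrite -subr_eq0 -opprD oppr_eq0 -mulr2n -scaler_nat scaler_eq0 pnatr_eq0 /=.
rewrite !rowE !scalemxAl -mulmxDl => /eqP/(congr1 (mulmx^~ (invmx P))).
rewrite mulmxK // mul0mx => /rowP ab0; split.
  by have := ab0 i; rewrite !mxE !eqxx (negbTE ik) mulr0 addr0 mulr1.
by have := ab0 k; rewrite !mxE !eqxx eq_sym (negbTE ik) mulr0 add0r mulr1.
Qed.

(** Each composition or germ identity may shrink the disc, so the radius depends on F and is
    produced by the induction. *)
Lemma generated_fixes_line (I : Type) (t : I -> V -> V) (v : V) :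
  (forall j, exists2 d : R, 0 < d & forall c : C, normc c < d -> t j (c *: v) = c *: v) ->
  forall F, germ_generated t F ->
  exists2 d : R, 0 < d & forall c : C, normc c < d -> F (c *: v) = c *: v.
Proof.
have both (P1 P2 : C -> Prop) : (exists2 d : R, 0 < d & forall c, normc c < d -> P1 c) ->
    (exists2 d : R, 0 < d & forall c, normc c < d -> P2 c) ->
    exists2 d : R, 0 < d & forall c, normc c < d -> P1 c /\ P2 c.
  move=> [d1 d10 h1] [d2 d20 h2]; exists (Num.min d1 d2); first by rewrite lt_min d10.
  by move=> c; rewrite lt_min => /andP[/h1 ? /h2 ?].
move=> tv F; elim=> [j|||F' G _ IH _ GF|F' G _ IH FG] //.
- by exists 1.
- move=> F' G _ IHF _ IHG; have [d d0 dP] := both _ _ IHF IHG.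
  by exists d => // c /dP[hF hG]; rewrite /= hG hF.
- have [d d0 dP] := both _ _ IH (near0_line v GF).
  by exists d => // c /dP[hF hG]; rewrite -[in LHS]hF; exact: hG.
- have [d d0 dP] := both _ _ IH (near0_line v FG).
  by exists d => // c /dP[hF hG]; rewrite -hG hF.
Qed.

End Generators.

Lemma rnorm_conjv (R : realType) n (x : 'rV[(R[i] : numFieldType)]_n) :
  rnorm (conjv x : 'rV[(R[i] : numFieldType)]_n) = rnorm x.
Proof.
congr (complex.Re _); rewrite /Num.norm /= !mx_normE; congr (_%:num).
apply: eq_bigr => i _; apply: val_inj; rewrite /= mxE; case: (x _ _) => a b.
by rewrite !normc_def /= sqrrN.
Qed.

Lemma mulmx_swap_block (F : fieldType) p (A N : 'M[F]_p) :
  (block_mx 0 1%:M 1%:M 0 : 'M[F]_(p + p)) *m block_mx 1%:M A 0 (- 1%:M) *m block_mx 0 1%:M 1%:M 0 *m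
    block_mx 1%:M N 0 (- 1%:M) = block_mx (- 1%:M) (- N) A (A *m N - 1%:M).
Proof.
have E1 : (block_mx 0 1%:M 1%:M 0 : 'M[F]_(p + p)) *m block_mx 1%:M A 0 (- 1%:M) =
    block_mx 0 (- 1%:M) 1%:M A.
  by rewrite mulmx_block !mul0mx !mul1mx !add0r !addr0.
have E2 : (block_mx 0 (- 1%:M) 1%:M A : 'M[F]_(p + p)) *m block_mx 0 1%:M 1%:M 0 =
    block_mx (- 1%:M) 0 A 1%:M.
  by rewrite mulmx_block !mul0mx !mulmx0 !mulmx1 !add0r !addr0.
rewrite E1 E2 mulmx_block !mul0mx !mulmx0 !mul1mx !mulmx1 !addr0.
by congr block_mx; rewrite mulNmx mul1mx.
Qed.

Section Sigma.
Variables (R : realType) (p : nat).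
Local Notation C := R[i].
Local Notation K := (R[i] : numFieldType).
Local Notation V := 'rV[K]_(p + p).

Lemma near0_conj_linear (P : V -> Prop) (S : 'M[C]_(p + p)) : (\forall x \near (0 : V), P x) ->
  \forall x \near (0 : V), P (conjv x *m S).
Proof.
have dS : differentiable (fun x : V => x *m S) 0 by exact: differentiable_mulmxr.
move=> /(near_germ_comp (mul0mx _ S) dS)/near0_rnorm[d d0 dP].
apply/near0_rnorm; exists d => // x xd; apply: dP.
by rewrite rnorm_conjv.
Qed.

Definition swap_mx : 'M[C]_(p + p) := block_mx 0 1%:M 1%:M 0.

Lemma rho0E (x : V) : rho0 x = conjv x *m swap_mx.
Proof.
rewrite -{2}[x]hsubmxK /rho0 /swap_mx /conjv map_row_mx mul_row_block.
by rewrite !mulmx0 !mulmx1 addr0 add0r.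
Qed.

Definition sigma_mx (N : 'M[C]_p) : 'M[C]_(p + p) :=
  block_mx (- 1%:M) (- N) (conjv N) (conjv N *m N - 1%:M).

Variables (H K' : 'I_p -> 'M[C]_p) (P N : 'M[C]_p).
Hypothesis q0 : [set w | qmap K' w = 0] = [set 0].
Hypothesis maxd : max_deck H K'.
Hypothesis Pu : P \in unitmx.
Hypothesis deckE : forall T, linear_deck H K' T -> exists s, T = deck_mx P N s.
Hypothesis deckP : forall s, linear_deck H K' (deck_mx P N s).
Variable t : 'I_p -> V -> V.
Hypothesis genP : deck_generators H K' t.

(* Each t j reflects at most one row of P; were row i reflected by none of them,
   the whole group they generate would fix it. *)
Lemma generator_signs : exists2 S : 'I_p -> {ffun 'I_p -> bool},
  forall j, germ_eq (t j) (fun x => x *m deck_mx P N (S j)) &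
  forall i, exists2 j, S j i & forall j', j' != j -> S j' i = false.
Proof.
have [tdeck tfix tgen] := genP.
have /choice[S SE] : forall j, exists s, germ_eq (t j) (fun x => x *m deck_mx P N s).
  move=> j; have [T lT tT] := deck_is_linear maxd (tdeck j).
  by have [s sE] := deckE lT; exists s; rewrite -sE.
exists S => //.
have Suniq j i k : S j i -> S j k -> i = k by exact: fixes_hypersurface_sign (tfix j) (SE j).
have /choice[f fS] : forall i, exists j, S j i.
  move=> i; apply: contrapT => noj.
  pose v : V := row_mx 0 (row i P).
  have vT s : v *m deck_mx P N s = (-1) ^+ s i *: v.
    have := mul_deck_mx P N s 0 (row i P).
    rewrite mul0mx scaler0 !add0r => ->.
    by rewrite row_sign_mx // scale_row_mx scaler0.
  have tv j : exists2 d : R, 0 < d & forall c : C, normc c < d -> t j (c *: v) = c *: v.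
    have [d d0 dP] := near0_line v (SE j); exists d => // c /dP ->.
    rewrite -scalemxAl vT (_ : S j i = false) ?scale1r //.
    by apply/negP => Sji; apply: noj; exists j.
  have [d d0 dP] := generated_fixes_line tv (tgen _ (deck_linear q0 (deckP [ffun l => l == i]))).
  have := dP (d / 2)%:C%C; rewrite -scalemxAl vT ffunE eqxx expr1 normc_real.
  rewrite gtr0_norm ?divr_gt0 // => /(_ _)/wrap[]; first by rewrite ltr_pdivrMr // ltr_pMr // ltr1n.
  move=> /eqP; rewrite scaleN1r scalerN eq_sym -addr_eq0 -mulr2n -[_ *+ 2]scaler_nat !scaler_eq0.
  rewrite pnatr_eq0 /= eq_complex /= eqxx andbT mulf_eq0 invr_eq0 (gt_eqF d0) pnatr_eq0 /=.
  move=> /eqP/(congr1 (fun x : V => rsubmx x)); rewrite row_mxKr linear0 rowE => iP.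
  have : delta_mx 0 i *m P *m invmx P = 0 :> 'rV_p by rewrite iP mul0mx.
  rewrite mulmxK // => /rowP/(_ i); rewrite !mxE !eqxx => /eqP.
  by rewrite oner_eq0.
(* There are as many rows as generators, so this injection is a bijection and each row is reflected
   by one generator only. *)
have finj : injective f by move=> i k ik; apply: (Suniq (f i)); [exact: fS|rewrite ik; exact: fS].
have [g gK fK] := injF_bij finj.
move=> i; exists (f i) => // j' j'i; apply/negP => Sj'i; move: j'i; rewrite -(fK j').
by rewrite (Suniq j' i (g j') Sj'i) ?eqxx // -{1}(fK j') fS.
Qed.

(** Composition adds sign patterns modulo 2, and each coordinate is flipped by exactly one
    generator, so the product flips all of them. *)
Lemma tau1_germ : germ_eq (tau1 t) (fun x => x *m block_mx 1%:M N 0 (- 1%:M)).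
Proof.
have [S SE Suniq] := generator_signs.
have comp r : germ_eq (\big[(fun F G : V -> V => F \o G)/id]_(j <- r) t j)
    (fun x => x *m deck_mx P N [ffun i => \big[addb/false]_(j <- r) S j i]).
  elim: r => [|j r IH].
    rewrite big_nil (_ : [ffun i => _] = [ffun=> false]).
      by rewrite deck_mx0 //; apply: filterE => x; rewrite mulmx1.
    by apply/ffunP => i; rewrite !ffunE big_nil.
  rewrite big_cons; move: IH; set s := [ffun i => _] => IH.
  rewrite (_ : [ffun i => _] = [ffun i => s i (+) S j i]); last first.
    by apply/ffunP => i; rewrite !ffunE big_cons addbC.
  have := near_germ_comp (mul0mx _ (deck_mx P N s)) (differentiable_mulmxr _ _) (SE j).
  move: IH; apply: filterS2 => x /= ->; rewrite -mulmxA deck_mxM //.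
rewrite -(deck_mx_all N Pu) (_ : [ffun=> true] = [ffun i => \big[addb/false]_j S j i]).
  exact: comp.
apply/ffunP => i; rewrite !ffunE; have [j Sji jU] := Suniq i.
by rewrite (bigD1 j) //= big1 ?Sji //.
Qed.

Lemma sigma_jacobian : 'J (sigma t) 0 = sigma_mx N.
Proof.
apply: germ_linear_jacobian; pose T : 'M[C]_(p + p) := block_mx 1%:M N 0 (- 1%:M).
have tT : germ_eq (tau1 t) (fun x => x *m T) by exact: tau1_germ.
(* Matrices act on row vectors, so the factors stand in the order of application; moving the
   conjugation of [rho0] past T conjugates it, and the second [rho0] undoes the conjugation of x. *)
have SE : sigma_mx N = swap_mx *m conjv T *m swap_mx *m T.
  rewrite /T /conjv map_block_mx map_mx1 map_mxN map_mx1 map_mx0; exact: esym (mulmx_swap_block _ _).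
have h1 := near0_conj_linear swap_mx tT.
have h2 := near_germ_comp (mul0mx _ (swap_mx *m conjv T *m swap_mx))
  (differentiable_mulmxr _ _) tT.
move: h1 h2; apply: filterS2 => x e1 e2.
have cs : conjv swap_mx = swap_mx.
  by rewrite /conjv map_block_mx !map_mx0 !map_mx1.
rewrite /sigma /tau2 /= (rho0E x) e1 rho0E SE [RHS]mulmxA -e2; congr (tau1 t _).
by rewrite !conjvM conjvK cs !mulmxA.
Qed.

End Sigma.

(** * The normal form of M *)

Section SigmaEigenvalues.
Variables (R : realType) (p : nat).
Local Notation C := R[i].
Implicit Types N : 'M[C]_p.

Lemma not_unitmx_eigenvalue0 N (A : 'M[C]_p) : N \notin unitmx -> eigenvalue (N *m A) 0.
Proof.
move=> /not_unitmx_kernel[v v0 vN]; apply/eigenvalueP; exists v => //.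
by rewrite mulmxA vN mul0mx scale0r.
Qed.

(** Eliminating w from the two halves of the equation gives m z N conj(N) = (1 + m)^2 z. If z = 0,
    then m = -1 and w conj(N) = 0, so N is singular and 0 is the eigenvalue sought. *)
Lemma sigma_mx_eigenvalue N (m : C) : eigenvalue (sigma_mx N) m ->
  m != 0 /\ eigenvalue (N *m conjv N) ((1 + m) ^+ 2 / m).
Proof.
move=> /eigenvalueP[v]; rewrite -[v]hsubmxK; move: (lsubmx v) (rsubmx v) => z w.
rewrite /sigma_mx mul_row_block scale_row_mx => /eq_row_mx[zE wE] zw0.
have wN : w *m conjv N = (1 + m) *: z.
  by rewrite scalerDl scale1r -zE mulmxN mulmx1 addrA subrr add0r.
have zN : m *: (z *m N) = (1 + m) *: w.
  rewrite scalerDl scale1r -wE mulmxBr mulmx1 mulmxA wN -scalemxAl scalerDl scale1r mulmxN.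
  rewrite -[_ + _ - w]addrA addKr. by rewrite [RHS]addrC subrK.
have zz : m *: (z *m (N *m conjv N)) = (1 + m) ^+ 2 *: z.
  by rewrite mulmxA scalemxAl zN -scalemxAl wN scalerA expr2.
have [z0|z0] := eqVneq z 0.
  move: zN wN; rewrite z0 mul0mx !scaler0 => /esym/eqP; rewrite scaler_eq0.
  have w0 : w != 0 by apply: contraNneq zw0 => ->; rewrite z0 row_mx0.
  rewrite (negbTE w0) orbF addrC addr_eq0 => /eqP-> wN; split; first by rewrite oppr_eq0 oner_eq0.
  rewrite addNr expr0n mul0r; apply: not_unitmx_eigenvalue0.
  apply/negP => Nu; move: wN => /(congr1 (mulmx^~ (conjv (invmx N)))).
  by rewrite -mulmxA -conjvM mulmxV // conjv1 mulmx1 mul0mx => /eqP; rewrite (negbTE w0).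
have m0 : m != 0.
  apply: contraNneq z0 => m0; move: zN wN; rewrite m0 scale0r addr0 !scale1r => <-.
  by rewrite mul0mx => <-.
split => //; apply/eigenvalueP; exists z => //.
by rewrite mulrC -scalerA -zz scalerA mulVf // scale1r.
Qed.

Lemma sigma_eigenvalue_fiber (m n : C) : m != 0 -> n != 0 ->
  (1 + m) ^+ 2 / m = (1 + n) ^+ 2 / n -> m = n \/ m = n^-1.
Proof.
move=> m0 n0 /eqP; rewrite eqr_div // -subr_eq0.
have -> : (1 + m) ^+ 2 * n - (1 + n) ^+ 2 * m = (m - n) * (m * n - 1) by ring.
rewrite mulf_eq0 !subr_eq0 => /orP[/eqP|/eqP mn]; first by left.
by right; rewrite -[LHS](mulfK n0) mn mul1r.
Qed.

(** If k values of (1 + m)^2 / m occur and g of them avoid 0 and 4, then 2p <= k + g <= 2k <= 2p;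
    hence k = g = p. Were N singular, 0 would be one eigenvalue too many. *)
Lemma sigma_distinct_eigenvalues N : distinct_eigenvalues (sigma_mx N) ->
  N \in unitmx /\ exists lam : p.-tuple C, [/\ uniq lam, all (eigenvalue (N *m conjv N)) lam &
    forall l, l \in lam -> l != 0 /\ l != 4].
Proof.
move=> [mu [umu /allP emu]].
pose lm (m : C) : C := (1 + m) ^+ 2 / m.
pose ls := undup [seq lm m | m <- mu].
have lsE l : l \in ls -> exists2 m, m \in mu & l = lm m.
  by rewrite mem_undup => /mapP[m ? ->]; exists m.
have els : all (eigenvalue (N *m conjv N)) ls.
  by apply/allP => l /lsE[m /emu/sigma_mx_eigenvalue[_ ?] ->].
have sls : (size ls <= p)%N by exact: size_eigenvalues (undup_uniq _) els.
have /choice[r rP] : forall l : C, exists m : C, l \in ls -> m \in mu /\ l = lm m.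
  move=> l; case L : (l \in ls); last by exists 0.
  by have [m ? ?] := lsE _ L; exists m.
pose good (l : C) := (l != 0) && (l != 4 :> C).
(* Over 0 and 4 the fibre is {-1} and {1}, where m and 1 / m coincide; only the other values
   contribute a second point. *)
have sub : {subset mu <= map r ls ++ map (fun l => (r l)^-1) [seq l <- ls | good l]}.
  move=> m mmu; have lml : lm m \in ls by rewrite mem_undup map_f.
  have [rmu lr] := rP _ lml.
  have [m0 _] := sigma_mx_eigenvalue (emu _ mmu).
  have [r0 _] := sigma_mx_eigenvalue (emu _ rmu).
  rewrite mem_cat; have [->|mr] := sigma_eigenvalue_fiber m0 r0 lr.
    by rewrite map_f.
  case G : (good (lm m)).
    by apply/orP; right; apply/mapP; exists (lm m) => //; rewrite mem_filter G.
  suff -> : m = r (lm m) by rewrite map_f.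
  move: (r (lm m)) r0 mr lr G {rmu} => x x0 -> -> /negbT; rewrite negb_and !negbK.
  case/orP; rewrite /lm => /eqP.
    move/eqP; rewrite mulf_eq0 invr_eq0 (negbTE x0) orbF expf_eq0 /=.
    by rewrite addrC addr_eq0 => /eqP ->; rewrite invrN invr1.
  move=> /(canRL (divfK x0))/eqP; rewrite -subr_eq0.
  have -> : (1 + x) ^+ 2 - 4 * x = (x - 1) ^+ 2 :> C by ring.
  by rewrite expf_eq0 /= subr_eq0 => /eqP ->; rewrite invr1.
have := uniq_leq_size umu sub; rewrite size_cat !size_map size_tuple size_filter => le.
have cl := count_size good ls.
have cls : count good ls = size ls.
  by apply/eqP; rewrite eqn_leq cl -(leq_add2l (size ls)) (leq_trans (leq_add sls sls) le).
have sp : size ls = p.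
  by apply/eqP; rewrite eqn_leq sls -leq_double -!addnn -{2}cls le.
have gls : all good ls by rewrite all_count cls.
split.
  case U : (N \in unitmx) => //.
  have E0 : eigenvalue (N *m conjv N) 0 by apply: not_unitmx_eigenvalue0; rewrite U.
  have : (size (0%R :: ls) <= p)%N.
    apply: (@size_eigenvalues _ _ (N *m conjv N)); rewrite /= ?els ?E0 ?undup_uniq ?andbT //.
    by apply/negP => /(allP gls); rewrite /good eqxx.
  by rewrite /= sp ltnn.
exists (Tuple (introT eqP sp)); split => //; first exact: undup_uniq.
by move=> l /(allP gls)/andP.
Qed.

End SigmaEigenvalues.

(** * Reduction of M to a quadric Q *)

Section Shear.
Variables (k : numFieldType) (p : nat).
Local Notation Cp := 'rV[k]_p.
Local Notation V := 'rV[k]_(p + p).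

Definition shear (e : Cp -> Cp) (M : 'M[k]_p) (x : V) : V :=
  row_mx (lsubmx x) ((rsubmx x + e (lsubmx x)) *m M).

Lemma shear_differentiable e M : (forall z, differentiable e z) ->
  forall x : V, differentiable (shear e M) x.
Proof.
move=> de x.
pose L : 'M[k]_(p + p, p) := col_mx 1%:M 0.
pose S : 'M[k]_(p, p + p) := row_mx 0 M.
have LE (y : V) : lsubmx y = y *m L by rewrite -{2}[y]hsubmxK mul_row_col mulmx1 mulmx0 addr0.
have -> : shear e M = fun y => y *m block_mx 1%:M 0 0 M + e (y *m L) *m S.
  apply/funext => y; have BE : y *m block_mx 1%:M 0 0 M = row_mx (lsubmx y) (rsubmx y *m M).
    by rewrite -{1}[y]hsubmxK mul_row_block !mulmx0 mulmx1 addr0 add0r.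
  by rewrite BE -LE mul_mx_row mulmx0 add_row_mx addr0 -mulmxDl.
apply: differentiableD; first exact: differentiable_mulmxr.
apply: (@differentiable_comp _ _ _ _ (fun y : V => e (y *m L)) (fun u : Cp => u *m S)).
  apply: (@differentiable_comp _ _ _ _ (fun y : V => y *m L) e); last exact: de.
  exact: differentiable_mulmxr.
exact: differentiable_mulmxr.
Qed.

Lemma shear_biholo e M : M \in unitmx -> e 0 = 0 -> (forall z, differentiable e z) ->
  germ_biholo (shear e M).
Proof.
move=> Mu e0 de; pose e' z := - e z *m M.
have de' z : differentiable e' z.
  apply: (@differentiable_comp _ _ _ _ (fun y : Cp => - e y) (fun u : Cp => u *m M)).
    exact: differentiableN.
  exact: differentiable_mulmxr.
have s0 (f : Cp -> Cp) S : f 0 = 0 -> shear f S 0 = 0.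
  by move=> f0; rewrite /shear !linear0 f0 addr0 mul0mx row_mx0.
split; [exact: s0|by apply: filterE => x; exact: shear_differentiable|].
exists (shear e' (invmx M)); split.
- by apply: s0; rewrite /e' e0 oppr0 mul0mx.
- by apply: filterE => x; exact: shear_differentiable.
- apply: filterE => x; rewrite /shear /= row_mxKl row_mxKr /e' [(_ + _) *m invmx M]mulmxDl mulmxK //.
  by rewrite subrK mulmxKV // hsubmxK.
- apply: filterE => x; rewrite /shear /= row_mxKl row_mxKr /e' -mulmxDl addrK.
  by rewrite mulmxK // hsubmxK.
Qed.

End Shear.

Section NormalQuadric.
Variables (R : realType) (p : nat).
Local Notation C := R[i].
Local Notation K := (R[i] : numFieldType).
Local Notation Cp := 'rV[K]_p.
Variables (H K' : 'I_p -> 'M[C]_p).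

Lemma Emap_differentiable (M : 'M[C]_p) (z : Cp) :
  differentiable (fun z : Cp => Emap H K' z (z *m M) : Cp) z.
Proof.
apply: differentiable_coords => j.
pose c (l : 'I_p) := fun y : Cp => (y *m M) 0 l : K^o.
have dc l : differentiable (c l) z.
  exact: (@differentiable_coord_comp _ _ _ (fun y : Cp => y *m M) l z (differentiable_mulmxr M z)).
have dz (l : 'I_p) : differentiable (fun y : Cp => y 0 l : K^o) z by exact: differentiable_coord.
have -> : (fun y : Cp => Emap H K' y (y *m M) 0 j : K^o) =
    (fun y : Cp => \sum_a \sum_b (H j a b * y 0 a * c b y : K^o)) +
    (fun y : Cp => \sum_a \sum_b (K' j a b * c a y * c b y : K^o)).
  by apply/funext => y; rewrite fctE /Emap /hmap /qmap !mxE.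
by apply: differentiableD; apply: differentiable_bigsum => a; apply: differentiable_bigsum => b;
  do 2! [apply: differentiableM => //]; exact: differentiable_cst.
Qed.

Variables (P N : 'M[C]_p).
Hypothesis q0 : [set w | qmap K' w = 0] = [set 0].
Hypothesis Pu : P \in unitmx.
Hypothesis Nu : N \in unitmx.
Hypothesis deckP : forall s, linear_deck H K' (deck_mx P N s).

Lemma quadM_equiv_quadQ : exists2 A, A \in unitmx &
  holo_equiv (quadM H K') (quadQ A (invmx N^T)).
Proof.
have Su := square_mx_unit q0 Pu deckP.
pose e (z : Cp) : Cp := - Emap H K' z (z *m (2^-1 *: N)).
have de z : differentiable e z by apply: differentiableN; exact: Emap_differentiable.
have e0 : e 0 = 0.
  rewrite /e mul0mx Emap0; apply/eqP; rewrite oppr_eq0; apply/eqP/rowP => j.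
  by rewrite !mxE big1 // => a _; rewrite big1 // => b _; rewrite !mxE mulr0.
(* With this A and G = (N^T)^-1, the row [Lmap] is -(1/2) z N P^-1 + conj(z) P^-1, the coordinates
   of conj(z) - z N / 2 in the basis of rows of P. *)
pose A := (- 2^-1) *: (N *m invmx P)^T.
exists A.
  rewrite unitmxZ ?unitfE ?oppr_eq0 ?invr_eq0 ?pnatr_eq0 // unitmx_tr unitmx_mul Nu.
  by rewrite unitmx_inv.
exists (shear e (invmx (square_mx K' P))).
  by apply: shear_biholo => //; rewrite unitmx_inv.
apply: filterE => x; rewrite /quadM /quadQ /shear /= !row_mxKl row_mxKr.
move: (lsubmx x) (rsubmx x) => z x''.
pose y := (conjv z - 2^-1 *: (z *m N)) *m invmx P.
have LE : Lmap A (invmx N^T) z (conjv z) = y.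
  rewrite /Lmap trmx_mul linearB linearZ /= trmx_mul.
  have -> : A^T = - 2^-1 *: (N *m invmx P) by rewrite /A linearZ /= trmxK.
  rewrite !trmxK trmx_inv trmxK.
  rewrite -scalemxAr mulmxBl -!scalemxAl !mulmxA mulmxKV //.
  rewrite scalerBr scalerA mulNr mulVf ?pnatr_eq0 // scaleN1r opprK addrC scaleNr.
  by rewrite /y mulmxBl -scalemxAl.
have zE : conjv z = 2^-1 *: (z *m N) + y *m P.
  by rewrite /y mulmxKV // addrC subrK.
rewrite {1}zE (Emap_squares Pu deckP) LE.
have eE : e z = - Emap H K' z (2^-1 *: (z *m N)) by rewrite /e -scalemxAr.
rewrite eE; split=> [->|h].
  by move=> j; rewrite addrAC addrN add0r mulmxK // mxE.
have : (x'' - Emap H K' z (2^-1 *: (z *m N))) *m invmx (square_mx K' P) = \row_k y 0 k ^+ 2.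
  by apply/rowP => j; rewrite h [RHS]mxE.
move/(congr1 (mulmx^~ (square_mx K' P))); rewrite mulmxKV // => <-.
by rewrite [RHS]addrC subrK.
Qed.

End NormalQuadric.

Lemma eigenvalue_trmx (F : fieldType) n (A : 'M[F]_n) x : eigenvalue A^T x = eigenvalue A x.
Proof.
rewrite !eigenvalue_root_char; congr (root _ _); rewrite /char_poly.
rewrite (_ : char_poly_mx A^T = (char_poly_mx A)^T) ?det_tr //.
by apply/matrixP => i j; rewrite !mxE eq_sym.
Qed.

Section ConditionE.
Variables (R : realType) (p : nat).
Local Notation C := R[i].

Lemma conditionE_quadQ (H K : 'I_p -> 'M[C]_p) : conditionE H K ->
  exists N A (lam : p.-tuple C), [/\ N \in unitmx, A \in unitmx,
    holo_equiv (quadM H K) (quadQ A (invmx N^T)) &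
    [/\ uniq lam, all (eigenvalue (N *m conjv N)) lam &
      forall l, l \in lam -> l != 0 /\ l != 4]].
Proof.
move=> [q0 maxd [t gt sd]].
have [P [N [Pu dE dP]]] := linear_deck_normal_form q0 maxd.
move: sd; rewrite (sigma_jacobian q0 maxd Pu dE dP gt).
move=> /sigma_distinct_eigenvalues[Nu [lam lamP]].
have [A Au MA] := quadM_equiv_quadQ q0 Pu Nu dP.
by exists N, A, lam.
Qed.

(** The product is the inverse of the transpose of N conj(N), so its eigenvalues are the inverses of
    [lam]. *)
Lemma distinct_eigenvalues_inv_tr (N : 'M[C]_p) (lam : p.-tuple C) : N \in unitmx ->
  uniq lam -> all (eigenvalue (N *m conjv N)) lam -> (forall l, l \in lam -> l != 0 /\ l != 4) ->
  distinct_eigenvalues (invmx N^T *m conjv (invmx N^T)).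
Proof.
move=> Nu ulam /allP elam lam0; exists (map_tuple (fun x : C => x^-1) lam); split.
  by rewrite map_inj_uniq //; exact: invr_inj.
apply/allP => _ /mapP[l llam ->]; have [l0 _] := lam0 _ llam.
have /eigenvalueP[v vE v0] : eigenvalue (N *m conjv N)^T l.
  by rewrite eigenvalue_trmx elam.
apply/eigenvalueP; exists v => //.
have NTu : N^T \in unitmx by rewrite unitmx_tr.
have cNu : (conjv N)^T \in unitmx by rewrite unitmx_tr conjv_unitmx.
apply: (scalerI l0); rewrite scalerA divff // scale1r !scalemxAl -vE.
rewrite trmx_mul !mulmxA mulmxK // conjv_invmx conjv_tr //.
by rewrite mulmxK.
Qed.

End ConditionE.

Theorem theorem1p1 (R : realType) (p : nat) (H K : 'I_p -> 'M[R[i]]_p) :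
  conditionE H K ->
  (exists (e h s : nat) (Ep : (e + h + (s + s))%N = p)
          (ge : 'rV[R]_e) (gh : 'rV[R]_h) (gs : 'rV[R[i]]_s),
      gamma_range ge gh gs /\
      exists2 B : 'M[R[i]]_p, B \in unitmx &
        holo_equiv (quadM H K) (quadQ B (gamma_mx Ep ge gh gs))) /\
  (forall (e h s : nat) (Ep : (e + h + (s + s))%N = p)
          (ge : 'rV[R]_e) (gh : 'rV[R]_h) (gs : 'rV[R[i]]_s),
      gamma_range ge gh gs ->
      (exists2 B : 'M[R[i]]_p, B \in unitmx &
        holo_equiv (quadM H K) (quadQ B (gamma_mx Ep ge gh gs))) ->
      forall B B' : 'M[R[i]]_p, B \in unitmx -> B' \in unitmx ->
        (holo_equiv (quadQ B (gamma_mx Ep ge gh gs))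
                    (quadQ B' (gamma_mx Ep ge gh gs)) <->
         B_equiv Ep B B')).
Proof.
move=> /conditionE_quadQ[N [A [lam [Nu Au MA [ulam elam lam04]]]]].
have NTu : N^T \in unitmx by rewrite unitmx_tr.
split.
  have [e [h [s [Ep [ge [gh [gs [P [rg Pu PE]]]]]]]]] :=
    consimilarity_normal_form ulam elam lam04.
  exists e, h, s, Ep, ge, gh, gs; split=> //; exists (A *m P).
    by rewrite unitmx_mul Au.
  apply: holo_equiv_trans MA _.
  (* The equation conj(P) = N^T P gamma says that gamma is the consimilarity transform of (N^T)^-1
     produced by [quadQ_change_basis]. *)
  have GE : invmx P *m invmx N^T *m conjv P = gamma_mx Ep ge gh gs.
    by rewrite PE; move: (gamma_mx _ _ _ _) => g; rewrite !mulmxA mulmxKV // mulVmx // mul1mx.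
  by rewrite -GE; exact: quadQ_change_basis.
move=> e h s Ep ge gh gs rg [B0 B0u MB]; apply: quadQ_gamma_equivP => //.
have gu : gamma_mx Ep ge gh gs \in unitmx by exact: gamma_mx_unitmx.
have AB := holo_equiv_trans (holo_equiv_sym MA) MB.
apply: quadQ_equiv_distinct Au _ B0u gu AB _; first by rewrite unitmx_inv.
exact: distinct_eigenvalues_inv_tr elam lam04.
Qed.
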